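(* Let $n,k\ge1$, $m\ge0$, and let $\Omega\subseteq\mathbb C^{n+m}$ be a domain which is $n$-star-shaped Hartogs in the first $n$ variables $z=(z_1,\dots,z_n)$; write points as $(z,z')$, $z'\in\mathbb C^m$. Let $\alpha_j>0$ ($1\le j\le n$) and $$U^\alpha=\{(z,z',w)\in\mathbb C^{n+m}\times\mathbb C^k:(f_\alpha(z,w),z')\in\Omega,\ \|w\|<1\},\quad f_\alpha(z,w)=\Big(\frac{z_1}{(1-\|w\|^2)^{\alpha_1/2}},\dots,\frac{z_n}{(1-\|w\|^2)^{\alpha_n/2}}\Big).$$ For $\|\eta\|<1$ let $U^\alpha_\eta=\{(z,z'):(z,z',\eta)\in U^\alpha\}$ with Bergman kernel $K_{U^\alpha_\eta}$. Define $$h(z,w,\eta)=\Big(z_1\Big(\frac{1-\|\eta\|^2}{1-\langle w,\eta\rangle}\Big)^{\alpha_1},\dots,z_n\Big(\frac{1-\|\eta\|^2}{1-\langle w,\eta\rangle}\Big)^{\alpha_n}\Big)$$ and $$D_{U^\alpha}=\frac{(1-\|\eta\|^2)^{\alpha\cdot\mathbf 1}}{\pi^k(1-\langle w,\eta\rangle)^{k+1+\alpha\cdot\mathbf 1}}\prod_{j=1}^k\Big(jI+\sum_{l=1}^n\alpha_l\Big(I+z_l\frac{\partial}{\partial z_l}\Big)\Big).$$ Then for all $(z,z',w;\zeta,\zeta',\eta)\in U^\alpha\times U^\alpha$, $$K_{U^\alpha}(z,z',w;\bar\zeta,\bar\zeta',\bar\eta)=D_{U^\alpha}\Big[K_{U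^\alpha_\eta}\big(h(z,w,\eta),z';\bar\zeta,\bar\zeta'\big)\Big].$$
   Context: A domain $\Omega\subseteq\mathbb C^{n+m}$ is $n$-star-shaped Hartogs in $(z_1,\dots,z_n)$ if $(z_1,\dots,z_n,\zeta)\in\Omega$ implies $(\lambda_1z_1,\dots,\lambda_nz_n,\zeta)\in\Omega$ for all $|\lambda_j|\le1$. $\langle w,\eta\rangle=\sum_{i=1}^k w_i\bar\eta_i$, $\alpha\cdot\mathbf 1=\sum_j\alpha_j$, $I$ is the identity operator; powers of $1-\langle w,\eta\rangle$ (positive real part) use the principal branch. The Bergman kernel is the reproducing kernel of the space of square-integrable holomorphic functions. The operator acts on the function $(z,z',w)\mapsto K_{U^\alpha_\eta}(h(z,w,\eta),z';\bar\zeta,\bar\zeta')$, with $\partial/\partial z_l$ differentiating in $z_l$. *)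

(* Defs.v *)
(* MathComp + MathComp-Analysis; complex numbers are R[i] (mathcomp-real-closed). *)
From mathcomp Require Import all_boot all_order all_algebra.
From mathcomp Require Import all_classical all_reals all_analysis.
From mathcomp Require Export complex.
Import Order.TTheory GRing.Theory Num.Theory.

Set Implicit Arguments.
Unset Strict Implicit.
Unset Printing Implicit Defensive.

Local Open Scope ring_scope.
Local Open Scope classical_set_scope.

Section Defs.
Variable R : realType.
Local Notation C := R[i].

(* ---------- complex numbers ---------- *)
(* embedding R -> C *)
Definition rc (x : R) : C := complex.Complex x 0.
(* real-valued modulus *)
Definition cabs (z : C) : R := Num.sqrt (complex.Re z ^+ 2 + complex.Im z ^+ 2).
(* complex exponential of a purely imaginary number: e^{i t} *)
Definition cexpi (t : R) : C := complex.Complex (cos t) (sin t).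
(* principal argument Arg z in (-pi, pi] (atan2) *)
Definition carg (z : C) : R :=
  let x := complex.Re z in let y := complex.Im z in
  if 0 < x then atan (y / x)
  else if x < 0 then (if 0 <= y then atan (y / x) + pi else atan (y / x) - pi)
  else (if 0 < y then pi / 2 else if y < 0 then - (pi / 2) else 0).
(* principal branch power z^a (a real), z <> 0 *)
Definition cpow (z : C) (a : R) : C := rc (powR (cabs z) a) * cexpi (a * carg z).

(* ---------- points of C^N ---------- *)
Definition pt (N : nat) := 'I_N -> C.

Definition join2 (a b : nat) (x : pt a) (y : pt b) : pt (a + b) :=
  fun i => match fintype.split i with inl i1 => x i1 | inr i2 => y i2 end.
Definition lpart (a b : nat) (p : pt (a + b)) : pt a := fun i => p (lshift b i).
Definition rpart (a b : nat) (p : pt (a + b)) : pt b := fun i => p (rshift a i).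

(* ||x||^2 and the hermitian product <w, eta> = sum w_i conj(eta_i) *)
Definition sqnorm (N : nat) (x : pt N) : R := \sum_(i < N) cabs (x i) ^+ 2.
Definition herm (N : nat) (w eta : pt N) : C := \sum_(i < N) w i * (eta i)^*.

(* ---------- topology of C^N ---------- *)
Definition cball (N : nat) (p : pt N) (d : R) : set (pt N) :=
  [set q | forall j, cabs (q j - p j) < d].
Definition copen (N : nat) (O : set (pt N)) : Prop :=
  forall p, O p -> exists d : R, 0 < d /\ cball p d `<=` O.
Definition cconnected (N : nat) (O : set (pt N)) : Prop :=
  forall A B : set (pt N), copen A -> copen B -> O `<=` A `|` B ->
    O `&` A !=set0 -> O `&` B !=set0 -> O `&` A `&` B !=set0.
(* a domain = nonempty connected open set *)
Definition cdomain (N : nat) (O : set (pt N)) : Prop :=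
  copen O /\ cconnected O /\ O !=set0.

(* ---------- holomorphy: complex (Frechet) differentiability at every point ---------- *)
Definition holomorphic_on (N : nat) (O : set (pt N)) (f : pt N -> C) : Prop :=
  forall p, O p -> exists a : pt N, forall e : R, 0 < e -> exists d : R, 0 < d /\
    forall h : pt N, (forall j, cabs (h j) < d) ->
      cabs (f (fun j => p j + h j) - f p - \sum_(j < N) a j * h j)
        <= e * \sum_(j < N) cabs (h j).

(* ---------- Lebesgue integration over C^N = R^(2N) ---------- *)
Definition ccons (N : nat) (c : C) (p : pt N) : pt N.+1 :=
  fun i => match unlift ord0 i with Some j => p j | None => c end.

(* Lebesgue integral over C^N of a real function, computed as the iterated
   integral over the real coordinates x_1, y_1, x_2, y_2, ... (z_j = x_j + i y_j) *)
Fixpoint lint (N : nat) : (pt N -> R) -> \bar R :=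
  match N return (pt N -> R) -> \bar R with
  | 0 => fun F => (F (fun _ => 0))%:E
  | N'.+1 => fun F =>
      (\int[@lebesgue_measure R]_x \int[@lebesgue_measure R]_y
          lint (fun p => F (ccons (complex.Complex x y) p)))%E
  end.

Definition indic (N : nat) (O : set (pt N)) (p : pt N) : R :=
  if `[< O p >] then 1 else 0.

(* integral over O of a complex-valued function *)
Definition cint (N : nat) (O : set (pt N)) (f : pt N -> C) : C :=
  complex.Complex (fine (lint (fun p => indic O p * complex.Re (f p))))
                  (fine (lint (fun p => indic O p * complex.Im (f p)))).

(* Bergman space A^2(O) *)
Definition bergman_space (N : nat) (O : set (pt N)) (f : pt N -> C) : Prop :=
  holomorphic_on O f /\ (lint (fun p => (indic O p * cabs (f p) ^+ 2)%R) < +oo)%E.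

(* K is the Bergman kernel of O: K z zeta = K(z, \bar zeta), holomorphic in z, and
   reproducing: f(zeta) = int_O f(z) conj(K(z, \bar zeta)) dV(z) for all f in A^2(O). *)
Definition bergman_kernel (N : nat) (O : set (pt N)) (K : pt N -> pt N -> C) : Prop :=
  forall zeta, O zeta ->
    bergman_space O (fun z => K z zeta) /\
    forall f, bergman_space O f -> f zeta = cint O (fun z => f z * (K z zeta)^*).

(* ---------- the objects of the theorem ---------- *)
Definition nstar_hartogs (n m : nat) (Om : set (pt (n + m))) : Prop :=
  forall (z : pt n) (z' : pt m) (lam : pt n), (forall j, cabs (lam j) <= 1) ->
    Om (join2 z z') -> Om (join2 (fun j => lam j * z j) z').

Definition f_alpha (n k : nat) (alpha : 'I_n -> R) (z : pt n) (w : pt k) : pt n :=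
  fun j => z j / rc (powR (1 - sqnorm w) (alpha j / 2)).

(* U^alpha as a subset of C^(n+m+k), points (z, z', w) *)
Definition U_alpha (n m k : nat) (Om : set (pt (n + m))) (alpha : 'I_n -> R)
  : set (pt (n + m + k)) :=
  fun q => let z := lpart (lpart q) in let z' := rpart (lpart q) in let w := rpart q in
    Om (join2 (f_alpha alpha z w) z') /\ sqnorm w < 1.

(* U^alpha_eta = {(z, z') : (z, z', eta) in U^alpha} *)
Definition U_eta (n m k : nat) (Om : set (pt (n + m))) (alpha : 'I_n -> R) (eta : pt k)
  : set (pt (n + m)) :=
  fun p => U_alpha (k:=k) Om alpha (join2 p eta).

Definition h_map (n k : nat) (alpha : 'I_n -> R) (z : pt n) (w eta : pt k) : pt n :=
  fun j => z j * cpow (rc (1 - sqnorm eta) / (1 - herm w eta)) (alpha j).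

(* Wirtinger derivative d/dz_l of G : C^n -> C at z:  (1/2)(d/dx_l - i d/dy_l) *)
Definition upd (n : nat) (z : pt n) (l : 'I_n) (c : C) : pt n :=
  fun j => if j == l then z j + c else z j.
Definition dz (n : nat) (G : pt n -> C) (l : 'I_n) (z : pt n) : C :=
  let ux := derive1 (fun t : R => complex.Re (G (upd z l (complex.Complex t 0)))) 0 in
  let uy := derive1 (fun t : R => complex.Re (G (upd z l (complex.Complex 0 t)))) 0 in
  let vx := derive1 (fun t : R => complex.Im (G (upd z l (complex.Complex t 0)))) 0 in
  let vy := derive1 (fun t : R => complex.Im (G (upd z l (complex.Complex 0 t)))) 0 in
  complex.Complex ((ux + vy) / 2) ((vx - uy) / 2).

(* the operator  j I + sum_l alpha_l (I + z_l d/dz_l) *)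
Definition Lop (n : nat) (alpha : 'I_n -> R) (j : nat) (G : pt n -> C) : pt n -> C :=
  fun z => j%:R * G z + \sum_(l < n) rc (alpha l) * (G z + z l * dz G l z).

(* prod_{j=1}^k (j I + ...) applied to G *)
Definition Prodop (n : nat) (alpha : 'I_n -> R) (k : nat) (G : pt n -> C) : pt n -> C :=
  foldr (fun j acc => Lop alpha j acc) G (iota 1 k).

(* D_{U^alpha}[G] evaluated at the point (z, z', w), with parameter eta *)
Definition D_op (n k : nat) (alpha : 'I_n -> R) (w eta : pt k) (G : pt n -> C) (z : pt n) : C :=
  rc (powR (1 - sqnorm eta) (\sum_(l < n) alpha l))
  / (rc (pi ^+ k) * cpow (1 - herm w eta) (k.+1%:R + \sum_(l < n) alpha l))
  * Prodop alpha k G z.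

End Defs.

(* Main.v *)
(** Holomorphic changes of variables turn Bergman kernels into each other. For
    the Moebius maps of the w-ball, lifted to U^alpha by multiplying z_l by the
    alpha_l-th power of s/(1 - conj(a) w_i), s^2 = 1 - |a|^2, this reduces
    K_U(P, Q) to the case Q = (zeta, zeta', 0), one coordinate of eta at a time.
    There K_U is independent of w, by circular symmetry, so it is given by one
    function g on the base Omega. Conversely the kernel of Omega, viewed as a
    function on U^alpha that does not depend on w, is reproduced by K_U. By
    Fubini and a scaling of the fibres, t^(k + |alpha|) K_Omega(t^alpha p, q) is
    the integral over |w|^2 < t of Phi(t - |w|^2), where
    Phi(u) = u^|alpha| g(u^alpha p, q), that is, pi^k times the k-fold iterated
    integral of Phi. Differentiating k times along the curve t^alpha p produces
    the k Euler-type factors of the operator and recovers g. *)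
From HB Require Import structures.
Require Import Defs.
From mathcomp Require Import all_boot all_order all_algebra.
From mathcomp Require Import all_classical all_reals all_analysis measurable_realfun.
From mathcomp Require Import complex zify ring lra.
Import Order.TTheory GRing.Theory Num.Theory.
Import numFieldNormedType.Exports.
Set Implicit Arguments.
Unset Strict Implicit.
Unset Printing Implicit Defensive.
Local Open Scope ring_scope.
Local Open Scope classical_set_scope.

(** * Complex numbers *)

Section ComplexModulus.
Variable R : realType.
Local Notation C := R[i].
Implicit Types (x y z : C) (a b t : R).

(** The integral in the definition of the kernel is iterated over real coordinates, so a measure
    [vol] on C^N is built along the same recursion and identified with it. Every substitution is
    assembled from one-variable rules: a Moebius map of the disc is affine, then an inversion, then
    affine, and its lift is diagonal once the disc coordinate is fixed. Holomorphy is plain complex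
    differentiability. Since the operator differentiates k times, derivatives must be shown to be
    holomorphic again; this rests on Goursat's theorem, used in logarithmic coordinates around a
    centre to obtain circle means. Circle means also extend K(c p, q) = K(p, c^* q) from |c| = 1 to
    |c| <= 1, and this one identity gives both the independence of w (at c = 0) and the transfer of
    fibre scalings from one argument to the other. The k derivatives are taken at t = 1, which is
    interior to the parameter interval because Omega, being open, allows some T > 1. U_eta is a
    diagonal image of Omega, so its kernel differs from that of Omega by a constant Jacobian and a
    scaling. *)

Lemma conjcE z : z^* = complex.Complex (complex.Re z) (- complex.Im z).
Proof. by case: z. Qed.

Lemma cplx_eq x y : complex.Re x = complex.Re y -> complex.Im x = complex.Im y -> x = y.
Proof. by case: x; case: y => /= ? ? ? ? -> ->. Qed.

Lemma cReD x y : complex.Re (x + y) = complex.Re x + complex.Re y.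
Proof. by case: x; case: y. Qed.
Lemma cImD x y : complex.Im (x + y) = complex.Im x + complex.Im y.
Proof. by case: x; case: y. Qed.
Lemma cReN x : complex.Re (- x) = - complex.Re x.
Proof. by case: x. Qed.
Lemma cImN x : complex.Im (- x) = - complex.Im x.
Proof. by case: x. Qed.
Lemma cReB x y : complex.Re (x - y) = complex.Re x - complex.Re y.
Proof. by rewrite cReD cReN. Qed.
Lemma cImB x y : complex.Im (x - y) = complex.Im x - complex.Im y.
Proof. by rewrite cImD cImN. Qed.
Lemma cReM x y : complex.Re (x * y) = complex.Re x * complex.Re y - complex.Im x * complex.Im y.
Proof. by case: x; case: y. Qed.
Lemma cImM x y : complex.Im (x * y) = complex.Re x * complex.Im y + complex.Im x * complex.Re y.
Proof. by case: x; case: y. Qed.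
Lemma cReJ x : complex.Re x^* = complex.Re x.
Proof. by rewrite conjcE. Qed.
Lemma cImJ x : complex.Im x^* = - complex.Im x.
Proof. by rewrite conjcE. Qed.

Lemma rcE a : rc a = a%:C%C. Proof. by []. Qed.
Lemma rcD a b : rc (a + b) = rc a + rc b.
Proof. by rewrite !rcE rmorphD. Qed.
Lemma rcM a b : rc (a * b) = rc a * rc b.
Proof. by rewrite !rcE rmorphM. Qed.
Lemma rcB a b : rc (a - b) = rc a - rc b.
Proof. by rewrite !rcE rmorphB. Qed.
Lemma rcV a : rc a^-1 = (rc a)^-1.
Proof. by rewrite !rcE fmorphV. Qed.
Lemma rc0 : rc 0 = 0 :> C. Proof. by []. Qed.
Lemma rc1 : rc 1 = 1 :> C. Proof. by []. Qed.
Lemma rcX a n : rc (a ^+ n) = rc a ^+ n.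
Proof. by rewrite !rcE rmorphXn. Qed.
Lemma rc_nat n : rc n%:R = n%:R :> C.
Proof. by rewrite !rcE rmorph_nat. Qed.
Lemma rc_eq0 a : (rc a == 0) = (a == 0).
Proof. by rewrite rcE fmorph_eq0. Qed.
Lemma rc_sum (I : Type) (r : seq I) (P : pred I) (F : I -> R) :
  rc (\sum_(i <- r | P i) F i) = \sum_(i <- r | P i) rc (F i).
Proof. by rewrite rcE rmorph_sum. Qed.
Lemma rc_inj : injective (@rc R).
Proof. by move=> a b []. Qed.

Lemma rcJ a : (rc a)^* = rc a.
Proof. by rewrite conjcE /rc /= oppr0. Qed.

Lemma cabsE z : `|z| = rc (cabs z).
Proof. by rewrite normc_def. Qed.

Lemma cabs_ge0 z : 0 <= cabs z.
Proof. exact: sqrtr_ge0. Qed.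

Lemma cabs_sqr z : cabs z ^+ 2 = complex.Re z ^+ 2 + complex.Im z ^+ 2.
Proof. by rewrite sqr_sqrtr // addr_ge0 // sqr_ge0. Qed.

Lemma cabsM x y : cabs (x * y) = cabs x * cabs y.
Proof. by apply: rc_inj; rewrite rcM -!cabsE normrM. Qed.
Lemma cabsV x : cabs x^-1 = (cabs x)^-1.
Proof. by apply: rc_inj; rewrite rcV -!cabsE normfV. Qed.
Lemma cabsN x : cabs (- x) = cabs x.
Proof. by apply: rc_inj; rewrite -!cabsE normrN. Qed.
Lemma cabs0 : cabs (0 : C) = 0.
Proof. by apply: rc_inj; rewrite -!cabsE normr0. Qed.
Lemma cabs1 : cabs (1 : C) = 1.
Proof. by apply: rc_inj; rewrite -!cabsE normr1. Qed.
Lemma cabsX x n : cabs (x ^+ n) = cabs x ^+ n.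
Proof. by apply: rc_inj; rewrite rcX -!cabsE normrX. Qed.
Lemma cabs_eq0 x : (cabs x == 0) = (x == 0).
Proof. by rewrite -[RHS]normr_eq0 cabsE rc_eq0. Qed.
Lemma cabs_gt0 x : (0 < cabs x) = (x != 0).
Proof. by rewrite lt_def cabs_ge0 andbT cabs_eq0. Qed.
Lemma cabsD x y : cabs (x + y) <= cabs x + cabs y.
Proof. by have := ler_normD x y; rewrite !cabsE -rcD lecR. Qed.
Lemma cabsJ x : cabs x^* = cabs x.
Proof. by rewrite /cabs cReJ cImJ sqrrN. Qed.
Lemma cabs_rc a : cabs (rc a) = `|a|.
Proof. by rewrite /cabs /= expr0n /= addr0 sqrtr_sqr. Qed.
Lemma cabs_sum (I : Type) (r : seq I) (P : pred I) (F : I -> C) :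
  cabs (\sum_(i <- r | P i) F i) <= \sum_(i <- r | P i) cabs (F i).
Proof.
elim/big_rec2: _ => [|i a b _ H]; first by rewrite cabs0.
by apply: le_trans (cabsD _ _) _; rewrite lerD2l.
Qed.
Lemma cabsBl x y : cabs x - cabs y <= cabs (x - y).
Proof. by rewrite lerBlDr -{1}(subrK y x) cabsD. Qed.

Lemma cRe_le z : `|complex.Re z| <= cabs z.
Proof.
rewrite -(@ler_pXn2r _ 2) // ?nnegrE ?cabs_ge0 // real_normK ?num_real // cabs_sqr.
by rewrite lerDl sqr_ge0.
Qed.
Lemma cIm_le z : `|complex.Im z| <= cabs z.
Proof.
rewrite -(@ler_pXn2r _ 2) // ?nnegrE ?cabs_ge0 // real_normK ?num_real // cabs_sqr.
by rewrite lerDr sqr_ge0.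
Qed.
Lemma cabs_leD z : cabs z <= `|complex.Re z| + `|complex.Im z|.
Proof.
rewrite -(@ler_pXn2r _ 2) // ?nnegrE ?cabs_ge0 ?addr_ge0 // cabs_sqr sqrrD !real_normK ?num_real //.
by rewrite addrAC lerDl mulrn_wge0 // mulr_ge0.
Qed.
Lemma mulcJ z : z * z^* = rc (cabs z ^+ 2).
Proof. by rewrite rcX -cabsE normCK. Qed.
Lemma mulJc z : z^* * z = rc (cabs z ^+ 2).
Proof. by rewrite mulrC mulcJ. Qed.

Lemma cabs_cexpi t : cabs (cexpi t) = 1.
Proof. by rewrite /cabs /= cos2Dsin2 sqrtr1. Qed.
Lemma cexpiD a b : cexpi (a + b) = cexpi a * cexpi b.
Proof. by apply: cplx_eq; rewrite ?cReM ?cImM /= ?cosD ?sinD //; ring. Qed.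
Lemma cexpi0 : cexpi 0 = 1 :> C.
Proof. by rewrite /cexpi cos0 sin0. Qed.

End ComplexModulus.

(** * Lebesgue measure on C^N *)

Section ProductMeasure.
Variables (R : realType) (d1 d2 : measure_display).
Variables (A : measurableType d1) (B : measurableType d2).
Variables (m1 : {sigma_finite_measure set A -> \bar R}).
Variables (m2 : {sigma_finite_measure set B -> \bar R}).

(** A named copy of the product measure, to which the sigma-finite structure is attached so that
    products can be nested. *)
Definition prodm : set (A * B) -> \bar R := (m1 \x m2)%E.
HB.instance Definition _ := Measure.copy prodm (m1 \x m2)%E.

Let prodm_sigma_finite : sigma_finite setT prodm.
Proof.
have /sigma_finiteP[F [TF ndF Foo]] := sigma_finiteT m1.
have /sigma_finiteP[G [TG ndG Goo]] := sigma_finiteT m2.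
exists (fun n => F n `*` G n).
  rewrite -setXTT TF TG predeqE => -[x y]; split.
    move=> [/= [n _ Fnx] [k _ Gky]]; exists (maxn n k) => //; split.
    - by move: x Fnx; exact/subsetPset/ndF/leq_maxl.
    - by move: y Gky; exact/subsetPset/ndG/leq_maxr.
  by move=> [n _ []/= ? ?]; split; exists n.
move=> k; have [? ?] := Foo k; have [? ?] := Goo k.
split; first exact: measurableX.
by rewrite /prodm product_measure1E// lte_mul_pinfty// ge0_fin_numE.
Qed.
HB.instance Definition _ := @Measure_isSigmaFinite.Build _ _ _ prodm prodm_sigma_finite.
Definition prod_sfm : {sigma_finite_measure set (A * B)%type -> \bar R} := prodm.
End ProductMeasure.

Section CoordinateMeasure.
Variable R : realType.
Local Notation C := R[i].
Local Notation leb := (@lebesgue_measure R).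

(** With these generators, measurability of a map into C^N is that of the real and imaginary parts
    of its coordinates. *)
Definition coord_sets (N : nat) : set (set (pt R N)) :=
  [set A | exists i : 'I_N, exists2 B : set R, measurable B &
     A = (fun p : pt R N => complex.Re (p i)) @^-1` B \/
     A = (fun p : pt R N => complex.Im (p i)) @^-1` B].

(** An alias of [pt], so that the measurable structure is not put on the bare function type. *)
Definition mpt (N : nat) : Type := pt R N.
HB.instance Definition _ N := gen_eqMixin (mpt N).
HB.instance Definition _ N := gen_choiceMixin (mpt N).
HB.instance Definition _ N := isPointed.Build (mpt N) (fun _ => 0).
HB.instance Definition _ N := @isMeasurable.Build (sigma_display (@coord_sets N))
  (mpt N) <<s @coord_sets N >> (@sigma_algebra0 _ setT _) (@sigma_algebraC (mpt N) _)
  (@sigma_algebra_bigcup _ setT _).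

Local Notation T1 := (measurableTypeR R).
Local Notation plane := (T1 * T1)%type.

Definition leb1 : {sigma_finite_measure set T1 -> \bar R} := leb.
Definition leb2 : {sigma_finite_measure set plane -> \bar R} := prod_sfm leb1 leb1.

Definition pc (c : plane) : C := complex.Complex c.1 c.2.

Lemma measurable_coord_Re N (i : 'I_N) :
  measurable_fun [set: mpt N] (fun p : mpt N => complex.Re (p i)).
Proof.
by move=> _ B mB; rewrite setTI; apply: sub_gen_smallest; exists i; exists B => //; left.
Qed.

Lemma measurable_coord_Im N (i : 'I_N) :
  measurable_fun [set: mpt N] (fun p : mpt N => complex.Im (p i)).
Proof.
by move=> _ B mB; rewrite setTI; apply: sub_gen_smallest; exists i; exists B => //; right.
Qed.

Lemma measurable_to_mpt d (T : measurableType d) N (f : T -> mpt N) :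
  (forall i, measurable_fun setT (fun x => complex.Re (f x i))) ->
  (forall i, measurable_fun setT (fun x => complex.Im (f x i))) ->
  measurable_fun setT f.
Proof.
move=> fR fI; apply: (@measurability _ _ _ _ setT f (@coord_sets N)) => //.
move=> _ [_ [i [B mB [->|->]]] <-].
  exact: fR.
exact: fI.
Qed.

Definition consf N (x : plane * mpt N) : mpt N.+1 := ccons (pc x.1) x.2.
(** The measurable left inverse of [consf]; it carries a sigma-finite exhaustion through the
    pushforward. *)
Definition unconsf N (p : mpt N.+1) : plane * mpt N :=
  ((complex.Re (p ord0), complex.Im (p ord0)), fun i => p (lift ord0 i)).

Lemma ccons0 N c (p : pt R N) : ccons c p ord0 = c.
Proof. by rewrite /ccons unlift_none. Qed.
Lemma cconsS N c (p : pt R N) i : ccons c p (lift ord0 i) = p i.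
Proof. by rewrite /ccons liftK. Qed.

Lemma consfK N : cancel (@consf N) (@unconsf N).
Proof.
case=> [[a b] p]; rewrite /unconsf /consf ccons0 /=; congr (_, _).
by apply/funext => i; rewrite cconsS.
Qed.

Lemma measurable_consf N : measurable_fun setT (@consf N).
Proof.
apply: measurable_to_mpt => i; rewrite /consf; case: (unliftP ord0 i) => [j ->|->].
- under eq_fun do rewrite cconsS.
  by apply: (measurableT_comp (measurable_coord_Re j)); exact: measurable_snd.
- under eq_fun do rewrite ccons0 /=.
  by apply: measurableT_comp => //; exact: measurable_fst.
- under eq_fun do rewrite cconsS.
  by apply: (measurableT_comp (measurable_coord_Im j)); exact: measurable_snd.
- under eq_fun do rewrite ccons0 /=.
  by apply: measurableT_comp => //; exact: measurable_fst.
Qed.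

Lemma measurable_unconsf N : measurable_fun setT (@unconsf N).
Proof.
apply: measurable_fun_pair; first apply: measurable_fun_pair.
- exact: measurable_coord_Re.
- exact: measurable_coord_Im.
by apply: measurable_to_mpt => i; [exact: measurable_coord_Re|exact: measurable_coord_Im].
Qed.

Section Push.
Variables (N : nat) (m : {sigma_finite_measure set (mpt N) -> \bar R}).
Definition cpush : set (mpt N.+1) -> \bar R := pushforward (prod_sfm leb2 m) (@consf N).

Let mf := @measurable_consf N.
Let cpush0 : cpush set0 = 0%E.
Proof. by rewrite /cpush /pushforward preimage_set0 measure0. Qed.
Let cpush_ge0 A : (0 <= cpush A)%E.
Proof. exact: measure_ge0. Qed.
Let cpush_sigma : semi_sigma_additive cpush.
Proof.
move=> F mF tF mUF; rewrite /cpush /pushforward preimage_bigcup.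
apply: measure_semi_sigma_additive.
- by move=> n; rewrite -[X in measurable X]setTI; exact: mf.
- apply/trivIsetP => /= i j _ _ ij; rewrite -preimage_setI.
  by move/trivIsetP : tF => /(_ _ _ _ _ ij) ->//; rewrite preimage_set0.
- by rewrite -preimage_bigcup -[X in measurable X]setTI; exact: mf.
Qed.
HB.instance Definition _ := isMeasure.Build _ _ _ cpush cpush0 cpush_ge0 cpush_sigma.

Let cpush_sf : sigma_finite setT cpush.
Proof.
have [F TF Ffin] := sigma_finiteT (prod_sfm leb2 m).
exists (fun n => @unconsf N @^-1` F n).
  by rewrite -preimage_bigcup -TF preimage_setT.
move=> n; have [mFn Fnoo] := Ffin n; split.
  by rewrite -[X in measurable X]setTI; exact: measurable_unconsf.
rewrite /cpush /pushforward; apply: le_lt_trans Fnoo.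
by rewrite -comp_preimage (_ : _ \o _ = id) //; apply/funext => x; rewrite /= consfK.
Qed.
HB.instance Definition _ := @Measure_isSigmaFinite.Build _ _ _ cpush cpush_sf.
Definition cpush_sfm : {sigma_finite_measure set (mpt N.+1) -> \bar R} := cpush.
End Push.

(** The recursion runs parallel to that of [lint], so that Tonelli and Fubini identify the two; C^0
    is a point and carries a Dirac mass. *)
Fixpoint vol (N : nat) : {sigma_finite_measure set (mpt N) -> \bar R} :=
  match N with
  | 0 => dirac ((fun _ => 0) : mpt 0)
  | N'.+1 => cpush_sfm (vol N')
  end.

End CoordinateMeasure.

Notation plane R := (measurableTypeR R * measurableTypeR R)%type.

(** * Product integrals and the passage from nonnegative to signed integrands *)

Section ProductIntegral.
Local Open Scope ereal_scope.
Variables (R : realType) (d1 d2 : measure_display).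
Variables (A : measurableType d1) (B : measurableType d2).
Variables (m1 : {sigma_finite_measure set A -> \bar R}).
Variables (m2 : {sigma_finite_measure set B -> \bar R}).

Lemma tonelli (F : A * B -> \bar R) : measurable_fun setT F -> (forall z, 0 <= F z) ->
  \int[prod_sfm m1 m2]_z F z = \int[m1]_x \int[m2]_y F (x, y).
Proof. by move=> mF F0; rewrite -[LHS]/(\int[m1 \x m2]_z F z) fubini_tonelli1. Qed.

Lemma fubini (F : A * B -> \bar R) : (prod_sfm m1 m2).-integrable setT F ->
  \int[prod_sfm m1 m2]_z F z = \int[m1]_x \int[m2]_y F (x, y).
Proof. by move=> iF; rewrite -[LHS]/(\int[m1 \x m2]_z F z) -integral12_prod_meas1. Qed.

Lemma measurable_pint (F : A * B -> \bar R) : measurable_fun setT F ->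
  measurable_fun setT (fun x => \int[m2]_y F (x, y)).
Proof.
move=> mF; rewrite (_ : (fun _ => _) = (fun x => \int[m2]_y F^\+ (x, y)) \-
    (fun x => \int[m2]_y F^\- (x, y))).
  apply: emeasurable_funB.
  - by apply: (measurable_fun_fubini_tonelli_F F^\+) => //; exact: measurable_funepos.
  - by apply: (measurable_fun_fubini_tonelli_F F^\-) => //; exact: measurable_funeneg.
apply/funext => x; rewrite [LHS]integralE.
under eq_integral do rewrite funepos_comp/=.
by under [X in _ - X = _]eq_integral do rewrite funeneg_comp/=.
Qed.

(** The integral is the difference of those of the positive and negative parts, and a nonnegative
    weight commutes with taking these parts; hence no integrability is assumed. *)
Lemma integral_weighted (m : {measure set A -> \bar R}) (m' : {measure set B -> \bar R})
    (psi : B -> A) (w : B -> R) : (forall x, 0 <= w x)%R ->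
  (forall F : A -> \bar R, measurable_fun setT F -> (forall x, 0 <= F x) ->
     \int[m]_x F x = \int[m']_y (F (psi y) * (w y)%:E)) ->
  forall F : A -> \bar R, measurable_fun setT F ->
     \int[m]_x F x = \int[m']_y (F (psi y) * (w y)%:E).
Proof.
move=> w0 H F mF; rewrite integralE [RHS]integralE.
rewrite !H; [|exact: measurable_funeneg|by []|exact: measurable_funepos|by []].
congr (_ - _); apply: eq_integral => y _.
- by rewrite !funeposE muleC maxe_pMr ?lee_fin // mule0 muleC.
- by rewrite !funenegE muleC maxe_pMr ?lee_fin // mule0 muleN muleC.
Qed.
End ProductIntegral.

(** * The iterated integral as an integral against [vol] *)

Section CoordinateIntegral.
Local Open Scope ereal_scope.
Variable R : realType.
Local Notation C := R[i].
Local Notation leb := (@lebesgue_measure R).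
Local Notation plane := (plane R).
Local Notation vol := (@vol R).

Lemma vol_consE N (F : mpt R N.+1 -> \bar R) : measurable_fun setT F ->
  \int[vol N.+1]_p F p = \int[prod_sfm (leb2 R) (vol N)]_x F (consf x).
Proof.
suff H : forall G : mpt R N.+1 -> \bar R, measurable_fun setT G -> (forall p, 0 <= G p) ->
  \int[vol N.+1]_p G p = \int[prod_sfm (leb2 R) (vol N)]_x G (consf x).
  move=> mF; rewrite integralE [RHS]integralE.
  rewrite (H F^\+) //; last exact: measurable_funepos.
  rewrite (H F^\-) //; last exact: measurable_funeneg.
  by congr (_ - _); apply: eq_integral => x _; rewrite ?funeposE ?funenegE.
move=> G mG G0.
rewrite -[LHS]/(\int[pushforward (prod_sfm (leb2 R) (vol N)) (@consf R N)]_p G p).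
rewrite ge0_integral_pushforward //; exact: measurable_consf.
Qed.

Lemma measurable_ccons d (T : measurableType d) N (u v : T -> measurableTypeR R) (f : T -> mpt R N) :
  measurable_fun setT u -> measurable_fun setT v -> measurable_fun setT f ->
  measurable_fun setT (fun x => ccons (complex.Complex (u x) (v x)) (f x) : mpt R N.+1).
Proof.
move=> mu mv mf.
rewrite (_ : (fun _ => _) = @consf R N \o (fun x => ((u x, v x), f x))) //.
apply: measurableT_comp; first exact: measurable_consf.
by apply: measurable_fun_pair => //; exact: measurable_fun_pair.
Qed.

Lemma vol_cons N (F : mpt R N.+1 -> \bar R) : measurable_fun setT F -> (forall p, 0 <= F p) ->
  \int[vol N.+1]_p F p = \int[leb2 R]_c \int[vol N]_p F (ccons (pc c) p).
Proof.
move=> mF F0; rewrite vol_consE // tonelli //.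
by apply: measurableT_comp => //; exact: measurable_consf.
Qed.

Lemma vol0 (F : mpt R 0 -> \bar R) : measurable_fun setT F ->
  \int[vol 0]_p F p = F (fun _ => 0%R).
Proof. by move=> mF; rewrite -[LHS]/(\int[dirac _]_p F p) integral_dirac // diracT mul1e. Qed.

(** The induction absorbs two real coordinates at a time into the parameter space [T]. *)
Lemma measurable_lint d (T : measurableType d) N (F : T * mpt R N -> R) :
  measurable_fun setT F -> measurable_fun setT (fun x => lint (fun p => F (x, p))).
Proof.
elim: N d T F => [|N IH] d T F mF /=.
  by apply/measurable_EFinP; apply: (measurableT_comp (f := F)) => //.
pose G (y : (T * measurableTypeR R) * measurableTypeR R) : \bar R :=
  lint (fun p => F (y.1.1, ccons (complex.Complex y.1.2 y.2) p)).
have mG : measurable_fun setT G.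
  apply: (IH _ _ (fun z : ((T * measurableTypeR R) * measurableTypeR R) * mpt R N =>
    F (z.1.1.1, ccons (complex.Complex z.1.1.2 z.1.2) z.2))).
  apply: (measurableT_comp mF); apply: measurable_fun_pair => /=.
    by do 2 apply: measurableT_comp => //.
  by apply: measurable_ccons => //; do 2 apply: measurableT_comp => //.
apply: (measurable_pint (leb1 R) (F := fun z => \int[leb1 R]_y G (z, y))).
exact: (measurable_pint (leb1 R) mG).
Qed.

Lemma lint_ge0 N (F : mpt R N -> R) : measurable_fun setT F -> (forall p, 0 <= F p)%R ->
  lint F = \int[vol N]_p (F p)%:E.
Proof.
elim: N F => [|N IH] F mF F0 /=.
  by rewrite vol0 //; exact/measurable_EFinP.
have mF2 : measurable_fun setT (fun z : plane * mpt R N => F (ccons (pc z.1) z.2)).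
  apply: (measurableT_comp mF); apply: measurable_ccons => //;
  by apply: measurableT_comp => //.
rewrite vol_cons //; last exact/measurable_EFinP.
rewrite tonelli; first last.
- by move=> z; apply: integral_ge0 => p _; rewrite lee_fin.
- apply: (measurable_pint (vol N) (F := fun z : plane * mpt R N => (F (ccons (pc z.1) z.2))%:E)).
  exact/measurable_EFinP.
apply: eq_integral => x _; apply: eq_integral => y _.
rewrite IH //.
rewrite (_ : (fun p => _) = (fun z : plane * mpt R N => F (ccons (pc z.1) z.2)) \o (fun p => ((x, y), p))) //.
by apply: measurableT_comp => //; exact: measurable_pair1.
Qed.

Lemma lint_integrable N (F : mpt R N -> R) : (vol N).-integrable setT (EFin \o F) ->
  lint F = \int[vol N]_p (F p)%:E.
Proof.
elim: N F => [|N IH] F iF /=.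
  by rewrite vol0 //; exact: measurable_int iF.
have /measurable_EFinP mF := measurable_int _ iF.
have mF2 : measurable_fun setT (fun z : plane * mpt R N => F (ccons (pc z.1) z.2)).
  apply: (measurableT_comp mF); apply: measurable_ccons => //;
  by apply: measurableT_comp => //.
pose G (z : plane * mpt R N) : \bar R := (F (ccons (pc z.1) z.2))%:E.
have mG : measurable_fun setT G by exact/measurable_EFinP.
have iG : (prod_sfm (leb2 R) (vol N)).-integrable setT G.
  apply/integrableP; split => //.
  have /integrableP[_] := iF; rewrite vol_consE //.
  exact/measurableT_comp/measurable_EFinP.
rewrite vol_consE; last exact/measurable_EFinP.
rewrite -[RHS]/(\int[prod_sfm (leb2 R) (vol N)]_z G z) fubini //.
pose H (c : plane) : \bar R := lint (fun p => F (ccons (pc c) p)).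
have mH : measurable_fun setT H by apply: (measurable_lint mF2).
have iI : (leb2 R).-integrable setT (fun c => \int[vol N]_p G (c, p)).
  exact: (integrable_fubini_F iG).
(* Fubini makes only almost every slice integrable, so the inner integrals agree almost everywhere;
   the measurability of [H] then lets the outer integrals be compared. *)
have HI : ae_eq (leb2 R) setT H (fun c => \int[vol N]_p G (c, p)).
  have := ae_integrable1 iG; apply: filterS => c /= iGc _.
  by rewrite /H IH.
rewrite -(ae_eq_integral _ _ _ mH _ HI) //; last exact: measurable_int iI.
rewrite -[LHS]/(\int[leb1 R]_x \int[leb1 R]_y H (x, y)) -fubini //.
apply/integrableP; split => //; have /integrableP[mI] := iI.
rewrite (ae_eq_integral _ _ _ _ _ (ae_eq_abse HI)) //; exact: measurableT_comp.
Qed.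

End CoordinateIntegral.

(** * Substitutions in one real and one complex variable *)

Section WeightedMeasure.
Local Open Scope ereal_scope.
Variables (R : realType) (d1 d2 : measure_display).
Variables (A : measurableType d1) (B : measurableType d2).
Variables (m : {measure set B -> \bar R}) (psi : B -> A) (w : B -> R).
Hypotheses (mpsi : measurable_fun setT psi) (mw : measurable_fun setT w).
Hypothesis w0 : forall y, (0 <= w y)%R.

(** The image under [psi] of the measure with density [w]; a substitution rule asserts that it
    coincides with a given measure. *)
Definition wmeas (X : set A) : \bar R := \int[m]_(y in psi @^-1` X) (w y)%:E.

Let mpre X : measurable X -> measurable (psi @^-1` X).
Proof. by move=> mX; rewrite -[X in measurable X]setTI; exact: mpsi. Qed.

Lemma wmeasE X : measurable X ->
  wmeas X = \int[m]_y ((\1_X (psi y))%:E * (w y)%:E).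
Proof.
move=> mX; rewrite /wmeas [LHS]integral_mkcond; apply: eq_integral => y _.
rewrite /patch indicE; case: (boolP (psi y \in X)) => h.
  by rewrite ifT ?mul1e //; move: h; rewrite !inE.
by rewrite ifF ?mul0e //; apply/negbTE; move: h; apply: contra; rewrite !inE.
Qed.

Let wmeas0 : wmeas set0 = 0.
Proof. by rewrite /wmeas preimage_set0 integral_set0. Qed.
Let wmeas_ge0 X : 0 <= wmeas X.
Proof. by apply: integral_ge0 => y _; rewrite lee_fin. Qed.
Let wmeas_sigma : semi_sigma_additive wmeas.
Proof.
have H := @semi_sigma_additive_nng_induced _ B R m (EFin \o w).
move=> F mF tF mUF; rewrite /wmeas preimage_bigcup.
apply: H => //.
- exact/measurable_EFinP.
- by move=> n; exact: mpre.
- apply/trivIsetP => /= i j _ _ ij; rewrite -preimage_setI.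
  by move/trivIsetP : tF => /(_ _ _ _ _ ij) ->//; rewrite preimage_set0.
- by rewrite -preimage_bigcup; exact: mpre.
Qed.
HB.instance Definition _ := isMeasure.Build _ _ _ wmeas wmeas0 wmeas_ge0 wmeas_sigma.
Definition wmeasure : {measure set A -> \bar R} := wmeas.

Import HBNNSimple.

Lemma integral_wmeas (F : A -> \bar R) : measurable_fun setT F -> (forall x, 0 <= F x) ->
  \int[wmeasure]_x F x = \int[m]_y (F (psi y) * (w y)%:E).
Proof.
move=> mF F0.
pose f_ := nnsfun_approx (@measurableT _ A) mF.
have cF x : (fun n => (f_ n x)%:E) @ \oo --> F x.
  by apply: cvg_nnsfun_approx => // *; exact: F0.
have sfE (g : {nnsfun A >-> R}) :
    \int[wmeasure]_x (g x)%:E = \int[m]_y ((g (psi y))%:E * (w y)%:E).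
  have mind r : measurable_fun setT (fun y => (\1_(g @^-1` [set r]) (psi y))%:E : \bar R).
    apply/measurable_EFinP.
    have mr : measurable (g @^-1` [set r]) by apply: measurable_funPTI; exact: measurable_set1.
    exact: (measurableT_comp (measurable_indic (D := setT) mr) mpsi).
  under eq_integral do rewrite fimfunE -fsumEFin//.
  rewrite ge0_integral_fsum//; last 2 first.
  - by move=> y; exact/measurable_EFinP/measurable_funM.
  - by move=> y x _; rewrite nnfun_muleindic_ge0.
  transitivity (\sum_(k \in range g) \int[m]_y (k%:E * ((\1_(g @^-1` [set k]) (psi y))%:E * (w y)%:E))).
    apply: eq_fsbigr => r /[!inE] -[z _ rz].
    have mr : measurable (g @^-1` [set r]) by apply: measurable_funPTI; exact: measurable_set1.
    have r0 : (0 <= r)%R by rewrite -rz fun_ge0.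
    rewrite integralZl_indic_nnsfun// integral_indic//= setIT.
    rewrite -[wmeas _]/(wmeas _) wmeasE // ge0_integralZl_EFin //.
    - by move=> y _; rewrite mule_ge0 // lee_fin.
    - apply: emeasurable_funM; last exact/measurable_EFinP.
      exact: mind.
  rewrite -ge0_integral_fsum//; last 2 first.
  - move=> r; apply: emeasurable_funM => //.
    apply: emeasurable_funM; last exact/measurable_EFinP.
    exact: mind.
  - move=> r y _; rewrite muleA mule_ge0 ?lee_fin //.
    exact: nnfun_muleindic_ge0.
  apply: eq_integral => y _; rewrite [in RHS]fimfunE -fsumEFin// ge0_mule_fsuml.
    by apply: eq_fsbigr => r _; rewrite muleA.
  by move=> r; exact: nnfun_muleindic_ge0.
transitivity (limn (fun n => \int[wmeasure]_x (f_ n x)%:E)).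
  rewrite -monotone_convergence//.
  - by apply: eq_integral => y _; apply/esym/cvg_lim => //.
  - by move=> n; exact/measurable_EFinP/measurable_funP.
  - by move=> n y _; rewrite lee_fin.
  - by move=> y _ i j ij; rewrite lee_fin; exact/lefP/nd_nnsfun_approx.
under eq_fun do rewrite sfE.
rewrite -monotone_convergence//.
- apply: eq_integral => y _; apply/cvg_lim => //.
  by apply: cvgeMr => //; exact: cF.
- move=> n; apply: emeasurable_funM; last exact/measurable_EFinP.
  by apply/measurable_EFinP; apply: (measurableT_comp (f := f_ n)).
- by move=> n y _; rewrite mule_ge0 // lee_fin.
- move=> y _ i j ij; apply: lee_wpmul2r; rewrite ?lee_fin //.
  exact/lefP/nd_nnsfun_approx.
Qed.

Lemma weighted_ext (m0 : {measure set A -> \bar R}) :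
  (forall X, measurable X -> m0 X = wmeas X) ->
  forall F : A -> \bar R, measurable_fun setT F -> (forall x, 0 <= F x) ->
  \int[m0]_x F x = \int[m]_y (F (psi y) * (w y)%:E).
Proof.
move=> H F mF F0; rewrite -integral_wmeas //.
by apply: eq_measure_integral => X mX _; exact: H.
Qed.
End WeightedMeasure.

Section Leb1.
Local Open Scope ereal_scope.
Variable R : realType.
Local Notation leb := (@lebesgue_measure R).
Local Notation T1 := (measurableTypeR R).

(** By uniqueness of Lebesgue measure, a substitution rule need only be checked on half-open
    intervals. *)
Lemma leb_subst (psi w : T1 -> T1) :
  measurable_fun setT psi -> measurable_fun setT w -> (forall x, 0 <= w x)%R ->
  (forall p q, (p < q)%R -> \int[leb]_(x in psi @^-1` `]p, q]) (w x)%:E = (q - p)%:E) ->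
  forall F : T1 -> \bar R, measurable_fun setT F -> (forall x, 0 <= F x) ->
  \int[leb]_x F x = \int[leb]_x (F (psi x) * (w x)%:E).
Proof.
move=> mpsi mw w0 H; apply: weighted_ext => // X mX.
apply: (@lebesgue_measure_unique R (wmeasure (leb1 R) mpsi mw w0)) => //.
move=> Y /ocitvP[->|[[p q] /= pq ->]]; first by rewrite !measure0.
by rewrite lebesgue_measure_itv /= lte_fin pq -EFinB -H.
Qed.

Lemma leb_affine (a b : R) : a != 0%R ->
  forall F : T1 -> \bar R, measurable_fun setT F -> (forall x, 0 <= F x) ->
  \int[leb]_x F x = \int[leb]_x (F (a * x + b)%R * `|a|%:E).
Proof.
move=> a0 F mF F0.
have mpsi : measurable_fun setT (fun x : T1 => (a * x + b)%R : T1).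
  by apply: measurable_funD => //; exact: measurable_funM.
apply: (@leb_subst (fun x => (a * x + b)%R) (fun _ => `|a|%R)) => // p q pq.
rewrite integral_cst; last by rewrite -[X in measurable X]setTI; exact: mpsi.
case: (ltrgtP a 0%R) a0 => // a0 _.
- rewrite (_ : _ @^-1` _ = `[((q - b) / a)%R, ((p - b) / a)%R[%classic); last first.
    apply/seteqP; split=> x /=; rewrite !in_itv /= ler_ndivrMr // ltr_ndivlMr //;
    by move=> /andP[h1 h2]; apply/andP; split; lra.
  rewrite /= lebesgue_measure_itv /= lte_fin ltr_ndivrMr // divfK ?lt_eqF //.
  rewrite ifT; last by lra.
  rewrite -EFinB -EFinM; congr EFin; rewrite ltr0_norm //; field; exact: ltr0_neq0.
- rewrite (_ : _ @^-1` _ = `]((p - b) / a)%R, ((q - b) / a)%R]%classic); last first.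
    apply/seteqP; split=> x /=; rewrite !in_itv /= ler_pdivlMr // ltr_pdivrMr //;
    by move=> /andP[h1 h2]; apply/andP; split; lra.
  rewrite /= lebesgue_measure_itv /= lte_fin ltr_pdivrMr // divfK ?gt_eqF //.
  rewrite ifT; last by lra.
  rewrite -EFinB -EFinM; congr EFin; rewrite gtr0_norm //; field; exact: lt0r_neq0.
Qed.
End Leb1.

(** The inverse is written as [f] times [powR (f ^+ 2) (-1)], a product that vanishes together with
    [f], as does the convention for the inverse of zero. *)
Lemma measurable_funV d (T : measurableType d) (R : realType) (f : T -> R) :
  measurable_fun setT f -> measurable_fun setT (fun x => (f x)^-1).
Proof.
move=> mf; rewrite (_ : (fun _ => _) = (fun x => f x * powR (f x ^+ 2) (-1))).
  apply: measurable_funM => //.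
  apply: (measurableT_comp (measurable_powR _)) => //.
  exact: measurable_funX.
apply/funext => x; rewrite powR_inv1 ?sqr_ge0 //.
have [->|fx0] := eqVneq (f x) 0; first by rewrite mul0r invr0.
by field.
Qed.

Lemma is_deriveVf (R : realType) (f : R -> R) (x df : R) : f x != 0 ->
  is_derive x 1 f df -> is_derive x 1 (fun y => (f y)^-1) (- (f x) ^- 2 * df).
Proof.
move=> fx0 [df1 df2]; split; first exact: derivableV.
by rewrite deriveV // df2.
Qed.

Section PosSubst.
Local Open Scope ereal_scope.
Variable R : realType.
Local Notation leb := (@lebesgue_measure R).
Local Notation T1 := (measurableTypeR R).

Lemma measurable_ifpos (f g : T1 -> \bar R) : measurable_fun setT f -> measurable_fun setT g ->
  measurable_fun setT (fun x : T1 => if (0 < x)%R then f x else g x).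
Proof. by move=> mf mg; apply: measurable_fun_ifT => //; exact: measurable_fun_ltr. Qed.

Lemma measurable_ifposr (f g : T1 -> T1) : measurable_fun setT f -> measurable_fun setT g ->
  measurable_fun setT (fun x : T1 => if (0 < x)%R then f x else g x).
Proof. by move=> mf mg; apply: measurable_fun_ifT => //; exact: measurable_fun_ltr. Qed.

(** The substitution is completed to the whole line by the identity with weight one off the positive
    axis, so that [leb_subst] applies; an interval containing 0 is cut there. *)
Lemma leb_pos_subst (g w : T1 -> T1) :
  measurable_fun setT g -> measurable_fun setT w -> (forall x, 0 <= w x)%R ->
  (forall x, 0 < x -> 0 < g x)%R ->
  (forall p q, (0 <= p)%R -> (p < q)%R ->
     \int[leb]_(x in [set x | 0 < x /\ p < g x <= q]%R) (w x)%:E = (q - p)%:E) ->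
  forall F : T1 -> \bar R, measurable_fun setT F -> (forall x, 0 <= F x) ->
  \int[leb]_x (if (0 < x)%R then F x else 0) =
  \int[leb]_x (if (0 < x)%R then F (g x) * (w x)%:E else 0).
Proof.
move=> mg mw w0 g0 H F mF F0.
pose psi x : T1 := if (0 < x)%R then g x else x.
pose v x : T1 := if (0 < x)%R then w x else 1%R.
have mpsi : measurable_fun setT psi by exact: measurable_ifposr.
have mv : measurable_fun setT v by exact: measurable_ifposr.
have v0 x : (0 <= v x)%R by rewrite /v; case: ifP.
rewrite (@leb_subst R psi v) //.
- apply: eq_integral => x _; rewrite /psi /v; case: (boolP (0 < x)%R) => x0; first by rewrite g0.
  by rewrite (negbTE x0) mul0e.
- move=> p q pq.
  have H1 (p' q' : R) : (0 <= p')%R -> (p' <= q')%R -> \int[leb]_(x in [set x | 0 < x /\ p' < g x <= q']%R) (v x)%:E = (q' - p')%:E.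
    move=> p0; rewrite le_eqVlt => /orP[/eqP <-|pq'].
      rewrite (_ : [set _ | _] = set0) ?integral_set0 ?subrr //.
      by apply/seteqP; split=> // x /= [_ /andP[h1 h2]]; have := lt_le_trans h1 h2; rewrite ltxx.
    rewrite -(H p' q') //; apply: eq_integral => x.
    by rewrite inE /v => -[-> _].
  have H2 (p' q' : R) : (q' <= 0)%R -> (p' <= q')%R -> \int[leb]_(x in `]p', q']) (v x)%:E = (q' - p')%:E.
    move=> q0; rewrite le_eqVlt => /orP[/eqP <-|pq'].
      by rewrite set_itv_ge ?integral_set0 ?subrr // bnd_simp ltxx.
    transitivity (\int[leb]_(x in `]p', q']) (cst 1 x)).
      apply: eq_integral => x; rewrite inE /= in_itv /= => /andP[_ xq].
      by rewrite /v ltNge (le_trans xq q0).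
    by rewrite integral_cst //= lebesgue_measure_itv /= lte_fin pq' mul1e EFinB.
  have [p0|p0] := leP 0%R p.
    rewrite (_ : _ @^-1` _ = [set x | 0 < x /\ p < g x <= q]%R); first by apply: H1 => //; exact: ltW.
    apply/seteqP; split=> x /=; rewrite in_itv /= /psi; case: ifPn => x0.
    + by [].
    + by move=> /andP[h _]; case/negP: x0; exact: le_lt_trans h.
    + by case.
    + by case.
  have [q0|q0] := leP q 0%R.
    rewrite (_ : _ @^-1` _ = `]p, q]%classic); first by apply: H2 => //; exact: ltW.
    apply/seteqP; split=> x /=; rewrite !in_itv /= /psi; case: ifPn => x0 //.
    + by move=> /andP[_ h]; have := lt_le_trans (g0 _ x0) (le_trans h q0); rewrite ltxx.
    + by move=> /andP[_ h]; have := lt_le_trans x0 (le_trans h q0); rewrite ltxx.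
  rewrite (_ : _ @^-1` _ = [set x | 0 < x /\ 0 < g x <= q]%R `|` `]p, 0%R]); last first.
    apply/seteqP; split=> x /=; rewrite !in_itv /= /psi; case: ifPn => x0.
    + by move=> /andP[_ h]; left; split => //; rewrite g0.
    + by move=> /andP[h _]; right; rewrite h leNgt.
    + by case=> [[_ /andP[h1 h2]]|/andP[_ h]]; [rewrite h2 andbT (lt_trans p0)|move: x0; rewrite ltNge h].
    + by case=> [[]//|/andP[-> h2]] /=; exact: le_trans h2 (ltW q0).
  have m1 : measurable [set x : T1 | 0 < x /\ 0 < g x <= q]%R.
    rewrite (_ : [set _ | _] = `]0%R, +oo[ `&` g @^-1` `]0%R, q]).
      by apply: measurableI => //; rewrite -[X in measurable X]setTI; exact: mg.
    by apply/seteqP; split=> x /=; rewrite !in_itv /= andbT.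
  rewrite ge0_integral_setU //=.
  - rewrite H1 // ?H2 // ?ltW // -EFinD; congr EFin; lra.
  - apply/measurable_EFinP; exact: measurable_funTS.
  - by move=> x _; rewrite lee_fin.
  - apply/disj_set2P/seteqP; split=> x //= [[x0 _]]; rewrite in_itv /= => /andP[_ h].
    by have := lt_le_trans x0 h; rewrite ltxx.
- by apply: measurable_ifpos.
- by move=> x; case: ifP.
Qed.

Lemma leb_pos_inv (c : R) : (0 < c)%R ->
  forall F : T1 -> \bar R, measurable_fun setT F -> (forall x, 0 <= F x) ->
  \int[leb]_x (if (0 < x)%R then F x else 0) =
  \int[leb]_x (if (0 < x)%R then F (c / x)%R * (c / x ^+ 2)%:E else 0).
Proof.
move=> c0; apply: leb_pos_subst.
- by apply: measurable_funM => //; exact: measurable_funV.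
- by apply: measurable_funM => //; apply: measurable_funV; exact: measurable_funX.
- by move=> x; rewrite divr_ge0 ?sqr_ge0 // ltW.
- by move=> x x0; rewrite divr_gt0.
move=> p q p0 pq; have q0 : (0 < q)%R by exact: le_lt_trans pq.
have cq0 : (0 < c / q)%R by rewrite divr_gt0.
pose G (x : R) := (- (c / x))%R.
have dG (x : R) : (0 < x)%R -> is_derive x 1%R G (c / x ^+ 2)%R.
  move=> x0; have xn0 : x != 0%R by rewrite gt_eqF.
  have h := is_deriveN (is_deriveZ c (is_deriveVf xn0 (is_derive_id x 1%R))).
  suff <- : (- (c *: (- x ^- 2 * 1)) = c / x ^+ 2)%R by exact: h.
  by rewrite /GRing.scale /=; field.
have cG (x : R) : (0 < x)%R -> {for x, continuous G}.
  by move=> /dG [/derivable1_diffP/differentiable_continuous].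
have cw (x : R) : (0 < x)%R -> {for x, continuous (fun x : R => c / x ^+ 2)%R}.
  move=> x0; apply: cvgM; first exact: cvg_cst.
  by apply: cvgV; [rewrite sqrf_eq0 gt_eqF|exact: exprn_continuous].
(* For p = 0 the preimage is the unbounded interval from c / q on, and the improper form of the
   fundamental theorem is used. *)
move: p0; rewrite le_eqVlt => /orP[/eqP p0|p0].
  rewrite (_ : [set _ | _] = `[(c / q)%R, +oo[%classic); last first.
    apply/seteqP; split=> x /=; rewrite in_itv /= andbT.
      by move=> [x0 /andP[_]]; rewrite ler_pdivrMr // mulrC -ler_pdivrMr.
    move=> h; have x0 := lt_le_trans cq0 h; split => //.
    by rewrite -p0 divr_gt0 //= ler_pdivrMr // mulrC -ler_pdivrMr.
  rewrite (@ge0_continuous_FTC2y _ _ G _ 0%R).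
  - by rewrite -EFinB /G -p0; congr EFin; field; rewrite !gt_eqF.
  - by move=> x _; rewrite divr_ge0 ?sqr_ge0 // ltW.
  - apply: continuous_in_subspaceT => x; rewrite inE /= in_itv /= andbT => h.
    by apply: cw; exact: lt_le_trans h.
  - rewrite -oppr0 -(mulr0 c); apply: cvgN; apply: cvgM; first exact: cvg_cst.
    by apply/(@gtr0_cvgV0 _ _ _ _ id); [exact: nbhs_pinfty_gt|exact: cvg_id].
  - by move=> x h; case: (dG x (lt_trans cq0 h)).
  - by apply: cvg_at_right_filter; exact: cG.
  - move=> x; rewrite in_itv /= andbT => h; have x0 := lt_trans cq0 h.
    by rewrite derive1E; case: (dG x x0).
have cpq : (c / q < c / p)%R.
  by rewrite ltr_pM2l // ltf_pV2.
rewrite (_ : [set _ | _] = `[(c / q)%R, (c / p)%R[%classic); last first.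
  apply/seteqP; split=> x /=; rewrite in_itv /=.
    by move=> [x0]; rewrite ler_pdivrMr // ltr_pdivlMr // ler_pdivrMr // ltr_pdivlMr // ![(x * _)%R]mulrC andbC.
  move=> h; have x0 : (0 < x)%R by case/andP: h => h _; exact: lt_le_trans h.
  split => //; move: h.
  by rewrite ler_pdivrMr // ltr_pdivlMr // ler_pdivrMr // ltr_pdivlMr // ![(x * _)%R]mulrC andbC.
rewrite integral_itv_bndo_bndc; last first.
  apply/measurable_EFinP; apply: measurable_funTS; apply: measurable_funM => //.
  by apply: measurable_funV; exact: measurable_funX.
rewrite (@continuous_FTC2 _ _ G) //.
- by rewrite -EFinB /G; congr EFin; field; rewrite !gt_eqF.
- apply: continuous_in_subspaceT => x; rewrite inE /= in_itv /= => /andP[h _].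
  by apply: cw; exact: lt_le_trans h.
- split.
  + by move=> x; rewrite in_itv /= => /andP[h _]; case: (dG x (lt_trans cq0 h)).
  + by apply: cvg_at_right_filter; exact: cG.
  + by apply: cvg_at_left_filter; apply: cG; exact: lt_trans cpq.
- move=> x; rewrite in_itv /= => /andP[h _]; have x0 := lt_trans cq0 h.
  by rewrite derive1E; case: (dG x x0).
Qed.

Lemma leb_pos_sqr (s : R) : (0 < s)%R ->
  forall F : T1 -> \bar R, measurable_fun setT F -> (forall x, 0 <= F x) ->
  \int[leb]_x (if (0 < x)%R then F x else 0) =
  \int[leb]_x (if (0 < x)%R then F (s * x ^+ 2)%R * `|2 * s * x|%:E else 0).
Proof.
move=> s0; apply: leb_pos_subst.
- by apply: measurable_funM => //; exact: measurable_funX.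
- by apply: measurableT_comp => //; exact: measurable_funM.
- by [].
- by move=> x x0; rewrite mulr_gt0 // exprn_gt0.
move=> p q p0 pq; have q0 : (0 < q)%R by exact: le_lt_trans pq.
pose P := Num.sqrt (p / s); pose Q := Num.sqrt (q / s).
have PQ : (P < Q)%R by rewrite ltr_sqrt ?divr_gt0 // ltr_pM2r ?invr_gt0.
have P0 : (0 <= P)%R by exact: sqrtr_ge0.
have sP : (s * P ^+ 2 = p)%R by rewrite sqr_sqrtr ?divr_ge0 // 1?ltW // mulrC divfK // gt_eqF.
have sQ : (s * Q ^+ 2 = q)%R by rewrite sqr_sqrtr ?divr_ge0 // 1?ltW // mulrC divfK // gt_eqF.
rewrite (_ : [set _ | _] = `]P, Q]%classic); last first.
  apply/seteqP; split=> x /=; rewrite in_itv /=.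
    move=> [x0]; rewrite -{1}sP -sQ ltr_pM2l // ler_pM2l //.
    by rewrite ltr_pXn2r ?nnegrE ?ler_pXn2r ?nnegrE ?sqrtr_ge0 // ltW.
  move=> h; have x0 : (0 < x)%R by case/andP: h => h _; exact: le_lt_trans h.
  split => //; rewrite -{1}sP -sQ ltr_pM2l // ler_pM2l //.
  by rewrite ltr_pXn2r ?nnegrE ?ler_pXn2r ?nnegrE ?sqrtr_ge0 // ltW.
rewrite integral_itv_obnd_cbnd; last first.
  apply/measurable_EFinP; apply: measurable_funTS.
  by apply: measurableT_comp => //; exact: measurable_funM.
pose G (x : R) := (s * x ^+ 2)%R.
have dG (x : R) : is_derive x 1%R G (2 * s * x)%R.
  apply: is_derive_eq; rewrite /GRing.scale /=. ring.
have cG (x : R) : {for x, continuous G}.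
  by case: (dG x) => [/derivable1_diffP/differentiable_continuous].
rewrite (@continuous_FTC2 _ _ G) //.
- by rewrite /G sP sQ.
- apply: continuous_subspaceT => x; apply: continuous_comp; last exact: norm_continuous.
  by apply: cvgM; [exact: cvg_cst|exact: cvg_id].
- split.
  + by move=> x _; case: (dG x).
  + by apply: cvg_at_right_filter; exact: cG.
  + by apply: cvg_at_left_filter; apply: cG.
- move=> x; rewrite in_itv /= => /andP[h _]; rewrite derive1E ger0_norm; first by case: (dG x).
  by rewrite mulr_ge0 ?mulr_ge0 // ltW // (le_lt_trans P0).
Qed.
End PosSubst.

(** * Complex affine maps and the inversion in the plane *)

Section Planar.
Local Open Scope ereal_scope.
Variable R : realType.
Local Notation C := R[i].
Local Notation leb := (@lebesgue_measure R).
Local Notation T1 := (measurableTypeR R).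
Local Notation plane := (plane R).
Implicit Types F : plane -> \bar R.

Lemma leb2E F : measurable_fun setT F -> (forall z, 0 <= F z) ->
  \int[leb2 R]_z F z = \int[leb]_x \int[leb]_y F (x, y).
Proof. by move=> mF F0; exact: tonelli. Qed.

Lemma leb2E' F : measurable_fun setT F -> (forall z, 0 <= F z) ->
  \int[leb2 R]_z F z = \int[leb]_y \int[leb]_x F (x, y).
Proof.
move=> mF F0; rewrite (leb2E mF F0).
exact: (fubini_tonelli (m1 := leb1 R) (m2 := leb1 R) F mF F0).
Qed.

Lemma measurable_slice1 F (x : R) : measurable_fun setT F -> measurable_fun setT (fun y : T1 => F (x, y)).
Proof. by move=> mF; apply: (measurableT_comp mF); exact: measurable_pair1. Qed.
Lemma measurable_slice2 F (y : R) : measurable_fun setT F -> measurable_fun setT (fun x : T1 => F (x, y)).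
Proof. by move=> mF; apply: (measurableT_comp mF); exact: measurable_pair2. Qed.

(* Gaussian elimination factors the linear map into one-variable affine substitutions. *)
Lemma leb2_cmul_aux (a b s t : R) F : a != 0%R -> measurable_fun setT F -> (forall z, 0 <= F z) ->
  \int[leb2 R]_z F z =
  \int[leb2 R]_z (F (a * z.1 - b * z.2 + s, b * z.1 + a * z.2 + t)%R * (a ^+ 2 + b ^+ 2)%:E).
Proof.
move=> a0 mF F0.
have d0 : (0 < a ^+ 2 + b ^+ 2)%R.
  by rewrite ltr_pwDl ?sqr_ge0 // lt_def sqr_ge0 sqrf_eq0 a0.
pose k := ((a ^+ 2 + b ^+ 2) / a)%R.
have k0 : k != 0%R by rewrite mulf_neq0 ?invr_eq0 // gt_eqF.
pose G (z : plane) := F (z.1, (k * z.2 + ((b / a) * (z.1 - s) + t))%R) * `|k|%:E.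
have mG : measurable_fun setT G.
  apply: emeasurable_funM => //; apply: (measurableT_comp mF).
  apply: measurable_fun_pair => //.
  apply: measurable_funD; first exact: measurable_funM.
  by apply: measurable_funD => //; apply: measurable_funM => //; exact: measurable_funB.
have G0 z : 0 <= G z by rewrite mule_ge0 // lee_fin.
transitivity (\int[leb2 R]_z G z).
  rewrite (leb2E mF F0) (leb2E mG G0); apply: eq_integral => x _.
  by rewrite (leb_affine ((b / a) * (x - s) + t)%R k0) //; exact: measurable_slice1.
rewrite (leb2E' mG G0).
pose H (z : plane) := G ((a * z.1 + (s - b * z.2))%R, z.2) * `|a|%:E.
have mH : measurable_fun setT H.
  apply: emeasurable_funM => //; apply: (measurableT_comp mG).
  apply: measurable_fun_pair => //.
  apply: measurable_funD; first exact: measurable_funM.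
  by apply: measurable_funB => //; exact: measurable_funM.
have H0 z : 0 <= H z by rewrite mule_ge0 // lee_fin.
transitivity (\int[leb2 R]_z H z).
  rewrite (leb2E' mH H0); apply: eq_integral => y _.
  by rewrite (leb_affine (s - b * y)%R a0) //; exact: measurable_slice2.
apply: eq_integral => -[x y] _; rewrite /H /G /= -muleA -EFinM; congr (F (_, _) * _%:E).
- ring.
- by rewrite /k; field.
- by rewrite -normrM /k divfK // gtr0_norm.
Qed.

Lemma leb2_cmul (c d : C) F : c != 0%R -> measurable_fun setT F -> (forall z, 0 <= F z) ->
  \int[leb2 R]_z F z =
  \int[leb2 R]_z (F (complex.Re (c * pc z + d), complex.Im (c * pc z + d))%R * (cabs c ^+ 2)%:E).
Proof.
case: c => a b c0 mF F0; have [a0|a0] := eqVneq a 0%R; last first.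
  rewrite (leb2_cmul_aux b (complex.Re d) (complex.Im d) a0) //.
  apply: eq_integral => -[x y] _; rewrite cabs_sqr /= cReD cImD ?cReM ?cImM /=.
  by congr (F (_, _) * _); ring.
(* For a purely imaginary multiplier the elimination has pivot zero; the factorisation i b = (1 + i)
   (b / 2) (1 + i) has two admissible factors. *)
have b0 : (b / 2)%R != 0%R.
  move: c0; apply: contra; rewrite mulf_eq0 invr_eq0 pnatr_eq0 orbF => /eqP ->.
  by rewrite a0.
have o0 : (1%R : R) != 0%R by exact: oner_neq0.
rewrite (leb2_cmul_aux 1%R (complex.Re d) (complex.Im d) o0) //.
set H := (fun z : plane => F _ * _).
have mH : measurable_fun setT H.
  apply: emeasurable_funM => //; apply: (measurableT_comp mF).
  apply: measurable_fun_pair; apply: measurable_funD => //;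
  [apply: measurable_funB|apply: measurable_funD]; exact: measurable_funM.
have H0 z : 0 <= H z by rewrite mule_ge0 // lee_fin addr_ge0 ?sqr_ge0.
rewrite (leb2_cmul_aux (b / 2) 0%R 0%R b0 mH H0).
apply: eq_integral => -[x y] _; rewrite /H cabs_sqr /= cReD cImD ?cReM ?cImM /= a0 -muleA -EFinM.
by congr (F (_, _) * _%:E); field.
Qed.

Definition cinvw (c : R) (z : plane) : plane :=
  (complex.Re (rc c / pc z)%R, complex.Im (rc c / pc z)%R).

Lemma cReV (z : C) : complex.Re (z^-1)%R = (complex.Re z / (cabs z ^+ 2))%R.
Proof. by rewrite cabs_sqr; case: z. Qed.
Lemma cImV (z : C) : complex.Im (z^-1)%R = (- complex.Im z / (cabs z ^+ 2))%R.
Proof. by rewrite cabs_sqr; case: z => x y /=; rewrite mulNr. Qed.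

(** The coordinates (x, t) with y = x t, of Jacobian x, stand in for polar coordinates on the right
    half plane: at a fixed slope, both the inversion and the modulus involve x alone. *)
Lemma slopeE F : measurable_fun setT F -> (forall z, 0 <= F z) ->
  (forall z, ~~ (0 < z.1)%R -> F z = 0) ->
  \int[leb2 R]_z F z =
  \int[leb]_t \int[leb]_x (if (0 < x)%R then F (x, (x * t)%R) * x%:E else 0).
Proof.
move=> mF F0 Fz.
pose G (z : plane) := if (0 < z.1)%R then F (z.1, (z.1 * z.2)%R) * (z.1)%:E else 0.
have mG : measurable_fun setT G.
  apply: measurable_fun_ifT => //; first exact: measurable_fun_ltr.
  apply: emeasurable_funM; last exact/measurable_EFinP.
  by apply: (measurableT_comp mF); apply: measurable_fun_pair => //; exact: measurable_funM.
have G0 z : 0 <= G z.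
  by rewrite /G; case: ifP => // x0; rewrite mule_ge0 // lee_fin ltW.
transitivity (\int[leb2 R]_z G z); last by rewrite (leb2E' mG G0).
rewrite (leb2E mF F0) (leb2E mG G0); apply: eq_integral => x _; rewrite /G /=; case: (boolP (0 < x)%R) => x0.
  rewrite (leb_affine 0%R (lt0r_neq0 x0) (measurable_slice1 x mF)) //.
  by apply: eq_integral => y _; rewrite addr0 gtr0_norm.
by rewrite !integral0_eq // => y _; rewrite Fz.
Qed.

Lemma measurable_cV d (T : measurableType d) (f : T -> C) :
  measurable_fun setT (fun x => complex.Re (f x) : T1) -> measurable_fun setT (fun x => complex.Im (f x) : T1) ->
  measurable_fun setT (fun x => complex.Re (f x)^-1%R : T1) /\
  measurable_fun setT (fun x => complex.Im (f x)^-1%R : T1).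
Proof.
move=> mr mi; split.
  under eq_fun do rewrite cReV cabs_sqr; apply: measurable_funM => //.
  by apply: measurable_funV; apply: measurable_funD; exact: measurable_funX.
under eq_fun do rewrite cImV cabs_sqr; apply: measurable_funM => //.
  exact: measurableT_comp.
by apply: measurable_funV; apply: measurable_funD; exact: measurable_funX.
Qed.

Lemma measurable_cM d (T : measurableType d) (f g : T -> C) :
  measurable_fun setT (fun x => complex.Re (f x) : T1) -> measurable_fun setT (fun x => complex.Im (f x) : T1) ->
  measurable_fun setT (fun x => complex.Re (g x) : T1) -> measurable_fun setT (fun x => complex.Im (g x) : T1) ->
  measurable_fun setT (fun x => complex.Re (f x * g x)%R : T1) /\
  measurable_fun setT (fun x => complex.Im (f x * g x)%R : T1).
Proof.
move=> a b c d'; split.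
  under eq_fun do rewrite cReM; apply: measurable_funB; exact: measurable_funM.
under eq_fun do rewrite cImM; apply: measurable_funD; exact: measurable_funM.
Qed.

Lemma measurable_pcRe : measurable_fun setT (fun x : plane => complex.Re (pc x) : T1).
Proof. exact: measurable_fst. Qed.
Lemma measurable_pcIm : measurable_fun setT (fun x : plane => complex.Im (pc x) : T1).
Proof. exact: measurable_snd. Qed.

Lemma measurable_cinvw c : measurable_fun setT (cinvw c).
Proof.
have [h1 h2] : measurable_fun setT (fun x : plane => complex.Re (pc x)^-1%R : T1) /\
  measurable_fun setT (fun x : plane => complex.Im (pc x)^-1%R : T1) by apply: measurable_cV; [exact: measurable_pcRe|exact: measurable_pcIm].
have [h3 h4] : measurable_fun setT (fun x : plane => complex.Re (rc c * (pc x)^-1)%R : T1) /\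
  measurable_fun setT (fun x : plane => complex.Im (rc c * (pc x)^-1)%R : T1) by apply: measurable_cM => //=.
exact: measurable_fun_pair.
Qed.

Lemma cinvw1 c z : (cinvw c z).1 = (c * (z.1 / (z.1 ^+ 2 + z.2 ^+ 2)))%R.
Proof. by rewrite /cinvw cReM cReV cImV cabs_sqr /= mul0r subr0. Qed.
Lemma cinvw2 c z : (cinvw c z).2 = (c * (- z.2 / (z.1 ^+ 2 + z.2 ^+ 2)))%R.
Proof. by rewrite /cinvw cImM cReV cImV cabs_sqr /= mul0r addr0. Qed.

(** The map z -> c / z turns the slope t into - t and, at a fixed slope, x into (c / (1 + t^2)) / x;
    two one-variable substitutions result. *)
Lemma leb2_inversion (c : R) F : (0 < c)%R -> measurable_fun setT F -> (forall z, 0 <= F z) ->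
  (forall z, ~~ (0 < z.1)%R -> F z = 0) ->
  \int[leb2 R]_z F z =
  \int[leb2 R]_z (F (cinvw c z) * (c ^+ 2 / cabs (pc z) ^+ 4)%:E).
Proof.
move=> c0 mF F0 Fz; rewrite slopeE // [RHS]slopeE; first last.
- move=> [x y] /= x0; rewrite Fz ?mul0e // cinvw1 /=.
  apply: contra x0 => h; rewrite ltNge; apply/negP => x0; move: h; rewrite ltNge.
  by rewrite mulr_ge0_le0 ?(ltW c0) // mulr_le0_ge0 // invr_ge0 addr_ge0 ?sqr_ge0.
- by move=> z; rewrite mule_ge0 // lee_fin divr_ge0 ?sqr_ge0 // exprn_ge0 // cabs_ge0.
- apply: emeasurable_funM; first by apply: (measurableT_comp mF); exact: measurable_cinvw.
  apply/measurable_EFinP; apply: measurable_funM => //; apply: measurable_funV.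
  have -> : (fun x : plane => (cabs (pc x) ^+ 4)%R) = (fun x : plane => ((x.1 ^+ 2 + x.2 ^+ 2) ^+ 2)%R).
    by apply/funext => x; rewrite (_ : 4%N = (2 * 2)%N) // exprM cabs_sqr.
  by apply: measurable_funX; apply: measurable_funD; exact: measurable_funX.
have mS : measurable_fun setT (fun z : plane => if (0 < z.1)%R then F (z.1, (z.1 * z.2)%R) * (z.1)%:E else 0).
  apply: measurable_fun_ifT => //; first exact: measurable_fun_ltr.
  apply: emeasurable_funM; last exact/measurable_EFinP.
  by apply: (measurableT_comp mF); apply: measurable_fun_pair => //; exact: measurable_funM.
have n0 : (-1 : R)%R != 0%R by rewrite oppr_eq0 oner_eq0.
pose G (t : T1) := \int[leb]_x (if (0 < x)%R then F (x, (x * t)%R) * x%:E else 0).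
have mG : measurable_fun setT G.
  apply: (measurable_pint (leb1 R) (F := fun z : T1 * T1 => if (0 < z.2)%R then F (z.2, (z.2 * z.1)%R) * (z.2)%:E else 0)).
  apply: (measurableT_comp mS (g := fun z => (z.2, z.1))).
  exact: measurable_fun_pair.
have G0 t : 0 <= G t.
  by apply: integral_ge0 => x _; case: ifP => // x0; rewrite mule_ge0 // lee_fin ltW.
rewrite -[LHS]/(\int[leb]_t G t) (leb_affine 0%R n0) //; apply: eq_integral => t _.
have s0 : (0 < 1 + t ^+ 2)%R by rewrite ltr_pwDl // sqr_ge0.
have c'0 : (0 < c / (1 + t ^+ 2))%R by exact: divr_gt0.
rewrite addr0 normrN normr1 mule1 /G.
(* The absolute value makes the integrand nonnegative on the whole line, as [leb_pos_inv] asks. *)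
pose K (x : T1) := F (x, (x * (-1 * t))%R) * `|x|%:E.
transitivity (\int[leb]_x (if (0 < x)%R then K x else 0)).
  by apply: eq_integral => x _; rewrite /K; case: ifP => // x0; rewrite gtr0_norm.
rewrite (leb_pos_inv c'0); first last.
- by move=> x; rewrite mule_ge0 // lee_fin.
- apply: emeasurable_funM; last by apply/measurable_EFinP; exact: normr_measurable.
  by apply: (measurableT_comp mF); apply: measurable_fun_pair => //; exact: measurable_funM.
apply: eq_integral => x _; case: ifP => // x0; have xn0 : x != 0%R by rewrite gt_eqF.
have sn0 : (1 + t ^+ 2)%R != 0%R by rewrite gt_eqF.
have sn : (x ^+ 2 + (x * t) ^+ 2)%R != 0%R.
  by rewrite exprMn -[X in (X + _)%R]mulr1 -mulrDr mulf_neq0 // sqrf_eq0.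
rewrite /K -!muleA -!EFinM (surjective_pairing (cinvw _ _)) cinvw1 cinvw2 /=; congr (F (_, _) * _%:E).
- by field; rewrite sn0 sn xn0.
- by field; rewrite sn0 sn xn0.
- rewrite gtr0_norm ?divr_gt0 // (_ : 4%N = (2 * 2)%N) // exprM cabs_sqr /=.
  by field; rewrite sn0 sn xn0.
Qed.

End Planar.

(** * Moebius maps of the disc and integrals of radial functions *)

Section PlanarMobius.
Local Open Scope ereal_scope.
Variable R : realType.
Local Notation C := R[i].
Local Notation leb := (@lebesgue_measure R).
Local Notation T1 := (measurableTypeR R).
Local Notation plane := (plane R).
Implicit Types F : plane -> \bar R.

Definition cp (c : C) : plane := (complex.Re c, complex.Im c).
Lemma cpK : cancel cp (@pc R). Proof. by case. Qed.

Lemma measurable_cp d (T : measurableType d) (f : T -> C) :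
  measurable_fun setT (fun x => complex.Re (f x) : T1) ->
  measurable_fun setT (fun x => complex.Im (f x) : T1) ->
  measurable_fun setT (fun x => cp (f x)).
Proof. exact: measurable_fun_pair. Qed.

Definition mob (a w : C) : C := ((a - w) / (1 - a^* * w))%R.

Lemma measurable_cabs4 d (T : measurableType d) (f : T -> C) :
  measurable_fun setT (fun x => complex.Re (f x) : T1) ->
  measurable_fun setT (fun x => complex.Im (f x) : T1) ->
  measurable_fun setT (fun x => (cabs (f x) ^+ 4)%R : T1).
Proof.
move=> mr mi; rewrite (_ : (fun _ => _) = (fun x => ((complex.Re (f x) ^+ 2 + complex.Im (f x) ^+ 2) ^+ 2)%R)).
  by apply: measurable_funX; apply: measurable_funD; exact: measurable_funX.
by apply/funext => x; rewrite (_ : 4%N = (2 * 2)%N) // exprM cabs_sqr.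
Qed.

Lemma re_1Bmul_gt0 (a w : C) : (cabs a < 1)%R -> (cabs w < 1)%R -> (0 < complex.Re (1 - a * w)%R)%R.
Proof.
move=> a1 w1; rewrite cReB /= subr_gt0; apply: le_lt_trans (ler_norm _) _.
apply: le_lt_trans (cRe_le _) _; rewrite cabsM.
by apply: mulr_ilt1; rewrite ?cabs_ge0.
Qed.

(** With u = 1 - a^* w and s = 1 - |a|^2, the Moebius map is (1 - s / u) / a^*, that is, an affine
    map, an inversion and an affine map. A support in the disc becomes a support in Re u > 0, where
    the inversion rule holds. *)
Lemma leb2_mobius (a : C) F : a != 0%R -> (cabs a < 1)%R ->
  measurable_fun setT F -> (forall z, 0 <= F z) ->
  (forall z, ~~ (cabs (pc z) < 1)%R -> F z = 0) ->
  \int[leb2 R]_z F z =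
  \int[leb2 R]_z (F (cp (mob a (pc z))) * ((1 - cabs a ^+ 2) ^+ 2 / cabs (1 - a^* * pc z) ^+ 4)%:E).
Proof.
move=> a0 a1 mF F0 Fz.
have s0 : (0 < 1 - cabs a ^+ 2)%R by rewrite subr_gt0 expr_lt1 ?cabs_ge0.
have aJ0 : (a^* != 0)%R by rewrite -cabs_eq0 cabsJ cabs_eq0.
pose c := (- (a^*)^-1)%R.
have c0 : c != 0%R by rewrite oppr_eq0 invr_eq0.
pose G (u : plane) := F (cp (c * pc u + (a^*)^-1)%R) * (cabs c ^+ 2)%:E.
have G0 z : 0 <= G z by rewrite mule_ge0 // lee_fin sqr_ge0.
have mG : measurable_fun setT G.
  apply: emeasurable_funM => //; apply: (measurableT_comp mF).
  have [h1 h2] : measurable_fun setT (fun x : plane => complex.Re (c * pc x)%R : T1) /\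
      measurable_fun setT (fun x : plane => complex.Im (c * pc x)%R : T1).
    by apply: measurable_cM => //; [exact: measurable_pcRe|exact: measurable_pcIm].
  apply: measurable_cp.
    by under eq_fun do rewrite cReD; exact: measurable_funD.
  by under eq_fun do rewrite cImD; exact: measurable_funD.
have Gz z : ~~ (0 < z.1)%R -> G z = 0.
  move=> z1; rewrite /G Fz ?mul0e // cpK; apply: contra z1 => h.
  have := re_1Bmul_gt0 (a := a^*%R) _ h; rewrite cabsJ => /(_ a1).
  suff -> : (1 - a^* * (c * pc z + (a^*)^-1))%R = pc z by [].
  by rewrite /c; field.
rewrite (leb2_cmul ((a^*)^-1)%R c0 mF F0) -[LHS]/(\int[leb2 R]_z G z).
rewrite (leb2_inversion s0 mG G0 Gz).
set H := (fun z : plane => _).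
have H0 z : 0 <= H z.
  by rewrite mule_ge0 // lee_fin divr_ge0 ?sqr_ge0 // exprn_ge0 // cabs_ge0.
have mH : measurable_fun setT H.
  apply: emeasurable_funM; first by apply: (measurableT_comp mG); exact: measurable_cinvw.
  apply/measurable_EFinP; apply: measurable_funM => //; apply: measurable_funV.
  by apply: measurable_cabs4; [exact: measurable_pcRe|exact: measurable_pcIm].
have c'0 : (- a^*)%R != 0%R by rewrite oppr_eq0.
rewrite (leb2_cmul 1%R c'0 mH H0); apply: eq_integral => z _.
rewrite /H /G -/(cp _) cpK /cinvw -/(cp _) cpK cpK -!muleA -!EFinM.
have -> : (- a^* * pc z + 1 = 1 - a^* * pc z)%R by ring.
have [u0|u0] := eqVneq (1 - a^* * pc z)%R 0%R.
  by rewrite u0 cabs0 expr0n /= !invr0 !(mulr0, mul0r, mule0).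
congr (F (cp _) * _%:E).
  rewrite /mob rcB rc1 rcX -cabsE normCK /c.
  by field; rewrite aJ0 u0.
rewrite /c !cabsN cabsV cabsJ; field.
by rewrite !cabs_eq0 u0 a0.
Qed.

(** By symmetry the right half plane carries half of the integral. At slope t the squared modulus is
    (1 + t^2) x^2, so the substitution in x leaves the weight 1 / (2 (1 + t^2)), and the arctangent
    integral supplies pi. *)
Lemma leb2_radial (Phi : T1 -> \bar R) : measurable_fun setT Phi -> (forall x, 0 <= Phi x) ->
  \int[leb2 R]_z Phi (cabs (pc z) ^+ 2)%R = pi%:E * \int[leb]_v (if (0 < v)%R then Phi v else 0).
Proof.
move=> mP P0.
pose N (z : plane) : T1 := (z.1 ^+ 2 + z.2 ^+ 2)%R.
have mN : measurable_fun setT N by apply: measurable_funD; exact: measurable_funX.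
have NE z : (cabs (pc z) ^+ 2)%R = N z by rewrite cabs_sqr.
under eq_integral do rewrite NE.
pose G x := \int[leb]_y Phi (N (x, y)).
have mPN : measurable_fun setT (fun z => Phi (N z)) by exact: measurableT_comp.
have mG : measurable_fun setT G by exact: (measurable_pint (leb1 R) mPN).
have G0 x : 0 <= G x by exact: integral_ge0.
have GN x : G (- x)%R = G x by apply: eq_integral => y _; rewrite /N /= sqrrN.
rewrite (leb2E mPN) // -[LHS]/(\int[leb]_x G x).
have mpos : measurable [set x : T1 | 0 < x]%R.
  by rewrite -[X in measurable X]setTI; apply: (measurable_fun_ltr (f := fun _ => 0%R) (g := id)) => //.
have gtE (K : T1 -> \bar R) : \int[leb]_(x in `]0%R, +oo[) K x = \int[leb]_x (if (0 < x)%R then K x else 0).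
  rewrite integral_mkcond; apply: eq_integral => x _; rewrite patchE.
  by rewrite mem_setE in_itv /= andbT.
have -> : \int[leb]_x G x = 2%:E * \int[leb]_x (if (0 < x)%R then G x else 0).
  rewrite -gtE -(setUv `]0%R, +oo[) ge0_integral_setU //=; first last.
  - exact/disj_set2P/setICr.
  - by rewrite setUv.
  - exact: measurableC.
  rewrite setCitvr; transitivity (\int[leb]_(x in `]0%R, +oo[) G x + \int[leb]_(x in `]0%R, +oo[) G x); last first.
    by rewrite (_ : 2%:E = 1%:E + 1%:E) ?ge0_muleDl ?mul1e // -?EFinD.
  congr (_ + _).
  transitivity (\int[leb]_(x in `]-oo, 0%R]) G (- x)%R).
    by apply: eq_integral => x _; rewrite GN.
  rewrite -ge0_integration_by_substitution0 //.
  by rewrite integral_itv_obnd_cbnd //; exact: measurable_funTS.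
have -> : \int[leb]_x (if (0 < x)%R then G x else 0) =
    \int[leb2 R]_z (if (0 < z.1)%R then Phi (N z) else 0).
  rewrite leb2E; first last.
  - by move=> z; case: ifP.
  - by apply: measurable_fun_ifT => //; exact: measurable_fun_ltr.
  apply: eq_integral => x _ /=; case: (boolP (0 < x)%R) => x0 //.
  by rewrite integral0_eq.
rewrite slopeE; first last.
- by move=> z; case: ifP.
- by move=> z; case: ifP.
- by apply: measurable_fun_ifT => //; exact: measurable_fun_ltr.
set I := \int[leb]_v (if _ then _ else _).
have I0 : 0 <= I by apply: integral_ge0 => x _; case: ifP.
transitivity (2%:E * \int[leb]_t (I * ((2 * (1 + t ^+ 2))^-1)%:E)).
  congr (_ * _); apply: eq_integral => t _.
  have s0 : (0 < 1 + t ^+ 2)%R by rewrite ltr_pwDl // sqr_ge0.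
  rewrite /I (leb_pos_sqr s0) // muleC -ge0_integralZl //; first last.
  - by rewrite lee_fin invr_ge0 mulr_ge0 // ltW.
  - move=> x _; case: ifP => // _; rewrite mule_ge0 //.
  - apply: measurable_ifpos => //; apply: emeasurable_funM.
      by apply: (measurableT_comp mP); apply: measurable_funM => //; exact: measurable_funX.
    by apply/measurable_EFinP; apply: measurableT_comp => //; exact: measurable_funM.
  apply: eq_integral => x _ /=; case: (boolP (0 < x)%R) => x0; last by rewrite mule0.
  rewrite muleCA -EFinM; congr (Phi _ * _%:E); first by rewrite /N /=; ring.
  rewrite gtr0_norm ?mulr_gt0 //; field; exact: lt0r_neq0.
have msq : measurable_fun setT (fun t : T1 => ((2 * (1 + t ^+ 2))^-1)%R : T1).
  by apply: measurable_funV; apply: measurable_funM => //; apply: measurable_funD => //; exact: measurable_funX.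
have sq0 t : (0 <= (2 * (1 + t ^+ 2))^-1 :> R)%R by rewrite invr_ge0 mulr_ge0 // addr_ge0 ?sqr_ge0.
rewrite ge0_integralZl //; [|exact/measurable_EFinP|by move=> t _; rewrite lee_fin].
rewrite muleCA muleC; congr (_ * _).
have -> : \int[leb]_t ((2 * (1 + t ^+ 2))^-1)%:E = 2%:E * \int[leb]_(t in [set x | (0 <= x)%R]) ((2 * (1 + t ^+ 2))^-1)%:E :> \bar R.
  apply: (ge0_symfun_integralT (f := fun t => (2 * (1 + t ^+ 2))^-1%R)) => //.
  - move=> t; apply: cvgV; first by rewrite mulf_neq0 // gt_eqF // ltr_pwDl // sqr_ge0.
    apply: cvgM; first exact: cvg_cst.
    by apply: cvgD; [exact: cvg_cst|exact: exprn_continuous].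
  - by move=> t /=; rewrite sqrrN.
rewrite -set_itvcy.
have -> : \int[leb]_(t in `[0%R, +oo[) ((2 * (1 + t ^+ 2))^-1)%:E = (2^-1)%:E * \int[leb]_(t in `[0%R, +oo[) (oneDsqr t)^-1%:E :> \bar R.
  rewrite -ge0_integralZl_EFin //.
  - by apply: eq_integral => t _; rewrite -EFinM /oneDsqr invfM.
  apply/measurable_EFinP; apply: measurable_funTS; apply: measurable_funV.
  by apply: measurable_funD => //; exact: measurable_funX.
by rewrite integral0y_oneDsqr -!EFinM; congr EFin; field.
Qed.
End PlanarMobius.

(** * Substitutions in several complex variables *)

Section VolumeSubstitution.
Local Open Scope ereal_scope.
Variable R : realType.
Local Notation C := R[i].
Local Notation T1 := (measurableTypeR R).
Local Notation plane := (plane R).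
Local Notation vol := (@vol R).

Definition ins N (j : 'I_N) (c : C) (p : pt R N.-1) : pt R N :=
  fun i => match unlift j i with Some i' => p i' | None => c end.

Lemma ins_at N (j : 'I_N) c p : ins j c p j = c.
Proof. by rewrite /ins unlift_none. Qed.
Lemma ins_lift N (j : 'I_N) c p i : ins j c p (lift j i) = p i.
Proof. by rewrite /ins liftK. Qed.

Lemma measurable_ins d (T : measurableType d) N (j : 'I_N) (c : T -> plane) (p : T -> mpt R N.-1) :
  measurable_fun setT c -> measurable_fun setT p ->
  measurable_fun setT (fun x => ins j (pc (c x)) (p x) : mpt R N).
Proof.
move=> mc mp; apply: measurable_to_mpt => i; case: (unliftP j i) => [i' ->|->].
- under eq_fun do rewrite ins_lift.
  exact: (measurableT_comp (measurable_coord_Re i') mp).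
- under eq_fun do rewrite ins_at.
  exact: (measurableT_comp (@measurable_pcRe R) mc).
- under eq_fun do rewrite ins_lift.
  exact: (measurableT_comp (measurable_coord_Im i') mp).
- under eq_fun do rewrite ins_at.
  exact: (measurableT_comp (@measurable_pcIm R) mc).
Qed.

Lemma ins_ord0 N c (p : pt R N) : ins ord0 c p = ccons c p.
Proof. by []. Qed.

Lemma ins_ccons N (j : 'I_N.+1) c c0 (p : pt R N) :
  ins (lift ord0 j) c (ccons c0 p) = ccons c0 (ins j c p).
Proof.
apply/funext => i; case: (unliftP ord0 i) => [i' ->|->].
  rewrite cconsS; case: (unliftP j i') => [i'' ->|->]; last by rewrite !ins_at.
  have -> : lift ord0 (lift j i'') = lift (lift ord0 j) (lift ord0 i'').
    by apply/val_inj; rewrite /= /bump /=; lia.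
  by rewrite !ins_lift cconsS.
rewrite ccons0 (_ : ord0 = lift (lift ord0 j) ord0) ?ins_lift ?ccons0 //.
exact/val_inj.
Qed.

(** Any coordinate can be made the outermost one: the inductive step exchanges it with coordinate 0
    by Tonelli. *)
Lemma vol_ins N (j : 'I_N) (F : mpt R N -> \bar R) :
  measurable_fun setT F -> (forall p, 0 <= F p) ->
  \int[vol N]_p F p = \int[leb2 R]_c \int[vol N.-1]_p F (ins j (pc c) p).
Proof.
elim: N j F => [[]//|N IH] j F mF F0.
rewrite (vol_cons mF F0); case: (unliftP ord0 j) => [j' ->|->]; last first.
  by apply: eq_integral => c _; apply: eq_integral => p _; rewrite ins_ord0.
case: N IH j j' F mF F0 => [|N] IH j j' F mF F0; first by exfalso; case: j'.
pose G (z : plane * plane) := \int[vol N]_p F (ccons (pc z.1) (ins j' (pc z.2) p)).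
have mFi : measurable_fun setT
    (fun x : (plane * plane) * mpt R N => F (ccons (pc x.1.1) (ins j' (pc x.1.2) x.2) : mpt R N.+2)).
  apply: (measurableT_comp mF); apply: measurable_ccons.
  - by do 2 apply: measurableT_comp => //.
  - by do 2 apply: measurableT_comp => //.
  - by apply: measurable_ins => //; apply: measurableT_comp.
have mG : measurable_fun setT G by apply: (measurable_pint (vol N) mFi).
have G0 z : 0 <= G z by exact: integral_ge0.
have mFc c : measurable_fun setT (fun p : mpt R N.+1 => F (ccons (pc c) p)).
  by apply: (measurableT_comp mF); apply: measurable_ccons; [exact: measurable_cst|exact: measurable_cst|exact: measurable_id].
transitivity (\int[leb2 R]_x \int[leb2 R]_y G (x, y)).
  apply: eq_integral => c _.
  by rewrite (IH j') //=.
rewrite (fubini_tonelli (m1 := leb2 R) (m2 := leb2 R) G mG G0).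
apply: eq_integral => c _.
have mFi' : measurable_fun setT (fun p : mpt R N.+1 => F (ins (lift ord0 j') (pc c) p)).
  by apply: (measurableT_comp mF); apply: measurable_ins; [exact: measurable_cst|exact: measurable_id].
rewrite (vol_cons mFi' (fun p => F0 _)).
apply: eq_integral => c0 _; apply: eq_integral => p _.
by rewrite ins_ccons.
Qed.

Lemma measurable_diag N (c : 'I_N -> C) :
  measurable_fun setT (fun p : mpt R N => (fun i => c i * p i)%R : mpt R N).
Proof.
apply: measurable_to_mpt => i.
  under eq_fun do rewrite cReM; apply: measurable_funB; apply: measurable_funM => //.
  exact: measurable_coord_Re. exact: measurable_coord_Im.
under eq_fun do rewrite cImM; apply: measurable_funD; apply: measurable_funM => //.
exact: measurable_coord_Im. exact: measurable_coord_Re.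
Qed.

Lemma vol_diag N (c : 'I_N -> C) (F : mpt R N -> \bar R) :
  (forall i, c i != 0)%R -> measurable_fun setT F -> (forall p, 0 <= F p) ->
  \int[vol N]_p F p =
  \int[vol N]_p (F (fun i => c i * p i)%R * (\prod_(i < N) cabs (c i) ^+ 2)%:E).
Proof.
elim: N c F => [|N IH] c F c0 mF F0.
  rewrite !vol0 //; first by rewrite big_ord0 mule1; congr F; apply/funext => -[].
  apply: emeasurable_funM => //; apply: (measurableT_comp mF); exact: measurable_diag.
pose k := (\prod_(i < N) cabs (c (lift ord0 i)) ^+ 2)%R.
have k0 : (0 <= k)%R by apply: prodr_ge0 => i _; exact: sqr_ge0.
have mFc z : measurable_fun setT (fun p : mpt R N => F (ccons z p)).
  by case: z => x y; apply: (measurableT_comp mF); apply: measurable_ccons; [exact: measurable_cst|exact: measurable_cst|exact: measurable_id].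
pose G (z : plane) := \int[vol N]_p F (ccons (pc z) p).
have mG : measurable_fun setT G.
  apply: (measurable_pint (vol N) (F := fun x : plane * mpt R N => F (ccons (pc x.1) x.2))).
  by apply: (measurableT_comp mF); apply: measurable_ccons => //; apply: measurableT_comp.
have G0 z : 0 <= G z by exact: integral_ge0.
rewrite (vol_cons mF F0) -[LHS]/(\int[leb2 R]_z G z) (leb2_cmul 0%R (c0 ord0) mG G0).
rewrite (vol_cons (F := fun p : mpt R N.+1 => F (fun i => c i * p i)%R * _)); first last.
- by move=> p; rewrite mule_ge0 // lee_fin prodr_ge0 // => i _; exact: sqr_ge0.
- by apply: emeasurable_funM => //; apply: (measurableT_comp mF); exact: measurable_diag.
apply: eq_integral => z _; rewrite /G addr0 -/(cp _) cpK.
rewrite (IH (fun i => c (lift ord0 i))) // -/k.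
have mFk : measurable_fun setT (fun p : mpt R N => F (ccons (c ord0 * pc z) (fun i => c (lift ord0 i) * p i))%R * k%:E).
  by apply: emeasurable_funM => //; apply: (measurableT_comp (mFc _)); exact: measurable_diag.
rewrite muleC -ge0_integralZl //; first last.
- by rewrite lee_fin sqr_ge0.
- by move=> p _; rewrite mule_ge0 // lee_fin.
apply: eq_integral => p _; rewrite muleCA -EFinM big_ord_recl -/k; congr (F _ * _).
apply/funext => i; case: (unliftP ord0 i) => [i' ->|->]; first by rewrite !cconsS.
by rewrite !ccons0.
Qed.

Lemma join2_l a b (x : pt R a) (y : pt R b) i : join2 x y (lshift b i) = x i.
Proof. by rewrite /join2; have -> : fintype.split (lshift b i) = inl i by exact: (unsplitK (inl _)). Qed.
Lemma join2_r a b (x : pt R a) (y : pt R b) i : join2 x y (rshift a i) = y i.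
Proof. by rewrite /join2; have -> : fintype.split (rshift a i) = inr i by exact: (unsplitK (inr _)). Qed.

Lemma join2_ccons a b c (x : pt R a) (y : pt R b) :
  join2 (ccons c x) y = ccons c (join2 x y) :> pt R (a + b).+1.
Proof.
apply/funext => i; case: (unliftP ord0 i) => [i' ->|->].
  rewrite cconsS; case: (split_ordP i') => [k ->|k ->].
    rewrite join2_l (_ : lift ord0 (lshift b k) = lshift b (lift ord0 k) :> 'I_(a.+1 + b)); last exact/val_inj.
    by rewrite join2_l cconsS.
  rewrite join2_r (_ : lift ord0 (rshift a k) = rshift a.+1 k :> 'I_(a.+1 + b)); last exact/val_inj.
  by rewrite join2_r.
rewrite ccons0 (_ : ord0 = lshift b ord0 :> 'I_(a.+1 + b)); last exact/val_inj.
by rewrite join2_l ccons0.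
Qed.

Lemma measurable_join2 d (T : measurableType d) a b (f : T -> mpt R a) (g : T -> mpt R b) :
  measurable_fun setT f -> measurable_fun setT g ->
  measurable_fun setT (fun x => join2 (f x) (g x) : mpt R (a + b)).
Proof.
move=> mf mg; apply: measurable_to_mpt => i; case: (split_ordP i) => [k ->|k ->].
- by under eq_fun do rewrite join2_l; exact: (measurableT_comp (measurable_coord_Re k) mf).
- by under eq_fun do rewrite join2_r; exact: (measurableT_comp (measurable_coord_Re k) mg).
- by under eq_fun do rewrite join2_l; exact: (measurableT_comp (measurable_coord_Im k) mf).
- by under eq_fun do rewrite join2_r; exact: (measurableT_comp (measurable_coord_Im k) mg).
Qed.

Lemma vol_join2 a b (F : mpt R (a + b) -> \bar R) :
  measurable_fun setT F -> (forall p, 0 <= F p) ->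
  \int[vol (a + b)]_p F p = \int[vol a]_x \int[vol b]_y F (join2 x y).
Proof.
elim: a F => [|a IH] F mF F0.
  rewrite vol0.
    by apply: eq_integral => p _; congr F; apply/funext => i; rewrite -(join2_r (fun=> 0%R : C) p (a := 0)); congr join2; exact/val_inj.
  apply: (measurable_pint (vol b) (F := fun z : mpt R 0 * mpt R b => F (join2 z.1 z.2))).
  by apply: (measurableT_comp mF); apply: measurable_join2.
have mFc z : measurable_fun setT (fun p : mpt R (a + b) => F (ccons z p)).
  by case: z => x y; apply: (measurableT_comp mF); apply: measurable_ccons; [exact: measurable_cst|exact: measurable_cst|exact: measurable_id].
rewrite -[LHS]/(\int[vol (a + b).+1]_p F p) (vol_cons mF F0).
rewrite (vol_cons (F := fun x : mpt R a.+1 => \int[vol b]_y F (join2 x y))); first last.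
- by move=> p; exact: integral_ge0.
- apply: (measurable_pint (vol b) (F := fun z : mpt R a.+1 * mpt R b => F (join2 z.1 z.2))).
  by apply: (measurableT_comp mF); apply: measurable_join2.
apply: eq_integral => c _; rewrite (IH _ (mFc (pc c)) (fun p => F0 _)).
by apply: eq_integral => x _; apply: eq_integral => y _; rewrite join2_ccons.
Qed.

Lemma vol_join2E a b (F : mpt R (a + b) -> \bar R) :
  measurable_fun setT F ->
  \int[vol (a + b)]_p F p = \int[prod_sfm (vol a) (vol b)]_z F (join2 z.1 z.2).
Proof.
have mJ : measurable_fun setT (fun z : mpt R a * mpt R b => join2 z.1 z.2 : mpt R (a + b)).
  exact: measurable_join2.
move=> mF; rewrite (integral_weighted (m' := prod_sfm (vol a) (vol b))
    (psi := fun z : mpt R a * mpt R b => join2 z.1 z.2 : mpt R (a + b)) (w := fun=> 1%R)) //.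
  by apply: eq_integral => z _; rewrite mule1.
move=> G mG G0; rewrite (vol_join2 mG G0) tonelli; first last.
- by move=> z; rewrite mule1.
- by apply: emeasurable_funM => //; exact: (measurableT_comp mG mJ).
by apply: eq_integral => x _; apply: eq_integral => y _; rewrite mule1.
Qed.

(** With coordinate [j] outermost, the planar Moebius rule acts on it, while for its fixed value the
    remaining coordinates undergo a diagonal map. The factor [J] is prescribed on the disc only,
    hence the truncation on the right. *)
Lemma vol_mobius N (j : 'I_N) (a : C) (c : 'I_N -> C -> C) (psi : mpt R N -> mpt R N)
    (J : mpt R N -> R) (F : mpt R N -> \bar R) :
  a != 0%R -> (cabs a < 1)%R ->
  (forall i w, (cabs w < 1)%R -> c i w != 0%R) -> (forall w, c j w = 1%R) ->
  measurable_fun setT psi -> measurable_fun setT J ->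
  (forall p, psi p j = mob a (p j)) ->
  (forall p i, i != j -> psi p i = (c i (p j) * p i)%R) ->
  (forall p, (0 <= J p)%R) ->
  (forall p, (cabs (p j) < 1)%R -> J p = ((1 - cabs a ^+ 2) ^+ 2 / cabs (1 - a^* * p j) ^+ 4 *
     \prod_(i < N) cabs (c i (p j)) ^+ 2)%R) ->
  measurable_fun setT F -> (forall p, 0 <= F p) ->
  (forall p, ~~ (cabs (p j) < 1)%R -> F p = 0) ->
  \int[vol N]_p F p = \int[vol N]_p (if (cabs (p j) < 1)%R then F (psi p) * (J p)%:E else 0).
Proof.
move=> a0 a1 c0 cj mpsi mJ psij psii J0 JE mF F0 Fz.
pose G (z : plane) := \int[vol N.-1]_p F (ins j (pc z) p).
have mG : measurable_fun setT G.
  apply: (measurable_pint (vol N.-1) (F := fun z : plane * mpt R N.-1 => F (ins j (pc z.1) z.2))).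
  by apply: (measurableT_comp mF); exact: measurable_ins.
have mcabs (f : mpt R N -> C) : measurable_fun setT (fun p => complex.Re (f p) : T1) ->
    measurable_fun setT (fun p => complex.Im (f p) : T1) -> measurable_fun setT (fun p => cabs (f p) : T1).
  move=> mr mi; apply: (measurableT_comp (f := @Num.sqrt R)).
    by apply: continuous_measurable_fun; exact: sqrt_continuous.
  by apply: measurable_funD; exact: measurable_funX.
rewrite (vol_ins j mF F0) -[LHS]/(\int[leb2 R]_z G z) (leb2_mobius a0 a1 mG); first last.
- by move=> z z1; rewrite /G integral0_eq // => p _; rewrite Fz ?ins_at.
- by move=> z; exact: integral_ge0.
rewrite (vol_ins j); first last.
- by move=> p; case: ifP => // _; rewrite mule_ge0 // lee_fin.
- apply: measurable_fun_ifT => //.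
    apply: measurable_fun_ltr => //; apply: mcabs; [exact: measurable_coord_Re|exact: measurable_coord_Im].
  by apply: emeasurable_funM; [exact: measurableT_comp|exact/measurable_EFinP].
apply: eq_integral => z _.
transitivity (if (cabs (pc z) < 1)%R then G (cp (mob a (pc z))) *
    ((1 - cabs a ^+ 2) ^+ 2 / cabs (1 - a^* * pc z) ^+ 4)%:E else 0).
  case: ifPn => // z1.
  (* At the pole the weight is a quotient by zero, hence zero. Elsewhere off the disc the image has
     modulus at least one, where [F] vanishes. *)
  have [u0|u0] := eqVneq (1 - a^* * pc z)%R 0%R.
    by rewrite u0 cabs0 expr0n /= invr0 mulr0 mule0.
  rewrite {1}/G integral0_eq ?mul0e // => p _; rewrite Fz // ins_at cpK /mob.
  rewrite cabsM cabsV ltr_pdivrMr ?cabs_gt0 // mul1r -leNgt.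
  rewrite -(@ler_pXn2r _ 2) ?nnegrE ?cabs_ge0 // -subr_ge0.
  rewrite (_ : _ - _ = (1 - cabs a ^+ 2) * (cabs (pc z) ^+ 2 - 1))%R; last first.
    rewrite !cabs_sqr !(cReB, cImB, cReM, cImM, cReJ, cImJ) /=; ring.
  apply: mulr_ge0; first by rewrite subr_ge0 expr_le1 ?cabs_ge0 // ltW.
  by rewrite subr_ge0 exprn_ege1 // leNgt.
case: ifPn => z1; last by rewrite integral0_eq // => p _; rewrite ins_at (negbTE z1).
have mFi w : measurable_fun setT (fun p : mpt R N.-1 => F (ins j w p)).
  by rewrite -[w]cpK; apply: (measurableT_comp mF); apply: measurable_ins; [exact: measurable_cst|exact: measurable_id].
rewrite /G (vol_diag (c := fun i => c (lift j i) (pc z))) //; [|by move=> i; exact: c0].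
rewrite muleC -ge0_integralZl //; first last.
- by rewrite lee_fin divr_ge0 ?sqr_ge0 // exprn_ge0 // cabs_ge0.
- by move=> p _; rewrite mule_ge0 // lee_fin prodr_ge0 // => i _; exact: sqr_ge0.
- apply: emeasurable_funM => //; apply: (measurableT_comp (mFi _)); exact: measurable_diag.
apply: eq_integral => p _; rewrite ins_at z1 muleCA -EFinM; congr (F _ * _%:E).
  apply/funext => i; case: (unliftP j i) => [i' ->|->]; last by rewrite psij !ins_at cpK.
  by rewrite psii ?ins_lift ?ins_at // eq_sym neq_lift.
rewrite JE ?ins_at //; congr (_ * _)%R.
by rewrite [RHS](bigD1_ord j) //= cj cabs1 expr1n mul1r.
Qed.
End VolumeSubstitution.

(** * Complex differentiability *)

Section ComplexDifferentiability.
Variable R : realType.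
Local Notation C := R[i].

Definition cdiff N (f : pt R N -> C) (p a : pt R N) : Prop :=
  forall e : R, 0 < e -> exists d : R, 0 < d /\
    forall h : pt R N, (forall j, cabs (h j) < d) ->
      cabs (f (fun j => p j + h j) - f p - \sum_(j < N) a j * h j)
        <= e * \sum_(j < N) cabs (h j).

Definition ccont N (f : pt R N -> C) (p : pt R N) : Prop :=
  forall e : R, 0 < e -> exists d : R, 0 < d /\
    forall q, cball p d q -> cabs (f q - f p) < e.

Lemma ptD N (p q : pt R N) : q = (fun j => p j + (q j - p j)).
Proof. by apply/funext => j; rewrite addrC subrK. Qed.

Lemma cdiff_lip N (f : pt R N -> C) p a : cdiff f p a ->
  exists d : R, 0 < d /\ forall h : pt R N, (forall j, cabs (h j) < d) ->
    cabs (f (fun j => p j + h j) - f p) <= (1 + \sum_j cabs (a j)) * \sum_(j < N) cabs (h j).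
Proof.
move=> /(_ 1 ltr01) [d [d0 H]]; exists d; split=> // h hd.
have := H h hd; rewrite mul1r => {}H.
rewrite -[X in cabs X](subrK (\sum_(j < N) a j * h j)).
apply: le_trans (cabsD _ _) _; rewrite mulrDl mul1r; apply: lerD => //.
apply: le_trans (cabs_sum _ _ _) _; rewrite mulr_suml; apply: ler_sum => j _.
rewrite cabsM ler_wpM2l ?cabs_ge0 //.
by rewrite (bigD1 j) //= lerDl sumr_ge0 // => i _; exact: cabs_ge0.
Qed.

Lemma cdiff_cont N (f : pt R N -> C) p a : cdiff f p a -> ccont f p.
Proof.
move=> /cdiff_lip [d [d0 H]] e e0.
pose K := (1 + \sum_j cabs (a j)) * N%:R + 1.
have L0 : 0 <= \sum_j cabs (a j) by apply: sumr_ge0 => i _; exact: cabs_ge0.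
have K0 : 0 < K by rewrite ltr_wpDl // mulr_ge0 // addr_ge0.
exists (Num.min d (e / K)); split; first by rewrite lt_min d0 divr_gt0.
move=> q qp; rewrite [q in f q](ptD p); apply: le_lt_trans (H _ _) _.
  by move=> j; have := qp j; rewrite lt_min => /andP[].
have : \sum_(j < N) cabs (q j - p j) <= N%:R * (e / K).
  rewrite -[X in X%:R]card_ord -sum1_card natr_sum mulr_suml; apply: ler_sum => j _.
  by have := qp j; rewrite lt_min mul1r => /andP[_ /ltW].
move=> /(ler_wpM2l (addr_ge0 ler01 L0)) /le_lt_trans; apply.
rewrite (_ : (1 + _) * _ = e * ((1 + \sum_j cabs (a j)) * N%:R) / K); last by ring.
by rewrite ltr_pdivrMr // ltr_pM2l // /K ltrDl.
Qed.

Lemma cdiff_cst N (c : C) p : cdiff (fun _ : pt R N => c) p (fun=> 0).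
Proof.
move=> e e0; exists 1; split=> // h _.
rewrite subrr big1 ?subrr ?cabs0 => [|j _]; last by rewrite mul0r.
by rewrite mulr_ge0 ?sumr_ge0 // 1?ltW // => j _; exact: cabs_ge0.
Qed.

Lemma cdiff_coord N (i : 'I_N) p : cdiff (fun q : pt R N => q i) p (fun j => (j == i)%:R).
Proof.
move=> e e0; exists 1; split=> // h _.
rewrite (bigD1 i) //= eqxx mul1r big1 => [|j /negbTE ->]; last by rewrite mul0r.
rewrite addr0 (_ : _ - h i = 0); last by ring.
rewrite cabs0.
by rewrite mulr_ge0 ?sumr_ge0 // 1?ltW // => j _; exact: cabs_ge0.
Qed.

(** The error splits into that of [f] at the increment [k], whose coordinates sum to at most S T,
    and the errors of the [F i] weighted by [b i]; each is allotted e / 2. The added units in the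
    constants keep the denominators positive, also in dimension zero. *)
Lemma cdiff_comp M N (f : pt R N -> C) (F : pt R M -> pt R N) p b (A : 'I_N -> pt R M) :
  cdiff f (F p) b -> (forall i, cdiff (fun q => F q i) p (A i)) ->
  cdiff (fun q => f (F q)) p (fun j => \sum_i b i * A i j).
Proof.
move=> df dF e e0.
pose L i := 1 + \sum_j cabs (A i j).
have L0 i : 0 <= L i by rewrite addr_ge0 // sumr_ge0 // => j _; exact: cabs_ge0.
pose B := \sum_i cabs (b i) + 1.
have B0 : 0 < B by rewrite ltr_wpDl // sumr_ge0 // => j _; exact: cabs_ge0.
pose S := \sum_i L i + 1.
have S0 : 0 < S by rewrite ltr_wpDl // sumr_ge0.
have e1 : 0 < e / 2 / S by rewrite !divr_gt0.
have e2 : 0 < e / 2 / (N%:R + 1) / B by rewrite !divr_gt0 // ltr_wpDl.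
have [d1 [d10 H1]] := df _ e1.
have [d2 Hd2] : exists d2, 0 < d2 /\ forall i h, (forall j, cabs (h j) < d2) ->
    cabs (F (fun j => p j + h j) i - F p i - \sum_(j < M) A i j * h j)
      <= e / 2 / (N%:R + 1) / B * \sum_(j < M) cabs (h j) /\
    cabs (F (fun j => p j + h j) i - F p i) <= L i * \sum_(j < M) cabs (h j).
  have H i : exists d, 0 < d /\ forall h, (forall j, cabs (h j) < d) ->
    cabs (F (fun j => p j + h j) i - F p i - \sum_(j < M) A i j * h j)
      <= e / 2 / (N%:R + 1) / B * \sum_(j < M) cabs (h j) /\
    cabs (F (fun j => p j + h j) i - F p i) <= L i * \sum_(j < M) cabs (h j).
    have [a [a0 Ha]] := dF i _ e2; have [c [c0 Hc]] := cdiff_lip (dF i).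
    exists (Num.min a c); split; first by rewrite lt_min a0.
    move=> h hd; split; [apply: Ha|apply: Hc] => j; have := hd j;
    by rewrite lt_min => /andP[].
  have [d Hd] := choice H.
  exists (\big[Num.min/1]_i d i); split.
    by apply: lt_bigmin => // i _; case: (Hd i).
  move=> i h hd; apply: (Hd i).2 => j; apply: lt_le_trans (hd j) _.
  exact: bigmin_le_cond.
case: Hd2 => d20 H2.
have M0 : 0 < M%:R + 1 :> R by rewrite ltr_wpDl.
exists (Num.min d2 (d1 / S / (M%:R + 1))); split.
  by rewrite lt_min d20 !divr_gt0.
move=> h hd.
have hd2 j : cabs (h j) < d2 by have := hd j; rewrite lt_min => /andP[].
set T := \sum_(j < M) cabs (h j).
have T0 : 0 <= T by rewrite sumr_ge0 // => j _; exact: cabs_ge0.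
have Td : T <= M%:R * (d1 / S / (M%:R + 1)).
  apply: le_trans (ler_sum _ (G := fun=> d1 / S / (M%:R + 1)) _) _ => [j _|].
    by have := hd j; rewrite lt_min => /andP[_ /ltW].
  by rewrite sumr_const card_ord mulr_natl.
pose k i := F (fun j => p j + h j) i - F p i.
have kd i : cabs (k i) < d1.
  apply: le_lt_trans (H2 i h hd2).2 _.
  apply: le_lt_trans (ler_wpM2l (L0 i) Td) _.
  have LS : L i <= S.
    by rewrite /S (bigD1 i) //= -addrA lerDl addr_ge0 // sumr_ge0.
  apply: le_lt_trans (ler_wpM2r _ LS) _.
    by rewrite mulr_ge0 // ltW // !divr_gt0.
  rewrite (_ : S * _ = M%:R / (M%:R + 1) * d1); last by field; rewrite !gt_eqF.
  by rewrite gtr_pMl // ltr_pdivrMr // mul1r ltrDl.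
have E : (fun i => F p i + k i) = F (fun j => p j + h j).
  by apply/funext => l; rewrite /k addrC subrK.
have {H1} := H1 k kd; rewrite E => H1.
rewrite (_ : \sum_(j < M) _ * h j = \sum_i b i * (\sum_(j < M) A i j * h j)); last first.
  under eq_bigr do rewrite mulr_suml; rewrite exchange_big /=.
  by apply: eq_bigr => i _; rewrite mulr_sumr; apply: eq_bigr => j _; rewrite mulrA.
rewrite (_ : _ - _ = (f (F (fun j => p j + h j)) - f (F p) - \sum_i b i * k i) +
   \sum_i b i * (k i - \sum_(j < M) A i j * h j)); last first.
  under [X in _ = _ + X]eq_bigr do rewrite mulrBr.
  by rewrite sumrB addrA subrK.
apply: le_trans (cabsD _ _) _.
rewrite (_ : e * T = e / 2 * T + e / 2 * T); last by field.
apply: lerD.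
  apply: le_trans H1 _.
  rewrite (_ : e / 2 * T = e / 2 / S * (S * T)); last by field; rewrite gt_eqF.
  rewrite ler_wpM2l ?(ltW e1) //.
  apply: le_trans (ler_sum _ (fun i _ => (H2 i h hd2).2)) _.
  by rewrite -mulr_suml ler_wpM2r // /S lerDl.
apply: le_trans (cabs_sum _ _ _) _.
have : \sum_(i < N) cabs (b i * (k i - \sum_(j < M) A i j * h j)) <=
   \sum_(i < N) B * (e / 2 / (N%:R + 1) / B * T).
  apply: ler_sum => i _; rewrite cabsM; apply: ler_pM; rewrite ?cabs_ge0 //.
    rewrite /B (bigD1 i) //= -addrA lerDl addr_ge0 // sumr_ge0 // => j _; exact: cabs_ge0.
  exact: (H2 i h hd2).1.
move=> /le_trans; apply.
rewrite sumr_const card_ord -[X in X <= _]mulr_natl.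
have n0 : 0 < N%:R + 1 :> R by rewrite ltr_wpDl.
rewrite (_ : N%:R * _ = N%:R / (N%:R + 1) * (e / 2 * T)); last by field; rewrite !gt_eqF.
by rewrite ler_piMl ?mulr_ge0 // 1?ltW ?divr_gt0 // ltr_pdivrMr // mul1r ltrDl.
Qed.

Definition cdiff1 (f : C -> C) (z a : C) : Prop :=
  forall e : R, 0 < e -> exists d : R, 0 < d /\
    forall h, cabs h < d -> cabs (f (z + h) - f z - a * h) <= e * cabs h.

Lemma cdiff1P (f : C -> C) z a :
  cdiff1 f z a <-> cdiff (fun p : pt R 1 => f (p ord0)) (fun=> z) (fun=> a).
Proof.
split=> H e /H[d [d0 {}H]]; exists d; split=> // h hd.
  by rewrite !big_ord_recl !big_ord0 !addr0 H.
by have := H (fun=> h) (fun=> hd); rewrite !big_ord_recl !big_ord0 !addr0.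
Qed.

Lemma cdiff_comp1 N (f : C -> C) (F : pt R N -> C) p b a :
  cdiff1 f (F p) b -> cdiff F p a -> cdiff (fun q => f (F q)) p (fun j => b * a j).
Proof.
move=> /cdiff1P df dF.
have := @cdiff_comp N 1 _ (fun q _ => F q) p (fun=> b) (fun=> a) df (fun=> dF).
by congr cdiff; apply/funext => j; rewrite big_ord_recl big_ord0 addr0.
Qed.

Lemma cdiff1_curve N (f : pt R N -> C) (g : C -> pt R N) z b (a : pt R N) :
  cdiff f (g z) b -> (forall i, cdiff1 (fun w => g w i) z (a i)) ->
  cdiff1 (fun w => f (g w)) z (\sum_i b i * a i).
Proof.
move=> df dg; apply/cdiff1P.
apply: (@cdiff_comp 1 N f (fun q => g (q ord0)) (fun=> z) b (fun i _ => a i) df).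
by move=> i; exact: (cdiff1P (fun w => g w i) z (a i)).1.
Qed.

Lemma cdiff1_comp (f g : C -> C) z b a : cdiff1 f (g z) b -> cdiff1 g z a ->
  cdiff1 (fun w => f (g w)) z (b * a).
Proof. by move=> df /cdiff1P dg; apply/cdiff1P; apply: (cdiff_comp1 (F := fun p => g (p ord0))). Qed.

Lemma cdiffD N (f g : pt R N -> C) p a b : cdiff f p a -> cdiff g p b ->
  cdiff (fun q => f q + g q) p (fun j => a j + b j).
Proof.
move=> df dg e e0; have e2 : 0 < e / 2 by rewrite divr_gt0.
have [d1 [d10 H1]] := df _ e2; have [d2 [d20 H2]] := dg _ e2.
exists (Num.min d1 d2); split; first by rewrite lt_min d10.
move=> h hd; under [X in _ - X]eq_bigr do rewrite mulrDl.
rewrite big_split /= (_ : _ - _ = (f (fun j => p j + h j) - f p - \sum_(i < N) a i * h i) +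
  (g (fun j => p j + h j) - g p - \sum_(i < N) b i * h i)); last by ring.
apply: le_trans (cabsD _ _) _; rewrite (_ : e = e / 2 + e / 2); last by field.
rewrite mulrDl; apply: lerD; [apply: H1|apply: H2] => j; have := hd j;
by rewrite lt_min => /andP[].
Qed.

Lemma cdiff_mul (p : pt R 2) : cdiff (fun q => q ord0 * q (lift ord0 ord0)) p
  (fun j => if j == ord0 then p (lift ord0 ord0) else p ord0).
Proof.
move=> e e0; exists e; split=> // h hd; rewrite !big_ord_recl !big_ord0 !addr0 /=.
rewrite (_ : _ - _ = h ord0 * h (lift ord0 ord0)); last by ring.
rewrite cabsM mulrDr; apply: ler_wpDl; first by rewrite mulr_ge0 ?cabs_ge0 // ltW.
by apply: ler_wpM2r; rewrite ?cabs_ge0 // ltW.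
Qed.

(** The chain rule applied to multiplication as a function on C^2. *)
Lemma cdiffM N (f g : pt R N -> C) p a b : cdiff f p a -> cdiff g p b ->
  cdiff (fun q => f q * g q) p (fun j => a j * g p + f p * b j).
Proof.
move=> df dg.
pose F (q : pt R N) : pt R 2 := fun i => if i == ord0 then f q else g q.
have := @cdiff_comp N 2 _ F p _ (fun i => if i == ord0 then a else b) (cdiff_mul (F p)).
move=> H; have {H} := H _; rewrite /F /= => H.
rewrite (_ : (fun j => _) = (fun j : 'I_N =>
   \sum_(i < 2) (if i == ord0 then g p else f p) * (if i == ord0 then a else b) j)).
  by apply: H => i; case: ifP.
by apply/funext => j; rewrite !big_ord_recl big_ord0 addr0 /= mulrC.
Qed.

Lemma cdiff1_id z : cdiff1 id z 1.
Proof.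
move=> e e0; exists 1; split=> // h _; rewrite /= mul1r (_ : _ - h = 0); last by ring.
by rewrite cabs0 mulr_ge0 ?cabs_ge0 // ltW.
Qed.
Lemma cdiff1_cst c z : cdiff1 (fun=> c) z 0.
Proof. by move=> e e0; exists 1; split=> // h _; rewrite subrr mul0r subrr cabs0 mulr_ge0 ?cabs_ge0 // ltW. Qed.
Lemma cdiff1D f g z a b : cdiff1 f z a -> cdiff1 g z b -> cdiff1 (fun w => f w + g w) z (a + b).
Proof. by move=> /cdiff1P df /cdiff1P dg; apply/cdiff1P; exact: (cdiffD df dg). Qed.
Lemma cdiff1M f g z a b : cdiff1 f z a -> cdiff1 g z b ->
  cdiff1 (fun w => f w * g w) z (a * g z + f z * b).
Proof. by move=> /cdiff1P df /cdiff1P dg; apply/cdiff1P; exact: (cdiffM df dg). Qed.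
Lemma cdiff1N f z a : cdiff1 f z a -> cdiff1 (fun w => - f w) z (- a).
Proof.
by move=> df e /df[d [d0 H]]; exists d; split=> // h /H; rewrite -cabsN; congr (cabs _ <= _); ring.
Qed.

Lemma cdiff1V z : z != 0 -> cdiff1 (fun w => w^-1) z (- z ^- 2).
Proof.
move=> z0 e e0; have c0 : 0 < cabs z by rewrite cabs_gt0.
exists (Num.min (cabs z / 2) (e * cabs z ^+ 3 / 2)); split.
  by rewrite lt_min divr_gt0 //= divr_gt0 // mulr_gt0 // exprn_gt0.
move=> h; rewrite lt_min => /andP[h1 h2].
have zh : cabs z / 2 <= cabs (z + h).
  have := cabsBl z (- h); rewrite opprK cabsN; apply: le_trans; lra.
have zh0 : z + h != 0 by rewrite -cabs_gt0 (lt_le_trans _ zh) // divr_gt0.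
rewrite (_ : _ - _ = h ^+ 2 / (z ^+ 2 * (z + h))); last by field; rewrite zh0 z0.
rewrite cabsM cabsV cabsM !cabsX expr2 -mulrA mulrC ler_wpM2r ?cabs_ge0 //.
rewrite ler_pdivrMr; last by rewrite mulr_gt0 ?exprn_gt0 // (lt_le_trans _ zh) // divr_gt0.
apply: le_trans (ltW h2) _.
rewrite (_ : e * cabs z ^+ 3 / 2 = e * (cabs z ^+ 2 * (cabs z / 2))); last by field.
by rewrite ler_wpM2l ?(ltW e0) // ler_wpM2l // sqr_ge0.
Qed.

Lemma cdiff1_cont f z a : cdiff1 f z a ->
  forall e : R, 0 < e -> exists d : R, 0 < d /\ forall w, cabs (w - z) < d -> cabs (f w - f z) < e.
Proof.
move=> /cdiff1P /cdiff_cont H e /H[d [d0 {}H]]; exists d; split=> // w wz.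
by apply: (H (fun=> w)) => j.
Qed.

End ComplexDifferentiability.

(** * Goursat's theorem on rectangles *)

Section SegmentIntegral.
Variable R : realType.
Local Notation leb := (@lebesgue_measure R).
Implicit Types (f g : R -> R) (a b c : R).

(** For b < a the interval is empty and the value is zero; no orientation sign is attached. *)
Definition sint f a b : R := \int[leb]_(x in `[a, b]) f x.
Definition contin f a b := forall x, a <= x <= b -> {for x, continuous f}.

Lemma contin_integrable f a b : contin f a b -> leb.-integrable `[a, b] (EFin \o f).
Proof.
move=> cf; apply: continuous_compact_integrable; first exact: segment_compact.
by apply: continuous_in_subspaceT => x; rewrite inE /= in_itv /= => /cf.
Qed.

Lemma sint_split f a b c : contin f a b -> a <= c <= b -> sint f a b = sint f a c + sint f c b.
Proof.
move=> cf /andP[ac cb]; have ifab := contin_integrable cf.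
have := @Rintegral_itvB _ f (BLeft a) (BRight b) c ifab.
rewrite !bnd_simp => /(_ ac cb) /eqP; rewrite subr_eq => /eqP h; rewrite /sint h addrC.
rewrite Rintegral_itv_obnd_cbnd //.
by apply: integrableS ifab => //; apply: subset_itv; rewrite bnd_simp.
Qed.

Lemma sint_close f g a b M : contin f a b -> contin g a b -> a <= b ->
  (forall x, a <= x <= b -> `|f x - g x| <= M) -> `|sint f a b - sint g a b| <= M * (b - a).
Proof.
move=> cf cg ab H; have i1 := contin_integrable cf; have i2 := contin_integrable cg.
rewrite /sint -RintegralB //.
have i3 : leb.-integrable `[a, b] (EFin \o (fun x => f x - g x)).
  by apply: contin_integrable => x xab; apply: cvgB; [exact: cf|exact: cg].
apply: le_trans (le_normr_Rintegral _ i3) _ => //.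
have -> : M * (b - a) = \int[leb]_(x in `[a, b]) M.
  rewrite Rintegral_cst // [X in fine X](_ : _ = (b - a)%:E) //.
  rewrite /= lebesgue_measure_itv /= lte_fin; have [//|ba] := ltP a b.
  have -> : b = a by apply/eqP; rewrite eq_le ba ab.
  by rewrite subrr.
apply: le_Rintegral => //.
- by apply: contin_integrable => x xab; apply: cvg_norm; apply: cvgB; [exact: cf|exact: cg].
- by apply: contin_integrable => x xab; exact: cvg_cst.
Qed.

Lemma sint_FTC f F a b : a <= b -> contin f a b -> (forall x, a <= x <= b -> is_derive x 1 F (f x)) ->
  sint f a b = F b - F a.
Proof.
rewrite le_eqVlt => /orP[/eqP <- _ _|ab cf dF].
  by rewrite /sint set_itv1 Rintegral_set1 subrr.
have cF x : a <= x <= b -> {for x, continuous F}.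
  by move=> /dF [/derivable1_diffP/differentiable_continuous].
rewrite /sint /Rintegral (@continuous_FTC2 _ _ F) //.
- by apply: continuous_in_subspaceT => x; rewrite inE /= in_itv /= => /cf.
- split.
  + by move=> x; rewrite in_itv /= => /andP[h1 h2]; case: (dF x) => //; rewrite !ltW.
  + by apply: cvg_at_right_filter; apply: cF; rewrite lexx ltW.
  + by apply: cvg_at_left_filter; apply: cF; rewrite lexx ltW.
- move=> x; rewrite in_itv /= => /andP[h1 h2]; rewrite derive1E; case: (dF x) => //.
  by rewrite !ltW.
Qed.

Lemma contin_affine (al be : R) a b : contin (fun x => al + be * x) a b.
Proof.
by move=> x _; apply: cvgD; [exact: cvg_cst|apply: cvgM; [exact: cvg_cst|exact: cvg_id]].
Qed.

Lemma sint_affine (al be : R) a b : a <= b ->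
  sint (fun x => al + be * x) a b = al * (b - a) + be / 2 * (b ^+ 2 - a ^+ 2).
Proof.
move=> ab; pose F x := al * x + be / 2 * x ^+ 2.
have dF (x : R) : is_derive x 1 F (al + be * x).
  have h := is_deriveD (is_deriveZ al (is_derive_id x 1))
    (is_deriveZ (be / 2) (is_deriveX 2 (is_derive_id x 1))).
  suff <- : al *: 1 + (be / 2) *: ((2%:R * x ^+ 1) *: 1) = al + be * x by exact: h.
  by rewrite /GRing.scale /=; field.
rewrite (sint_FTC (F := F) ab) //; first by rewrite /F; ring.
exact: contin_affine.
Qed.
End SegmentIntegral.

Section Goursat.
Variable R : realType.
Local Notation C := R[i].
Local Notation cx := (@complex.Complex R).

Lemma cdiff1_line (f : C -> C) (z a : C) (g : R -> C) (t : R) :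
  g t = z -> cdiff1 f z a -> (forall s, cabs (g s - g t) <= `|s - t|) ->
  {for t, continuous (fun s => complex.Re (f (g s)))} /\
  {for t, continuous (fun s => complex.Im (f (g s)))}.
Proof.
move=> gt /cdiff1_cont H gl.
split; apply/cvgrPdist_lt => e /H [d [d0 Hd]];
exists d => //= s /= st; rewrite distrC.
  rewrite -cReB gt; apply: le_lt_trans (cRe_le _) (Hd _ _).
  by rewrite -gt; apply: le_lt_trans (gl s) _; rewrite distrC.
rewrite -cImB gt; apply: le_lt_trans (cIm_le _) (Hd _ _).
by rewrite -gt; apply: le_lt_trans (gl s) _; rewrite distrC.
Qed.

Lemma cdiff1_hline (f : C -> C) x y a : cdiff1 f (cx x y) a ->
  {for x, continuous (fun s => complex.Re (f (cx s y)))}.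
Proof.
move=> df; apply: (cdiff1_line (g := fun s => cx s y) _ df _).1 => // s.
apply: le_trans (cabs_leD _) _.
by rewrite cReB cImB /= subrr normr0 addr0.
Qed.

Lemma cdiff1_vline (f : C -> C) x y a : cdiff1 f (cx x y) a ->
  {for y, continuous (fun s => complex.Im (f (cx x s)))}.
Proof.
move=> df; apply: (cdiff1_line (g := fun s => cx x s) _ df _).2 => // s.
apply: le_trans (cabs_leD _) _.
by rewrite cReB cImB /= subrr normr0 add0r.
Qed.

(** The real part of the counterclockwise contour integral of [f] over the rectangle with lower left
    corner [p], width [w] and height [h]; its imaginary part is the same quantity for - i f. *)
Definition bdry (f : C -> C) (w h : R) (p : R * R) : R :=
  sint (fun x => complex.Re (f (cx x p.2))) p.1 (p.1 + w)
  - sint (fun x => complex.Re (f (cx x (p.2 + h)))) p.1 (p.1 + w)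
  - sint (fun y => complex.Im (f (cx (p.1 + w) y))) p.2 (p.2 + h)
  + sint (fun y => complex.Im (f (cx p.1 y))) p.2 (p.2 + h).

Definition holrect (f : C -> C) (w h : R) (p : R * R) :=
  forall x y, p.1 <= x <= p.1 + w -> p.2 <= y <= p.2 + h -> exists a, cdiff1 f (cx x y) a.

Lemma holrect_h f w h p y : holrect f w h p -> p.2 <= y <= p.2 + h ->
  contin (fun x => complex.Re (f (cx x y))) p.1 (p.1 + w).
Proof. by move=> H yh x xw; have [a] := H _ _ xw yh; exact: cdiff1_hline. Qed.

Lemma holrect_v f w h p x : holrect f w h p -> p.1 <= x <= p.1 + w ->
  contin (fun y => complex.Im (f (cx x y))) p.2 (p.2 + h).
Proof. by move=> H xw y yh; have [a] := H _ _ xw yh; exact: cdiff1_vline. Qed.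

(** The integrals over inner sides cancel, so the four quarters add up to the whole and one of them
    carries at least a quarter of it. *)
Lemma bdry_quarter f w h p : 0 <= w -> 0 <= h -> holrect f w h p ->
  exists q : R * R, [/\ `|bdry f w h p| <= 4 * `|bdry f (w / 2) (h / 2) q|,
    p.1 <= q.1 <= p.1 + w / 2, p.2 <= q.2 <= p.2 + h / 2 & holrect f (w / 2) (h / 2) q].
Proof.
move=> w0 h0 H; case: p H => a b H.
pose q1 := (a, b); pose q2 := (a + w / 2, b); pose q3 := (a, b + h / 2); pose q4 := (a + w / 2, b + h / 2).
have w2 : 0 <= w / 2 by rewrite divr_ge0.
have hh : 0 <= h / 2 by rewrite divr_ge0.
have wE : w = w / 2 + w / 2 by field.
have hE : h = h / 2 + h / 2 by field.
have i1 : a <= a <= a + w / 2 by rewrite lexx lerDl.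
have i2 : a <= a + w / 2 <= a + w / 2 by rewrite lexx lerDl w2.
have j1 : b <= b <= b + h / 2 by rewrite lexx lerDl.
have j2 : b <= b + h / 2 <= b + h / 2 by rewrite lexx lerDl hh.
have lew : w / 2 <= w by rewrite {2}wE lerDl.
have leh : h / 2 <= h by rewrite {2}hE lerDl.
have k1 : a <= a + w / 2 <= a + w by rewrite lerDl w2 lerD2l.
have k2 : b <= b + h / 2 <= b + h by rewrite lerDl hh lerD2l.
have E : bdry f w h (a, b) = bdry f (w / 2) (h / 2) q1 + bdry f (w / 2) (h / 2) q2
   + bdry f (w / 2) (h / 2) q3 + bdry f (w / 2) (h / 2) q4.
  rewrite /bdry /=.
  have e1 (c v : R) : c + v / 2 + v / 2 = c + v by field.
  have hs y : b <= y <= b + h -> sint (fun x => complex.Re (f (cx x y))) a (a + w) =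
      sint (fun x => complex.Re (f (cx x y))) a (a + w / 2) +
      sint (fun x => complex.Re (f (cx x y))) (a + w / 2) (a + w).
    move=> yh; apply: sint_split; first exact: (holrect_h H yh).
    exact: k1.
  have vs x : a <= x <= a + w -> sint (fun y => complex.Im (f (cx x y))) b (b + h) =
      sint (fun y => complex.Im (f (cx x y))) b (b + h / 2) +
      sint (fun y => complex.Im (f (cx x y))) (b + h / 2) (b + h).
    move=> xh; apply: sint_split; first exact: (holrect_v H xh).
    exact: k2.
  rewrite !e1 !hs ?vs ?lexx ?lerDl ?w0 ?h0 //.
  set t1 := sint _ _ _; set t2 := sint _ _ _; set t3 := sint _ _ _; set t4 := sint _ _ _.
  clear -t1; ring.
have sub q : a <= q.1 <= a + w / 2 -> b <= q.2 <= b + h / 2 -> holrect f (w / 2) (h / 2) q.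
  move=> /andP[h1 h3'] /andP[h3 h4] x y /andP[h5 h6] /andP[h7 h8].
  apply: H => /=; apply/andP; split.
  - exact: le_trans h5.
  - by apply: le_trans h6 _; rewrite [X in _ <= a + X]wE addrA lerD2r.
  - exact: le_trans h7.
  - by apply: le_trans h8 _; rewrite [X in _ <= b + X]hE addrA lerD2r.
have S q : a <= q.1 <= a + w / 2 -> b <= q.2 <= b + h / 2 ->
   `|bdry f w h (a, b)| <= 4 * `|bdry f (w / 2) (h / 2) q| ->
  exists q : R * R, [/\ `|bdry f w h (a, b)| <= 4 * `|bdry f (w / 2) (h / 2) q|,
    (a, b).1 <= q.1 <= (a, b).1 + w / 2, (a, b).2 <= q.2 <= (a, b).2 + h / 2 & holrect f (w / 2) (h / 2) q].
  by move=> h1 h2 h3; exists q; split => //; exact: sub.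
have T : `|bdry f w h (a, b)| <= `|bdry f (w / 2) (h / 2) q1| + `|bdry f (w / 2) (h / 2) q2|
   + `|bdry f (w / 2) (h / 2) q3| + `|bdry f (w / 2) (h / 2) q4|.
  rewrite E; apply: le_trans (ler_normD _ _) _; rewrite lerD2r.
  by apply: le_trans (ler_normD _ _) _; rewrite lerD2r ler_normD.
have [c1|c1] := leP `|bdry f w h (a, b)| (4 * `|bdry f (w / 2) (h / 2) q1|).
  exact: (S q1 i1 j1 c1).
have [c2|c2] := leP `|bdry f w h (a, b)| (4 * `|bdry f (w / 2) (h / 2) q2|).
  exact: (S q2 i2 j1 c2).
have [c3|c3] := leP `|bdry f w h (a, b)| (4 * `|bdry f (w / 2) (h / 2) q3|).
  exact: (S q3 i1 j2 c3).
have [c4|c4] := leP `|bdry f w h (a, b)| (4 * `|bdry f (w / 2) (h / 2) q4|).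
  exact: (S q4 i2 j2 c4).
exfalso; clear -T c1 c2 c3 c4. lra.
Qed.

(** The affine part of [f] contributes nothing to the contour integral; what is left is at most [M]
    times the perimeter. *)
Lemma bdry_close f w h p (z0 A : C) M : 0 <= w -> 0 <= h -> holrect f w h p ->
  (forall x y, p.1 <= x <= p.1 + w -> p.2 <= y <= p.2 + h ->
     cabs (f (cx x y) - f z0 - A * (cx x y - z0)) <= M) ->
  `|bdry f w h p| <= 2 * M * (w + h).
Proof.
move=> w0 h0 H HM.
pose al := complex.Re (f z0 - A * z0); pose be := complex.Im (f z0 - A * z0).
pose u := complex.Re A; pose v := complex.Im A.
have ReE x y : complex.Re (f z0 + A * (cx x y - z0)) = al - v * y + u * x.
  rewrite /al /u /v !(cReD, cReN, cReM, cImD, cImN) /=; ring.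
have ImE x y : complex.Im (f z0 + A * (cx x y - z0)) = be + v * x + u * y.
  by rewrite /be /u /v !(cImD, cImN, cImM, cReD, cReN) /=; ring.
have hz y : p.2 <= y <= p.2 + h ->
    `|sint (fun x => complex.Re (f (cx x y))) p.1 (p.1 + w) -
      ((al - v * y) * w + u / 2 * ((p.1 + w) ^+ 2 - p.1 ^+ 2))| <= M * w.
  move=> yh; have := @sint_close _ (fun x => complex.Re (f (cx x y))) (fun x => al - v * y + u * x) p.1 (p.1 + w) M.
  rewrite sint_affine ?lerDl // (_ : p.1 + w - p.1 = w); last by ring.
  apply; rewrite ?lerDl //; [exact: (holrect_h H yh)|exact: contin_affine|].
  move=> x xw; rewrite -ReE -cReB; apply: le_trans (cRe_le _) _.
  by rewrite opprD addrA; exact: HM.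
have vt x : p.1 <= x <= p.1 + w ->
    `|sint (fun y => complex.Im (f (cx x y))) p.2 (p.2 + h) -
      ((be + v * x) * h + u / 2 * ((p.2 + h) ^+ 2 - p.2 ^+ 2))| <= M * h.
  move=> xh; have := @sint_close _ (fun y => complex.Im (f (cx x y))) (fun y => be + v * x + u * y) p.2 (p.2 + h) M.
  rewrite sint_affine ?lerDl // (_ : p.2 + h - p.2 = h); last by ring.
  apply; rewrite ?lerDl //; [exact: (holrect_v H xh)|exact: contin_affine|].
  move=> y yw; rewrite -ImE -cImB; apply: le_trans (cIm_le _) _.
  by rewrite opprD addrA; exact: HM.
have b1 : p.2 <= p.2 <= p.2 + h by rewrite lexx lerDl.
have b2 : p.2 <= p.2 + h <= p.2 + h by rewrite lexx lerDl h0.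
have b3 : p.1 <= p.1 <= p.1 + w by rewrite lexx lerDl.
have b4 : p.1 <= p.1 + w <= p.1 + w by rewrite lexx lerDl w0.
have := hz _ b1; have := hz _ b2; have := vt _ b3; have := vt _ b4.
rewrite /bdry.
set I1 := sint _ _ _; set I2 := sint _ _ _; set I3 := sint _ _ _; set I4 := sint _ _ _.
set U := u / 2 * _; set W := u / 2 * _.
rewrite !ler_norml => /andP[h1 h2] /andP[h3 h4] /andP[h5 h6] /andP[h7 h8].
have k1 : (al - v * (p.2 + h)) * w = al * w - v * p.2 * w - v * h * w by ring.
have k2 : (al - v * p.2) * w = al * w - v * p.2 * w by ring.
have k3 : (be + v * (p.1 + w)) * h = be * h + v * p.1 * h + v * h * w by ring.
have k4 : (be + v * p.1) * h = be * h + v * p.1 * h by ring.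
rewrite k1 k2 k3 k4 in h1 h2 h3 h4 h5 h6 h7 h8.
have k5 : 2 * M * (w + h) = 2 * (M * w) + 2 * (M * h) by ring.
rewrite k5; apply/andP; split; lra.
Qed.

Theorem goursat f w h p : 0 <= w -> 0 <= h -> holrect f w h p -> bdry f w h p = 0.
Proof.
move=> w0 h0 H; apply/eqP/negPn/negP => /negbTE bn0.
have B0 : 0 < `|bdry f w h p| by rewrite normr_gt0 bn0.
pose wn n : R := w / 2 ^+ n; pose hn n : R := h / 2 ^+ n.
have p2 n : 0 < 2 ^+ n :> R by exact: exprn_gt0.
have wn0 n : 0 <= wn n by rewrite divr_ge0 // ltW.
have hn0 n : 0 <= hn n by rewrite divr_ge0 // ltW.
have wnS n : wn n / 2 = wn n.+1 by rewrite /wn exprS; field; rewrite gt_eqF.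
have hnS n : hn n / 2 = hn n.+1 by rewrite /hn exprS; field; rewrite gt_eqF.
(* Stated as an implication, so that the choice function is total on all rectangles. *)
pose P (s t : nat * (R * R)) := holrect f (wn s.1) (hn s.1) s.2 -> [/\ t.1 = s.1.+1,
  `|bdry f (wn s.1) (hn s.1) s.2| <= 4 * `|bdry f (wn t.1) (hn t.1) t.2|,
   s.2.1 <= t.2.1 <= s.2.1 + wn t.1, s.2.2 <= t.2.2 <= s.2.2 + hn t.1 & holrect f (wn t.1) (hn t.1) t.2].
have [next Hnext] : {g & forall s, P s (g s)}.
  apply: choice => -[n q]; have [Hq|Hq] := pselect (holrect f (wn n) (hn n) q); last first.
    by exists (n, q) => /Hq.
  have [t [t1 t2 t3 t4]] := bdry_quarter (wn0 n) (hn0 n) Hq.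
  by exists (n.+1, t) => _; rewrite /= -!wnS -!hnS.
pose S n := iter n next (0%N, p).
have wn00 : wn 0 = w by rewrite /wn expr0 divr1.
have hn00 : hn 0 = h by rewrite /hn expr0 divr1.
have SP n : (S n).1 = n /\ holrect f (wn n) (hn n) (S n).2.
  elim: n => [|n [IH1 IH2]]; first by rewrite wn00 hn00.
  have := Hnext (S n); rewrite /P IH1 => /(_ IH2) [E _ _ _].
  by rewrite -[next _]/(S n.+1) in E *; rewrite E.
pose X n := (S n).2.1; pose Y n := (S n).2.2.
have step n : [/\ `|bdry f (wn n) (hn n) (S n).2| <= 4 * `|bdry f (wn n.+1) (hn n.+1) (S n.+1).2|,
   X n <= X n.+1 <= X n + wn n.+1 & Y n <= Y n.+1 <= Y n + hn n.+1].
  have [E1 E2] := SP n; have := Hnext (S n); rewrite /P E1 => /(_ E2).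
  by rewrite -[next _]/(S n.+1) (SP n.+1).1 => -[].
have big n : `|bdry f w h p| <= 4 ^+ n * `|bdry f (wn n) (hn n) (S n).2|.
  elim: n => [|n IH]; first by rewrite expr0 mul1r wn00 hn00.
  apply: le_trans IH _; rewrite exprSr -mulrA ler_wpM2l ?exprn_ge0 //.
  by case: (step n).
have wle n : wn n = wn n.+1 + wn n.+1 by rewrite -wnS; field.
have hle n : hn n = hn n.+1 + hn n.+1 by rewrite -hnS; field.
have Xm n k : X n <= X (n + k)%N /\ X (n + k)%N + wn (n + k)%N <= X n + wn n.
  elim: k => [|k [IH1 IH2]]; first by rewrite addn0.
  rewrite addnS; case: (step (n + k)%N) => _ /andP[h1 h2] _.
  by split; [exact: le_trans h1|have := wle (n + k)%N; lra].
have Ym n k : Y n <= Y (n + k)%N /\ Y (n + k)%N + hn (n + k)%N <= Y n + hn n.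
  elim: k => [|k [IH1 IH2]]; first by rewrite addn0.
  rewrite addnS; case: (step (n + k)%N) => _ _ /andP[h1 h2].
  by split; [exact: le_trans h1|have := hle (n + k)%N; lra].
have lim (Z zn : nat -> R) : (forall n, 0 <= zn n) ->
    (forall n k, Z n <= Z (n + k)%N /\ Z (n + k)%N + zn (n + k)%N <= Z n + zn n) ->
    exists z, forall n, Z n <= z <= Z n + zn n.
  move=> zn0 HZ; exists (sup (range Z)) => n.
  have ub m : ubound (range Z) (Z m + zn m).
    move=> _ [k _ <-]; have [h1 _] := HZ k m; have [_ h2] := HZ m k.
    rewrite addnC in h1; apply: le_trans h1 _.
    by apply: le_trans h2; rewrite lerDl.
  apply/andP; split.
    apply: sup_upper_bound; last by exists n.
    by split; [exists (Z n); exists n|exists (Z 0%N + zn 0%N); exact: ub].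
  by apply: ge_sup; [exists (Z n); exists n|exact: ub].
have [x0 Hx0] := lim X wn wn0 Xm; have [y0 Hy0] := lim Y hn hn0 Ym.
have [A HA] : exists a, cdiff1 f (cx x0 y0) a.
  by apply: H; [have := Hx0 0%N; rewrite wn00|have := Hy0 0%N; rewrite hn00].
have wh0 : 0 < w + h + 1 by lra.
(* The final bound 2 e (w + h)^2 then stays below the supposedly nonzero value; the summand 1 covers
   a degenerate rectangle. *)
pose e := `|bdry f w h p| / (4 * (w + h + 1) ^+ 2).
have e0 : 0 < e by rewrite divr_gt0 // mulr_gt0 // exprn_gt0.
have [d [d0 Hd]] := HA e e0.
have [n nd] : exists n, wn n + hn n < d.
  have [n Hn] : exists n : nat, (w + h) / d < n%:R.
    by exists (Num.truncn ((w + h) / d)).+1; exact: truncnS_gt.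
  exists n; rewrite /wn /hn -mulrDl ltr_pdivrMr // mulrC -ltr_pdivrMr //.
  apply: lt_le_trans Hn _; rewrite -natrX ler_nat; exact/ltnW/ltn_expl.
have cl x y : X n <= x <= X n + wn n -> Y n <= y <= Y n + hn n ->
    cabs (cx x y - cx x0 y0) <= wn n + hn n.
  move=> /andP[a1 a2] /andP[a3 a4]; apply: le_trans (cabs_leD _) _; rewrite cReB cImB /=.
  have /andP[b1 b2] := Hx0 n; have /andP[b3 b4] := Hy0 n.
  clear -a1 a2 a3 a4 b1 b2 b3 b4.
  by apply: lerD; rewrite ler_norml; apply/andP; split; lra.
have := @bdry_close f (wn n) (hn n) (S n).2 (cx x0 y0) A (e * (wn n + hn n)) (wn0 n) (hn0 n) (SP n).2.
(* The diameter bound and the perimeter both shrink like 2^-n, which compensates the factor 4^n lost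
   in the subdivisions. *)
have -> : 2 * (e * (wn n + hn n)) * (wn n + hn n) = 2 * e * (w + h) ^+ 2 / 4 ^+ n.
  rewrite /wn /hn (_ : 4 = 2 * 2 :> R); last by rewrite -natrM.
  by rewrite exprMn; field; rewrite gt_eqF.
move=> Hb0; have {Hb0} Hb : `|bdry f (wn n) (hn n) (S n).2| <= 2 * e * (w + h) ^+ 2 / 4 ^+ n.
  apply: Hb0 => x y hx hy; have h1 := cl x y hx hy.
  have := Hd (cx x y - cx x0 y0) (le_lt_trans h1 nd); rewrite [cx x0 y0 + _]addrC subrK => /le_trans; apply.
  by rewrite ler_pM2l.
have := big n; have p4 : 0 < 4 ^+ n :> R by exact: exprn_gt0.
have : 4 ^+ n * `|bdry f (wn n) (hn n) (S n).2| <= 2 * e * (w + h) ^+ 2.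
  by rewrite mulrC -ler_pdivlMr.
have : 2 * e * (w + h) ^+ 2 < `|bdry f w h p|.
  apply: le_lt_trans (_ : 2 * e * (w + h + 1) ^+ 2 < _).
    apply: ler_wpM2l; first by rewrite mulr_ge0 // ltW.
    have wh : 0 <= w + h by rewrite addr_ge0.
    by rewrite ler_pXn2r ?nnegrE ?lerDl // addr_ge0.
  rewrite /e (_ : 2 * _ * _ = `|bdry f w h p| / 2); last by field; rewrite gt_eqF.
  lra.
lra.
Qed.

End Goursat.

(** * Exponential, logarithm and powers *)

Section RealDerivative.
Variable R : realType.
Implicit Types (f : R -> R) (x df : R).

Lemma derive_eps f x df : is_derive x 1 f df ->
  forall e, 0 < e -> exists d, 0 < d /\ forall h, `|h| < d -> `|f (x + h) - f x - df * h| <= e * `|h|.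
Proof.
move=> [df1 df2] e e0.
have : h^-1 *: ((f \o shift x) (h *: 1) - f x) @[h --> 0^'] --> df.
  by rewrite -df2; exact: df1.
move=> /cvgrPdist_le /(_ e e0) [d d0 Hd]; exists d; split => // h hd.
have [->|h0] := eqVneq h 0; first by rewrite addr0 subrr mulr0 subrr normr0 mulr0.
have := Hd h; rewrite /= sub0r normrN => /(_ hd h0).
rewrite /shift /= /GRing.scale /= mulr1 => H.
rewrite -ler_pdivrMr ?normr_gt0 // -normfV -normrM; move: H.
by rewrite -normrN; congr (`|_| <= _); rewrite [h + x]addrC; field.
Qed.

Lemma eps_derive f x df :
  (forall e, 0 < e -> exists d, 0 < d /\ forall h, `|h| < d -> `|f (x + h) - f x - df * h| <= e * `|h|) ->
  is_derive x 1 f df.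
Proof.
move=> H.
have cv : h^-1 *: ((f \o shift x) (h *: 1) - f x) @[h --> 0^'] --> df.
  apply/cvgrPdist_le => e /H [d [d0 Hd]]; exists d => // h /=; rewrite sub0r normrN => hd h0.
  rewrite /shift /= /GRing.scale /= mulr1.
  rewrite -(ler_pM2r (_ : 0 < `|h|)) ?normr_gt0 // -normrM -[X in X <= _]normrN; move: (Hd h hd).
  by congr (`|_| <= _); rewrite [h + x]addrC; field.
by split; [apply/cvg_ex; exists df|exact/cvg_lim].
Qed.
End RealDerivative.

Section ComplexExponential.
Variable R : realType.
Local Notation C := R[i].
Implicit Types (z w : C).

Definition cexp z : C := rc (expR (complex.Re z)) * cexpi (complex.Im z).

Lemma cexpD z w : cexp (z + w) = cexp z * cexp w.
Proof. by rewrite /cexp cReD cImD expRD rcM cexpiD; ring. Qed.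

Lemma cexp0 : cexp 0 = 1.
Proof. by rewrite /cexp /= expR0 cexpi0 mulr1. Qed.

Lemma cabs_cexp z : cabs (cexp z) = expR (complex.Re z).
Proof. by rewrite cabsM cabs_rc cabs_cexpi mulr1 gtr0_norm // expR_gt0. Qed.

Lemma cexp_neq0 z : cexp z != 0.
Proof. by rewrite -cabs_gt0 cabs_cexp expR_gt0. Qed.

Lemma cdiff1_cexp0 : cdiff1 cexp 0 1.
Proof.
move=> e e0; have e4 : 0 < e / 8 by rewrite divr_gt0.
have [d1 [d10 H1]] := derive_eps (is_derive_expR (0 : R)) e4.
have [d2 [d20 H2]] := derive_eps (is_derive_cos (0 : R)) e4.
have [d3 [d30 H3]] := derive_eps (is_derive_sin (0 : R)) e4.
have [d4 [d40 H4]] := derive_eps (is_derive_expR (0 : R)) ltr01.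
have [d5 [d50 H5]] := derive_eps (is_derive_sin (0 : R)) ltr01.
pose d := Num.min d1 (Num.min d2 (Num.min d3 (Num.min d4 (Num.min d5 (Num.min 1 (e / 16)))))).
exists d; split.
  by rewrite /d !lt_min d10 d20 d30 d40 d50 ltr01 divr_gt0.
move=> h; rewrite /d !lt_min => /and5P[h1 h2 h3 h4 /and3P[h5 h6 h7]].
rewrite add0r mul1r cexp0.
pose x := complex.Re h; pose y := complex.Im h.
have xh : `|x| <= cabs h := cRe_le h; have yh : `|y| <= cabs h := cIm_le h.
have {H1} := H1 x (le_lt_trans xh h1); have {H2} := H2 y (le_lt_trans yh h2).
have {H3} := H3 y (le_lt_trans yh h3); have {H4} := H4 x (le_lt_trans xh h4).
have {H5} := H5 y (le_lt_trans yh h5).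
rewrite !add0r expR0 cos0 sin0 oppr0 !mul0r !addr0 ?subr0 !mul1r.
move=> G5 G4 G3 G2 G1; clear -G1 G2 G3 G4 G5 xh yh h6 h7 e0 e4.
have c1 := cos_le1 y; have c2 := cos_geN1 y.
have cy : `|cos y| <= 1 by rewrite ler_norml c1 c2.
have B0 := cabs_ge0 h.
have x1 : `|1 + x| <= 2 by apply: le_trans (ler_normD _ _) _; rewrite normr1; lra.
have ex1 : `|expR x - 1| <= 2 * cabs h.
  rewrite -[expR x - 1](subrK x); apply: le_trans (ler_normD _ _) _; lra.
have sy : `|sin y| <= 2 * cabs h.
  rewrite -[sin y](subrK y); apply: le_trans (ler_normD _ _) _; lra.
apply: le_trans (cabs_leD _) _; rewrite !cReB !cImB cReM cImM /= mul0r mul0r addr0 !subr0 -/x -/y.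
have -> : expR x * cos y - 1 - x = (expR x - 1 - x) * cos y + (1 + x) * (cos y - 1) by ring.
have -> : expR x * sin y - y = (expR x - 1) * sin y + (sin y - y) by ring.
have g1 : e / 8 * `|x| <= e / 8 * cabs h by rewrite ler_pM2l.
have g2 : e / 8 * `|y| <= e / 8 * cabs h by rewrite ler_pM2l.
have t1 : `|(expR x - 1 - x) * cos y| <= e / 8 * cabs h.
  by rewrite normrM -[X in _ <= X]mulr1; apply: ler_pM => //; lra.
have t2 : `|(1 + x) * (cos y - 1)| <= 2 * (e / 8 * cabs h).
  by rewrite normrM; apply: ler_pM => //; lra.
have t3 : `|(expR x - 1) * sin y| <= e / 4 * cabs h.
  rewrite normrM; apply: le_trans (ler_pM _ _ ex1 sy) _ => //.
  rewrite (_ : e / 4 * cabs h = 2 * cabs h * (2 * (e / 16))); last by field.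
  by rewrite ler_wpM2l ?mulr_ge0 // ler_pM2l // ltW.
have t4 : `|sin y - y| <= e / 8 * cabs h by lra.
have := ler_normD ((expR x - 1 - x) * cos y) ((1 + x) * (cos y - 1)).
have := ler_normD ((expR x - 1) * sin y) (sin y - y).
have eB : 0 <= e * cabs h by rewrite mulr_ge0 // ltW.
lra.
Qed.

Lemma cdiff1_cexp z : cdiff1 cexp z (cexp z).
Proof.
move=> e e0; have c0 : 0 < cabs (cexp z) by rewrite cabs_gt0 cexp_neq0.
have [d [d0 H]] := cdiff1_cexp0 (divr_gt0 e0 c0); exists d; split => // h hd.
have := H h hd; rewrite add0r mul1r cexp0 cexpD.
rewrite (_ : _ - cexp z * h = cexp z * (cexp h - 1 - h)); last by ring.
by rewrite cabsM mulrAC ler_pdivlMr // mulrC.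
Qed.

Definition clog z : C := complex.Complex (ln (cabs z)) (carg z).

Lemma carg_re_gt0 z : 0 < complex.Re z -> carg z = atan (complex.Im z / complex.Re z).
Proof. by rewrite /carg => ->. Qed.

Lemma re_gt0_neq0 z : 0 < complex.Re z -> z != 0.
Proof. by apply: contraL => /eqP ->; rewrite ltxx. Qed.

Lemma clogK z : 0 < complex.Re z -> cexp (clog z) = z.
Proof.
move=> z0; have c0 : 0 < cabs z by rewrite cabs_gt0 re_gt0_neq0.
rewrite /cexp /clog /= lnK // carg_re_gt0 //.
set x := complex.Re z in z0 *; set y := complex.Im z.
have ca : cos (atan (y / x)) = x / cabs z.
  rewrite cos_atan; have -> : 1 + (y / x) ^+ 2 = (cabs z / x) ^+ 2.
    by rewrite !expr_div_n cabs_sqr -/x -/y; field; rewrite gt_eqF.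
  by rewrite sqrtr_sqr ger0_norm ?divr_ge0 ?cabs_ge0 ?ltW // invf_div.
have sa : sin (atan (y / x)) = y / cabs z.
  have := atanK (y / x); rewrite /tan ca => h.
  have xc0 : x / cabs z != 0 by rewrite mulf_neq0 ?invr_eq0 // gt_eqF.
  by rewrite -[LHS](divfK xc0) h; field; rewrite !gt_eqF.
by apply: cplx_eq; rewrite ?cReM ?cImM /= ca sa -/x -/y; field; rewrite gt_eqF.
Qed.

Lemma cont2_eps (F : R * R -> R) z : {for (complex.Re z, complex.Im z), continuous F} ->
  forall e, 0 < e -> exists d, 0 < d /\ forall w, cabs (w - z) < d ->
   `|F (complex.Re w, complex.Im w) - F (complex.Re z, complex.Im z)| < e.
Proof.
move=> /cvgrPdist_lt cF e /cF /nbhs_ballP [d d0 Hd]; exists d; split => // w wz.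
rewrite distrC; apply: Hd; split => /=; rewrite /ball /= distrC -?cReB -?cImB.
  exact: le_lt_trans (cRe_le _) wz.
exact: le_lt_trans (cIm_le _) wz.
Qed.

Lemma clog_cont z : 0 < complex.Re z ->
  forall e, 0 < e -> exists d, 0 < d /\ forall w, cabs (w - z) < d -> cabs (clog w - clog z) < e.
Proof.
move=> z0 e e0; have e2 : 0 < e / 2 by rewrite divr_gt0.
have c0 : 0 < cabs z by rewrite cabs_gt0 re_gt0_neq0.
have c1 : {for (complex.Re z, complex.Im z), continuous (fun p : R * R => ln (Num.sqrt (p.1 ^+ 2 + p.2 ^+ 2)))}.
  apply: (@continuous_comp _ _ _ (fun p : R * R => Num.sqrt (p.1 ^+ 2 + p.2 ^+ 2)) (@ln R)).
    apply: (@continuous_comp _ _ _ (fun p : R * R => p.1 ^+ 2 + p.2 ^+ 2) (@Num.sqrt R)); last exact: sqrt_continuous.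
    apply: cvgD.
      apply: (@continuous_comp _ _ _ fst (fun x : R => x ^+ 2)); [exact: cvg_fst|exact: exprn_continuous].
    apply: (@continuous_comp _ _ _ snd (fun x : R => x ^+ 2)); [exact: cvg_snd|exact: exprn_continuous].
  exact: continuous_ln.
have c2 : {for (complex.Re z, complex.Im z), continuous (fun p : R * R => atan (p.2 / p.1))}.
  apply: (@continuous_comp _ _ _ (fun p : R * R => p.2 / p.1) (@atan R)); last exact: continuous_atan.
  apply: cvgM; first exact: cvg_snd.
  by apply: cvgV; [rewrite gt_eqF|exact: cvg_fst].
have [d1 [d10 H1]] := cont2_eps c1 e2; have [d2 [d20 H2]] := cont2_eps c2 e2.
exists (Num.min (complex.Re z) (Num.min d1 d2)); split; first by rewrite !lt_min z0 d10.
move=> w; rewrite !lt_min => /and3P[h0 h1 h2].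
have w0 : 0 < complex.Re w.
  have := le_lt_trans (cRe_le _) h0; rewrite cReB ltr_norml => /andP[] ; lra.
have {H1} := H1 w h1; have {H2} := H2 w h2; rewrite /= => G2 G1.
apply: le_lt_trans (cabs_leD _) _; rewrite cReB cImB /clog /= !carg_re_gt0 //.
by rewrite [X in _ < X](_ : _ = e / 2 + e / 2); [exact: ltrD|field].
Qed.

(** The increment [k] of the logarithm satisfies h = z (exp k - 1), and [k] is small by continuity;
    the derivative of exp at 0 can thus be inverted. *)
Lemma cdiff1_clog z : 0 < complex.Re z -> cdiff1 clog z z^-1.
Proof.
move=> z0 e e0; have zn0 := re_gt0_neq0 z0; have c0 : 0 < cabs z by rewrite cabs_gt0.
(* The bound 1 / 2 makes |k| at most 2 |h| / |z|; the other bound then turns the error e1 |k| into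
   at most e |h|. *)
pose e1 := Num.min (1 / 2) (e * cabs z / 2).
have e10 : 0 < e1 by rewrite lt_min !divr_gt0 // mulr_gt0.
have [d1 [d10 H1]] := cdiff1_cexp0 e10.
have [d2 [d20 H2]] := clog_cont z0 d10.
exists (Num.min (complex.Re z) d2); split; first by rewrite lt_min z0.
move=> h; rewrite lt_min => /andP[h0 h2].
have w0 : 0 < complex.Re (z + h).
  have := le_lt_trans (cRe_le _) h0; rewrite cReD ltr_norml => /andP[]; lra.
pose k := clog (z + h) - clog z.
have kd : cabs k < d1 by apply: H2; rewrite addrAC subrr add0r.
have {H1} := H1 k kd; rewrite add0r cexp0 mul1r => G.
have hE : h = z * (cexp k - 1).
  have -> : cexp k = (z + h) / z.
    apply: (mulfI zn0); rewrite -{1}(clogK z0) -cexpD /k addrC subrK clogK //.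
    by field.
  by field.
set r := cexp k - 1 - k in G.
have kE : k - z^-1 * h = - r by rewrite [in LHS]hE /r; field.
have k2 : cabs k <= 2 * cabs h / cabs z.
  have : cabs k - cabs r <= cabs (k + r) by have := cabsBl k (- r); rewrite opprK cabsN.
  have -> : k + r = h / z by rewrite [in RHS]hE /r; field.
  rewrite cabsM cabsV -mulrA => H.
  have : e1 * cabs k <= 1 / 2 * cabs k.
    by rewrite ler_wpM2r ?cabs_ge0 // /e1 ge_min lexx.
  lra.
rewrite -/k kE cabsN; apply: le_trans G _.
apply: le_trans (_ : e * cabs z / 2 * cabs k <= _).
  by rewrite ler_wpM2r ?cabs_ge0 // /e1 ge_min lexx orbT.
rewrite (_ : e * cabs h = e * cabs z / 2 * (2 * cabs h / cabs z)); last by field; rewrite gt_eqF.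
by rewrite ler_wpM2l // divr_ge0 // mulr_ge0 // ltW.
Qed.

Lemma cpowE z a : z != 0 -> cpow z a = cexp (rc a * clog z).
Proof.
move=> z0; rewrite /cpow /powR cabs_eq0 (negbTE z0) /cexp cReM cImM /=.
by rewrite !mul0r subr0 addr0.
Qed.

Lemma cdiff1_cpow z a : 0 < complex.Re z -> exists b, cdiff1 (fun w => cpow w a) z b.
Proof.
move=> z0; have zn0 := re_gt0_neq0 z0.
exists (cexp (rc a * clog z) * (0 * clog z + rc a * z^-1)).
have := @cdiff1_comp R cexp (fun w => rc a * clog w) z _ _ (cdiff1_cexp _)
   (cdiff1M (cdiff1_cst (rc a) z) (cdiff1_clog z0)).
move=> H e /H [d [d0 {}H]]; exists (Num.min (complex.Re z) d); split; first by rewrite lt_min z0.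
move=> h; rewrite lt_min => /andP[h0 h1].
have w0 : 0 < complex.Re (z + h).
  have := le_lt_trans (cRe_le _) h0; rewrite cReD ltr_norml => /andP[]; lra.
by rewrite !cpowE ?re_gt0_neq0 //; exact: H.
Qed.

Lemma cpowD z a b : z != 0 -> cpow z (a + b) = cpow z a * cpow z b.
Proof. by move=> z0; rewrite !cpowE // rcD mulrDl cexpD. Qed.

Lemma cpow0 z : z != 0 -> cpow z 0 = 1.
Proof. by move=> z0; rewrite cpowE // mul0r cexp0. Qed.

Lemma cabs_cpow z a : cabs (cpow z a) = powR (cabs z) a.
Proof. by rewrite cabsM cabs_cexpi mulr1 cabs_rc ger0_norm ?powR_ge0. Qed.

Lemma cpow_neq0 z a : z != 0 -> cpow z a != 0.
Proof. by move=> z0; rewrite cpowE // cexp_neq0. Qed.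

Lemma carg_rc (r : R) : 0 < r -> carg (rc r) = 0.
Proof. by move=> r0; rewrite carg_re_gt0 //= mul0r atan0. Qed.

Lemma cpow_rc (r a : R) : 0 < r -> cpow (rc r) a = rc (powR r a).
Proof. by move=> r0; rewrite /cpow carg_rc // mulr0 cexpi0 mulr1 cabs_rc gtr0_norm. Qed.

Lemma carg_bound z : 0 < complex.Re z -> - (pi / 2) < carg z < pi / 2.
Proof. by move=> z0; rewrite carg_re_gt0 // atan_gtNpi2 atan_ltpi2. Qed.

Lemma cpolar z : 0 < complex.Re z -> z = rc (cabs z) * cexpi (carg z).
Proof.
move=> z0; rewrite -{1}(clogK z0) /cexp /clog /= lnK //.
by rewrite qualifE /= cabs_gt0 re_gt0_neq0.
Qed.

Lemma cexpi_eq1 (t : R) : cexpi t = 1 -> `|t| < 2 * pi -> t = 0.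
Proof.
move=> [ct _] tp; apply/eqP/negPn/negP => t0.
have : 0 < sin (`|t| / 2).
  by apply: sin_gt0_pi; rewrite divr_gt0 ?normr_gt0 //= ltr_pdivrMr // mulrC.
have : sin (`|t| / 2) ^+ 2 = 0.
  have : cos (`|t| / 2 + `|t| / 2) = 1.
    rewrite -splitr; case: (ler0P t) => _; [rewrite cosN|]; exact: ct.
  rewrite cosD -!expr2 cos2sin2; lra.
by move/eqP; rewrite sqrf_eq0 => /eqP ->; rewrite ltxx.
Qed.

(* The four arguments lie in (-pi/2, pi/2), so they add up without a multiple of 2 pi. *)
Lemma cpow_mul3 (x y z u : C) (c a : R) :
  0 < complex.Re x -> 0 < complex.Re y -> 0 < complex.Re z -> 0 < complex.Re u -> 0 < c ->
  x * y * z = rc c * u ->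
  cpow x a * cpow y a * cpow z a = rc (powR c a) * cpow u a.
Proof.
move=> x0 y0 z0 u0 c0 E.
have cx0 : 0 < cabs x by rewrite cabs_gt0 re_gt0_neq0.
have cy0 : 0 < cabs y by rewrite cabs_gt0 re_gt0_neq0.
have cz0 : 0 < cabs z by rewrite cabs_gt0 re_gt0_neq0.
have cu0 : 0 < cabs u by rewrite cabs_gt0 re_gt0_neq0.
have EA : cabs x * cabs y * cabs z = c * cabs u.
  by rewrite -!cabsM E cabsM cabs_rc gtr0_norm.
have ER : carg x + carg y + carg z = carg u.
  have /eqP := E; rewrite {1}(cpolar x0) {1}(cpolar y0) {1}(cpolar z0) {1}(cpolar u0).
  rewrite (_ : _ * _ * _ = rc (cabs x * cabs y * cabs z) * cexpi (carg x + carg y + carg z)); last first.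
    by rewrite !rcM !cexpiD; ring.
  have rc0 : rc c != 0 by rewrite rc_eq0 gt_eqF.
  have ru0 : rc (cabs u) != 0 by rewrite rc_eq0 gt_eqF.
  rewrite EA rcM -mulrA => /eqP /(mulfI rc0) /(mulfI ru0) F.
  have : cexpi (carg x + carg y + carg z - carg u) = 1.
    by rewrite cexpiD F -cexpiD subrr cexpi0.
  move/cexpi_eq1 => H; apply/eqP; rewrite -subr_eq0; apply/eqP/H.
  have := carg_bound x0; have := carg_bound y0; have := carg_bound z0; have := carg_bound u0.
  move=> /andP[? ?] /andP[? ?] /andP[? ?] /andP[? ?].
  by rewrite ltr_norml; apply/andP; split; lra.
rewrite /cpow (_ : _ * _ * _ = rc (powR (cabs x) a * powR (cabs y) a * powR (cabs z) a) *
    cexpi (a * (carg x + carg y + carg z))); last first.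
  by rewrite !rcM !mulrDr !cexpiD; ring.
by rewrite -!powRM ?mulr_ge0 ?cabs_ge0 // EA powRM ?cabs_ge0 ?(ltW c0) // ER rcM mulrA.
Qed.

Lemma cpow_mul2 (x y u : C) (c a : R) :
  0 < complex.Re x -> 0 < complex.Re y -> 0 < complex.Re u -> 0 < c ->
  x * y = rc c * u -> cpow x a * cpow y a = rc (powR c a) * cpow u a.
Proof.
move=> x0 y0 u0 c0 E; have := @cpow_mul3 x y (rc 1) u c a x0 y0 ltr01 u0 c0.
by rewrite cpow_rc // powR1 !mulr1; exact.
Qed.

Lemma cpowV z a : 0 < complex.Re z -> cpow z^-1 a = (cpow z a)^-1.
Proof.
move=> z0; have zn0 := re_gt0_neq0 z0.
have v0 : 0 < complex.Re z^-1.
  rewrite (_ : z^-1 = rc (cabs z ^+ 2)^-1 * z^*); last first.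
    by rewrite rcV -mulcJ; field; rewrite -cabs_gt0 cabsJ cabs_gt0 zn0.
  by rewrite cReM /= cReJ mul0r subr0 mulr_gt0 // invr_gt0 exprn_gt0 // cabs_gt0.
apply: (mulfI (cpow_neq0 a zn0)); rewrite mulfV ?cpow_neq0 //.
rewrite (@cpow_mul2 _ _ (rc 1) 1) ?ltr01 //; last by rewrite mulfV // mulr1.
by rewrite cpow_rc // powR1 mulr1.
Qed.

End ComplexExponential.

(** * Circle means *)

Section CircleMean.
Variable R : realType.
Local Notation C := R[i].
Local Notation cx := (@complex.Complex R).
Implicit Types (f g : C -> C) (G : R -> C).

Definition ccurve G := contin (fun t => complex.Re (G t)) 0 (2 * pi) /\
                       contin (fun t => complex.Im (G t)) 0 (2 * pi).

Definition CM G : C := cx (sint (fun t => complex.Re (G t)) 0 (2 * pi) / (2 * pi))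
                          (sint (fun t => complex.Im (G t)) 0 (2 * pi) / (2 * pi)).

Lemma twopi_gt0 : 0 < 2 * pi :> R.
Proof. by rewrite mulr_gt0 // pi_gt0. Qed.

Lemma sint_cst (c : R) a b : a <= b -> sint (fun=> c) a b = c * (b - a).
Proof.
move=> ab; have := @sint_affine R c 0 a b ab; rewrite !mul0r addr0 => <-.
by congr sint; apply/funext => x; rewrite mul0r addr0.
Qed.

Lemma CM_cst c : CM (fun=> c) = c.
Proof.
have p0 := twopi_gt0; apply: cplx_eq; rewrite /= sint_cst ?subr0 ?(ltW p0) //;
by rewrite mulfK // gt_eqF.
Qed.

Lemma sintD (u v : R -> R) a b : contin u a b -> contin v a b ->
  sint (fun t => u t + v t) a b = sint u a b + sint v a b.
Proof. by move=> cu cv; rewrite /sint RintegralD //; exact: contin_integrable. Qed.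

Lemma sintZ (u : R -> R) c a b : contin u a b -> sint (fun t => c * u t) a b = c * sint u a b.
Proof. by move=> cu; rewrite /sint RintegralZl //; exact: contin_integrable. Qed.

Lemma ccurveD G H : ccurve G -> ccurve H -> ccurve (fun t => G t + H t).
Proof.
move=> [a b] [c d]; split.
  by under eq_fun do rewrite cReD; move=> t ht; apply: cvgD; [exact: a|exact: c].
by under eq_fun do rewrite cImD; move=> t ht; apply: cvgD; [exact: b|exact: d].
Qed.

Lemma ccurveM G H : ccurve G -> ccurve H -> ccurve (fun t => G t * H t).
Proof.
move=> [a b] [c d]; split.
  under eq_fun do rewrite cReM; move=> t ht; apply: cvgB; apply: cvgM;
  [exact: a|exact: c|exact: b|exact: d].
under eq_fun do rewrite cImM; move=> t ht; apply: cvgD; apply: cvgM;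
[exact: a|exact: d|exact: b|exact: c].
Qed.

Lemma ccurve_cst c : ccurve (fun=> c).
Proof. by split=> t _; exact: cvg_cst. Qed.

Lemma CMD G H : ccurve G -> ccurve H -> CM (fun t => G t + H t) = CM G + CM H.
Proof.
move=> [a b] [c d]; apply: cplx_eq; rewrite /= ?cReD ?cImD /=.
  by under eq_fun do rewrite cReD; rewrite sintD // mulrDl.
by under eq_fun do rewrite cImD; rewrite sintD // mulrDl.
Qed.

Lemma continZ (u : R -> R) c a b : contin u a b -> contin (fun t => c * u t) a b.
Proof. by move=> cu t ht; apply: cvgM; [exact: cvg_cst|exact: cu]. Qed.

Lemma CMZ G c : ccurve G -> CM (fun t => c * G t) = c * CM G.
Proof.
move=> [a b]; have p0 := twopi_gt0; apply: cplx_eq; rewrite ?cReM ?cImM /=.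
  under eq_fun do rewrite cReM -mulNr; rewrite sintD; [|exact: continZ..].
  by rewrite !sintZ //; ring.
under eq_fun do rewrite cImM; rewrite sintD; [|exact: continZ..].
by rewrite !sintZ //; ring.
Qed.

Lemma ccurve_sum (I : Type) (r : seq I) (F : I -> R -> C) :
  (forall i, ccurve (F i)) -> ccurve (fun t => \sum_(i <- r) F i t).
Proof.
move=> cF; elim: r => [|i r IH].
  by under eq_fun do rewrite big_nil; exact: ccurve_cst.
by under eq_fun do rewrite big_cons; exact: ccurveD.
Qed.

Lemma CM_sum (I : Type) (r : seq I) (F : I -> R -> C) :
  (forall i, ccurve (F i)) -> CM (fun t => \sum_(i <- r) F i t) = \sum_(i <- r) CM (F i).
Proof.
move=> cF; elim: r => [|i r IH].
  by under eq_fun do rewrite big_nil; rewrite big_nil CM_cst.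
under eq_fun do rewrite big_cons.
by rewrite CMD ?big_cons ?IH //; exact: ccurve_sum.
Qed.

(** Real and imaginary parts are estimated separately, whence the factor 2. *)
Lemma CM_bound G M : ccurve G -> (forall t, cabs (G t) <= M) -> cabs (CM G) <= 2 * M.
Proof.
move=> [a b] GM; have p0 := twopi_gt0.
have H u : contin u 0 (2 * pi) -> (forall t, `|u t| <= M) -> `|sint u 0 (2 * pi) / (2 * pi)| <= M.
  move=> cu uM; have := @sint_close _ u (fun=> 0) 0 (2 * pi) M cu _ (ltW p0).
  rewrite sint_cst ?(ltW p0) // mul0r !subr0 => {}H.
  rewrite normrM normfV [X in _ / X]gtr0_norm // ler_pdivrMr //; apply: H.
    by move=> x _; exact: cvg_cst.
  by move=> x _; rewrite subr0.
apply: le_trans (cabs_leD _) _; rewrite (_ : 2 * M = M + M); last by ring.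
apply: lerD; apply: H => // t; apply: le_trans (GM t); [exact: cRe_le|exact: cIm_le].
Qed.

Definition circ (c : C) (rho t : R) : C := c + rc rho * cexpi t.

Lemma circ_dist c rho t : 0 <= rho -> cabs (circ c rho t - c) = rho.
Proof. by move=> r0; rewrite /circ addrAC subrr add0r cabsM cabs_rc cabs_cexpi mulr1 ger0_norm. Qed.

Lemma circ_cexp c rho t : 0 < rho -> circ c rho t = c + cexp (cx (ln rho) t).
Proof. by move=> r0; rewrite /circ /cexp /= lnK. Qed.

Lemma ccurve_comp f (z : R -> C) :
  (forall t, exists a, cdiff1 f (z t) a) ->
  (forall t, {for t, continuous (fun s => complex.Re (z s))}) ->
  (forall t, {for t, continuous (fun s => complex.Im (z s))}) ->
  ccurve (fun t => f (z t)).
Proof.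
move=> df cR cI.
have H t e : 0 < e -> \forall s \near nbhs t, cabs (f (z s) - f (z t)) < e.
  move=> e0; have [a /cdiff1_cont /(_ e e0) [d [d0 Hd]]] := df t.
  have d2 : 0 < d / 2 by rewrite divr_gt0.
  have /cvgrPdist_lt /(_ _ d2) HR := cR t; have /cvgrPdist_lt /(_ _ d2) HI := cI t.
  near=> s; apply: Hd; apply: le_lt_trans (cabs_leD _) _.
  rewrite cReB cImB [X in _ < X]splitr; apply: ltrD; rewrite distrC; near: s; [exact: HR|exact: HI].
split=> t _; apply/cvgrPdist_lt => e e0; near=> s; rewrite distrC.
  rewrite -cReB; apply: le_lt_trans (cRe_le _) _; near: s; exact: H.
rewrite -cImB; apply: le_lt_trans (cIm_le _) _; near: s; exact: H.
Unshelve. all: by end_near. Qed.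

Lemma circ_cont c rho t : {for t, continuous (fun s => complex.Re (circ c rho s))} /\
  {for t, continuous (fun s => complex.Im (circ c rho s))}.
Proof.
have eR : (fun s => complex.Re (circ c rho s)) = (fun s => complex.Re c + rho * cos s).
  by apply/funext => s; rewrite /circ cReD cReM /= mul0r subr0.
have eI : (fun s => complex.Im (circ c rho s)) = (fun s => complex.Im c + rho * sin s).
  by apply/funext => s; rewrite /circ cImD cImM /= mul0r addr0.
rewrite eR eI; split.
  by apply: cvgD; [exact: cvg_cst|apply: cvgM; [exact: cvg_cst|exact: continuous_cos]].
by apply: cvgD; [exact: cvg_cst|apply: cvgM; [exact: cvg_cst|exact: continuous_sin]].
Qed.

Lemma ccurve_circ f c rho : (forall t, exists a, cdiff1 f (circ c rho t) a) ->
  ccurve (fun t => f (circ c rho t)).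
Proof. by move=> df; apply: (ccurve_comp (z := circ c rho) df) => t; [exact: (circ_cont c rho t).1|exact: (circ_cont c rho t).2]. Qed.

Lemma bdryE f w h a b : bdry f w h (a, b) =
  sint (fun x => complex.Re (f (cx x b))) a (a + w)
  - sint (fun x => complex.Re (f (cx x (b + h)))) a (a + w)
  - sint (fun y => complex.Im (f (cx (a + w) y))) b (b + h)
  + sint (fun y => complex.Im (f (cx a y))) b (b + h).
Proof. by []. Qed.

Section MeanValue.
Variables (f : C -> C) (c : C) (rho : R).
Hypothesis rho0 : 0 < rho.
Hypothesis df : forall z, 0 < cabs (z - c) <= rho -> exists a, cdiff1 f z a.
Hypothesis cf : forall e, 0 < e -> exists d, 0 < d /\ forall w, cabs (w - c) < d -> cabs (f w - f c) < e.

Let dfc r : 0 < r <= rho -> forall t, exists a, cdiff1 f (circ c r t) a.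
Proof. by move=> /andP[r0 rr] t; apply: df; rewrite circ_dist ?r0 // ltW. Qed.

(* In the coordinate s = log(z - c) the annulus becomes a rectangle whose horizontal sides cancel by periodicity. *)
Lemma circle_im_const (r : R) : 0 < r <= rho ->
  sint (fun t => complex.Im (f (circ c r t))) 0 (2 * pi) =
  sint (fun t => complex.Im (f (circ c rho t))) 0 (2 * pi).
Proof.
move=> /andP[r0 rr].
have lr : ln r <= ln rho by rewrite ler_ln.
pose psi s := f (c + cexp s).
have H : holrect psi (ln rho - ln r) (2 * pi) (ln r, 0).
  move=> x y /= /andP[x1 x2] _.
  have [a da] : exists a, cdiff1 f (c + cexp (cx x y)) a.
    apply: df; rewrite addrAC subrr add0r cabs_cexp /= expR_gt0 /=.
    by rewrite -[rho]lnK // ler_expR (le_trans x2) // addrC subrK.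
  exists (a * (0 + cexp (cx x y))); apply: (cdiff1_comp (g := fun s => c + cexp s) da).
  by apply: cdiff1D; [exact: cdiff1_cst|exact: cdiff1_cexp].
have := goursat _ _ H; rewrite subr_ge0 => /(_ lr (ltW twopi_gt0)).
rewrite bdryE.
have -> : ln r + (ln rho - ln r) = ln rho by rewrite addrC subrK.
have -> : 0 + 2 * pi = 2 * pi :> R by rewrite add0r.
rewrite (_ : (fun x => complex.Re (psi (cx x (2 * pi)))) = (fun x => complex.Re (psi (cx x 0)))).
  rewrite subrr sub0r => /eqP; rewrite addrC subr_eq0 => /eqP E.
  transitivity (sint (fun y => complex.Im (psi (cx (ln r) y))) 0 (2 * pi)).
    by congr sint; apply/funext => t; rewrite circ_cexp.
  by rewrite E; congr sint; apply/funext => t; rewrite circ_cexp.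
by apply/funext => x; rewrite /psi /cexp /= /cexpi mulr_natl cos2pi sin2pi cos0 sin0.
Qed.

(** All circles of radius at most [rho] give the same integral; on small ones it is close to the
    value at the centre by continuity. *)
Lemma mean_value_im : sint (fun t => complex.Im (f (circ c rho t))) 0 (2 * pi) = 2 * pi * complex.Im (f c).
Proof.
have p0 := twopi_gt0.
apply/eqP; rewrite -subr_eq0 -normr_le0; apply/ler_addgt0Pl => e e0; rewrite addr0.
have ep : 0 < e / (2 * pi) by rewrite divr_gt0.
have [d [d0 Hd]] := cf ep.
pose r := Num.min rho (d / 2).
have r0 : 0 < r by rewrite lt_min rho0 divr_gt0.
have rr : 0 < r <= rho by rewrite r0 /r ge_min lexx.
have rd : r < d by rewrite /r gt_min; apply/orP; right; lra.
rewrite -(circle_im_const rr).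
have [_ c1] := ccurve_circ (dfc rr).
have := @sint_close _ _ (fun=> complex.Im (f c)) 0 (2 * pi) (e / (2 * pi)) c1 _ (ltW p0).
rewrite sint_cst ?(ltW p0) // subr0 divfK ?gt_eqF // [_ * (2 * pi)]mulrC; apply.
  by move=> x _; exact: cvg_cst.
move=> x _; rewrite -cImB; apply: le_trans (cIm_le _) _; apply/ltW/Hd.
by rewrite circ_dist // ltW.
Qed.
End MeanValue.

(** Only continuity is asked at the centre, so that the lemma applies to a difference quotient. The
    real part of [f] is the imaginary part of i f. *)
Lemma mean_value f c rho : 0 < rho ->
  (forall z, 0 < cabs (z - c) <= rho -> exists a, cdiff1 f z a) ->
  (forall e, 0 < e -> exists d, 0 < d /\ forall w, cabs (w - c) < d -> cabs (f w - f c) < e) ->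
  CM (fun t => f (circ c rho t)) = f c.
Proof.
move=> r0 df cf; have p0 := twopi_gt0.
have h1 := mean_value_im r0 df cf.
have h2 : sint (fun t => complex.Im ('i%C * f (circ c rho t))) 0 (2 * pi) = 2 * pi * complex.Im ('i%C * f c).
  apply: (mean_value_im (f := fun z => 'i%C * f z)) => //.
    move=> z /df [a da]; exists (0 * f z + 'i%C * a); apply: cdiff1M => //; exact: cdiff1_cst.
  move=> e /cf [d [d0 H]]; exists d; split => // w /H.
  by rewrite -mulrBr cabsM (_ : cabs 'i%C = 1) ?mul1r // /cabs /= expr0n expr1n add0r sqrtr1.
have ImI (z : C) : complex.Im ('i%C * z) = complex.Re z by rewrite cImM /= mul0r add0r mul1r.
apply: cplx_eq => /=; last by rewrite h1 mulrC mulKf // gt_eqF.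
by rewrite -ImI -[RHS](mulKf (lt0r_neq0 p0)) -h2 mulrC; congr (_ * sint _ _ _); apply/funext => t; rewrite ImI.
Qed.

Lemma mean_value_hol f c rho : 0 < rho ->
  (forall z, cabs (z - c) <= rho -> exists a, cdiff1 f z a) ->
  CM (fun t => f (circ c rho t)) = f c.
Proof.
move=> r0 df; apply: mean_value => //; first by move=> z /andP[_ /df].
have [|a /cdiff1_cont] := df c; last by [].
by rewrite subrr cabs0 ltW.
Qed.

Lemma mob_modulus (w z : C) : cabs (1 - w^* * z) ^+ 2 - cabs (w - z) ^+ 2 = (1 - cabs w ^+ 2) * (1 - cabs z ^+ 2).
Proof. by rewrite !cabs_sqr !(cReD, cReN, cReM, cReJ, cImD, cImN, cImM, cImJ) /=; ring. Qed.

Lemma mob_denom (w z : C) : cabs w < 1 -> cabs z <= 1 -> 1 - w^* * z != 0.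
Proof.
move=> w1 z1; rewrite subr_eq0 eq_sym; apply/eqP => /(congr1 (@cabs R)).
rewrite cabsM cabsJ cabs1 => h; have := cabs_ge0 w; have := cabs_ge0 z => z0 w0.
have : cabs w * cabs z <= cabs w by rewrite ler_piMr.
by rewrite h leNgt w1.
Qed.

(** The disc automorphism taking 0 to [w] preserves the unit circle; the mean value property of the
    composite expresses [f w] by the boundary values. *)
Lemma zero_on_circle f : (forall z, cabs z <= 1 -> exists a, cdiff1 f z a) ->
  (forall z, cabs z = 1 -> f z = 0) -> forall w, cabs w < 1 -> f w = 0.
Proof.
move=> df f0 w w1; pose m z : C := (w - z) / (1 - w^* * z).
have m_le z : cabs z <= 1 -> cabs (m z) <= 1 /\ (cabs z = 1 -> cabs (m z) = 1).
  move=> z1; have dn := mob_denom w1 z1; have dp : 0 < cabs (1 - w^* * z) by rewrite cabs_gt0.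
  have E := mob_modulus w z; rewrite /m cabsM cabsV; split.
    rewrite ler_pdivrMr // mul1r -(@ler_pXn2r _ 2) ?nnegrE ?cabs_ge0 // -subr_ge0 E.
    by apply: mulr_ge0; rewrite subr_ge0 expr_le1 ?cabs_ge0 // ltW.
  move=> z2; move: E; rewrite z2 expr1n subrr mulr0 => /eqP; rewrite subr_eq0 eqrXn2 ?cabs_ge0 // => /eqP <-.
  by rewrite divff // gt_eqF.
have dm z : cabs z <= 1 -> exists a, cdiff1 m z a.
  move=> z1; have dn := mob_denom w1 z1; eexists.
  apply: cdiff1M; first by apply: cdiff1D; [exact: cdiff1_cst|exact: (cdiff1N (cdiff1_id z))].
  apply: (cdiff1_comp (f := GRing.inv) (g := fun z => 1 - w^* * z) (cdiff1V dn)); apply: cdiff1D; first exact: cdiff1_cst.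
  by apply: cdiff1N; apply: cdiff1M; [exact: cdiff1_cst|exact: cdiff1_id].
have := @mean_value_hol (fun z => f (m z)) 0 1 ltr01 _.
rewrite (_ : (fun t => f (m (circ 0 1 t))) = fun=> 0); last first.
  apply/funext => t; have h : cabs (circ 0 1 t) = 1 by rewrite -[circ _ _ _]subr0 circ_dist.
  by apply: f0; apply: (m_le _ _).2; rewrite h.
rewrite CM_cst {2}/m mulr0 !subr0 divr1 => <- //.
move=> z; rewrite subr0 => z1; have [a da] := dm z z1; have [b db] := df (m z) (m_le z z1).1.
by exists (b * a); exact: cdiff1_comp.
Qed.

(** The mean value property of the difference quotient, completed by [a] at the centre, is Cauchy's
    formula for the derivative. In the estimate, |f c| <= 2 M, so the quotient is at most 3 M / rho,
    and [CM_bound] doubles this. *)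
Lemma derivative_bound f c rho M a : 0 < rho ->
  (forall z, cabs (z - c) <= rho -> exists a, cdiff1 f z a) ->
  (forall z, cabs (z - c) = rho -> cabs (f z) <= M) ->
  cdiff1 f c a ->
  a = CM (fun t => (f (circ c rho t) - f c) * (circ c rho t - c)^-1) /\ cabs a <= 6 * M / rho.
Proof.
move=> r0 df fM da.
pose g z := if z == c then a else (f z - f c) * (z - c)^-1.
have ccn t : circ c rho t == c = false.
  by apply/negbTE; rewrite -subr_eq0 -cabs_eq0 circ_dist ?gt_eqF // ltW.
have dg z : 0 < cabs (z - c) <= rho -> exists b, cdiff1 g z b.
  move=> /andP[z0 z1]; have [b db] := df z z1.
  have zc : z - c != 0 by rewrite -cabs_gt0.
  have H : cdiff1 (fun w => (f w - f c) * (w - c)^-1) z ((b + 0) * (z - c)^-1 + (f z - f c) * (- (z - c) ^- 2 * (1 + 0))).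
    apply: cdiff1M; first by apply: cdiff1D => //; exact: cdiff1_cst.
    apply: (cdiff1_comp (f := GRing.inv) (g := fun w => w - c) (cdiff1V zc)); apply: cdiff1D; [exact: cdiff1_id|exact: cdiff1_cst].
  eexists; move=> e /H [d [d0 Hd]]; exists (Num.min (cabs (z - c)) d); split; first by rewrite lt_min z0.
  move=> h; rewrite lt_min => /andP[h1 h2]; have gz : (z == c) = false by rewrite -subr_eq0 (negbTE zc).
  rewrite /g gz ifF; first exact: Hd.
  apply/negbTE; rewrite -subr_eq0 -cabs_gt0.
  have := cabsBl (z - c) (- h); rewrite opprK cabsN.
  by rewrite (_ : z - c + h = z + h - c); [lra|ring].
have cg e : 0 < e -> exists d, 0 < d /\ forall w, cabs (w - c) < d -> cabs (g w - g c) < e.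
  move=> e0; have e2 : 0 < e / 2 by rewrite divr_gt0.
  have [d [d0 Hd]] := da _ e2; exists d; split => // w wd.
  rewrite /g eqxx; case: eqP => [_|/eqP wc]; first by rewrite subrr cabs0.
  have wc0 : 0 < cabs (w - c) by rewrite cabs_gt0 subr_eq0.
  have := Hd _ wd; rewrite [c + _]addrC subrK => H.
  rewrite (_ : _ - a = (f w - f c - a * (w - c)) / (w - c)); last first.
    by field; rewrite subr_eq0.
  by rewrite cabsM cabsV ltr_pdivrMr //; apply: le_lt_trans H _; rewrite ltr_pM2r //; lra.
have E := mean_value r0 dg cg; rewrite {2}/g eqxx in E.
have GE : (fun t => g (circ c rho t)) = (fun t => (f (circ c rho t) - f c) * (circ c rho t - c)^-1).
  by apply/funext => t; rewrite /g ccn.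
have dgc t : exists b, cdiff1 g (circ c rho t) b by apply: dg; rewrite circ_dist ?r0 ?lexx // ltW.
have dfc t : exists b, cdiff1 f (circ c rho t) b by apply: df; rewrite circ_dist ?lexx // ltW.
split; first by rewrite -GE E.
have Mf : cabs (f c) <= 2 * M.
  rewrite -(mean_value_hol r0 df); apply: CM_bound; first exact: ccurve_circ.
  by move=> t; apply: fM; rewrite circ_dist // ltW.
rewrite -E (_ : 6 * M / rho = 2 * (3 * M / rho)); last by field; rewrite gt_eqF.
apply: CM_bound; first exact: ccurve_circ.
move=> t; rewrite /g ccn cabsM cabsV circ_dist ?(ltW r0) // ler_pdivrMr // divfK ?gt_eqF //.
apply: le_trans (cabsD _ _) _; rewrite cabsN.
have : cabs (f (circ c rho t)) <= M by apply: fM; rewrite circ_dist // ltW.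
lra.
Qed.

End CircleMean.

(** * Derivatives of holomorphic functions are holomorphic *)

Section RealCurves.
Variable R : realType.
Local Notation C := R[i].
Local Notation cx := (@complex.Complex R).

Definition rcdiff (g : R -> C) (t : R) (a : C) := forall e : R, 0 < e -> exists d : R, 0 < d /\
  forall s : R, `|s| < d -> cabs (g (t + s) - g t - a * rc s) <= e * `|s|.

Lemma rcdiff_is_derive g t a : rcdiff g t a ->
  is_derive t 1 (fun s => complex.Re (g s)) (complex.Re a) /\
  is_derive t 1 (fun s => complex.Im (g s)) (complex.Im a).
Proof.
move=> H; split; apply: eps_derive => e /H [d [d0 {}H]]; exists d; split => // s /H; apply: le_trans.
  have -> : complex.Re (g (t + s)) - complex.Re (g t) - complex.Re a * s = complex.Re (g (t + s) - g t - a * rc s).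
    by rewrite !cReB cReM /= mulr0 subr0.
  exact: cRe_le.
have -> : complex.Im (g (t + s)) - complex.Im (g t) - complex.Im a * s = complex.Im (g (t + s) - g t - a * rc s).
  by rewrite !cImB cImM /= mulr0 add0r.
exact: cIm_le.
Qed.

(** The curve is extended to a function of a complex variable, affinely in the imaginary direction,
    so that the complex chain and product rules can be reused for real curves. *)
Lemma rcdiff_cdiff1 g t a : rcdiff g t a ->
  cdiff1 (fun w => g (complex.Re w) + a * cx 0 (complex.Im w)) (rc t) a.
Proof.
move=> H e e0; have [d [d0 {}H]] := H e e0; exists d; split => // h hd.
have {H} := H (complex.Re h) (le_lt_trans (cRe_le h) hd) => H.
rewrite cReD cImD /= add0r.
rewrite (_ : _ - a * h = g (t + complex.Re h) - g t - a * rc (complex.Re h)); last first.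
  have hE : h = rc (complex.Re h) + cx 0 (complex.Im h).
    by apply: cplx_eq; rewrite ?cReD ?cImD /= ?addr0 ?add0r.
  by rewrite [in a * h]hE (_ : cx 0 0 = 0) //; ring.
by apply: le_trans H _; rewrite ler_pM2l // cRe_le.
Qed.

Lemma rcdiff_comp N (f : pt R N -> C) (g : R -> pt R N) t b (a : pt R N) :
  cdiff f (g t) b -> (forall i, rcdiff (fun s => g s i) t (a i)) ->
  rcdiff (fun s => f (g s)) t (\sum_i b i * a i).
Proof.
move=> df dg; pose G (w : C) : pt R N := fun i => g (complex.Re w) i + a i * cx 0 (complex.Im w).
have Gr s : G (rc s) = g s.
  by apply/funext => i; rewrite /G /= (_ : cx 0 0 = 0) // mulr0 addr0.
have dfG : cdiff f (G (rc t)) b by rewrite Gr.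
have : cdiff1 (fun w => f (G w)) (rc t) (\sum_i b i * a i).
  exact: (cdiff1_curve dfG (fun i => rcdiff_cdiff1 (dg i))).
move=> H e /H [d [d0 {}H]]; exists d; split => // s sd.
by have := H (rc s); rewrite cabs_rc -rcD !Gr; apply.
Qed.

Lemma rcdiff_line (p h : C) t : rcdiff (fun s => p + rc s * h) t h.
Proof.
move=> e e0; exists 1; split => // s _.
by rewrite (_ : _ - _ = 0) ?cabs0 ?mulr_ge0 // ?ltW // rcD; ring.
Qed.
End RealCurves.

Section Regularity.
Variable R : realType.
Local Notation C := R[i].
Local Notation cx := (@complex.Complex R).

Lemma upd0 N (q : pt R N) l : upd q l 0 = q.
Proof. by apply/funext => j; rewrite /upd addr0; case: ifP. Qed.

Lemma cdiff_upd N (f : pt R N -> C) q a l : cdiff f q a -> cdiff1 (fun c => f (upd q l c)) 0 (a l).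
Proof.
move=> df; have := @cdiff1_curve R N f (fun c => upd q l c) 0 a (fun j => (j == l)%:R).
rewrite upd0 => /(_ df) H; rewrite (_ : a l = \sum_i a i * (i == l)%:R).
  apply: H => i; rewrite /upd; case: eqP => _ /=; last exact: cdiff1_cst.
  by rewrite -[X in cdiff1 _ _ X]add0r; apply: cdiff1D; [exact: cdiff1_cst|exact: cdiff1_id].
by rewrite (bigD1 l) //= eqxx mulr1 big1 ?addr0 // => i /negbTE ->; rewrite mulr0.
Qed.

(** The partial derivatives along 1 and i are [a l] and i times [a l], and the Wirtinger combination
    of these is [a l]. *)
Lemma dz_cdiff N (f : pt R N -> C) q a l : cdiff f q a -> dz f l q = a l.
Proof.
move=> /(cdiff_upd l) df.
have H (c : C) : rcdiff (fun t => f (upd q l (rc t * c))) 0 (a l * c).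
  have df1 : cdiff (fun p : pt R 1 => f (upd q l (p ord0))) (fun=> rc 0 * c) (fun=> a l).
    by apply: (cdiff1P (fun c => f (upd q l c)) (rc 0 * c) (a l)).1; rewrite mul0r.
  have := rcdiff_comp (g := fun t _ => rc t * c) (a := fun=> c) df1 _.
  rewrite big_ord_recl big_ord0 addr0; apply => _ e e0; have [d [d0 H]] := rcdiff_line 0 c 0 e0.
  by exists d; split => // s /H; rewrite !add0r.
have [h1 h2] := rcdiff_is_derive (H 1); have [h3 h4] := rcdiff_is_derive (H 'i%C).
have e1 t : cx t 0 = rc t * 1 by rewrite mulr1.
have e2 t : cx 0 t = rc t * 'i%C by apply: cplx_eq; rewrite ?cReM ?cImM /=; ring.
rewrite /dz; apply: cplx_eq => /=.
  under eq_fun do rewrite e1; under [in X in _ + X]eq_fun do rewrite e2.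
  rewrite !derive1E; case: h1 => _ ->; case: h4 => _ ->.
  by rewrite mulr1 cImM /= mulr0 addr0 mulr1; field.
under eq_fun do rewrite e1; under [in X in _ - X]eq_fun do rewrite e2.
rewrite !derive1E; case: h2 => _ ->; case: h3 => _ ->.
by rewrite mulr1 cReM /= mulr0 sub0r mulr1; field.
Qed.

(** The mean value theorem is applied to the real and to the imaginary part along the segment, after
    subtraction of the linear form [c]; hence the factor 2. *)
Lemma segment_bound N (f : pt R N -> C) (q h : pt R N) (a : R -> pt R N) (c : pt R N) B :
  (forall t : R, 0 <= t <= 1 -> cdiff f (fun j => q j + rc t * h j) (a t)) ->
  (forall t : R, 0 <= t <= 1 -> cabs (\sum_j (a t j - c j) * h j) <= B) ->
  cabs (f (fun j => q j + h j) - f q - \sum_j c j * h j) <= 2 * B.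
Proof.
move=> df aB.
pose g s := f (fun j => q j + rc s * h j) + - (rc s * \sum_j c j * h j).
have dg t : 0 <= t <= 1 -> rcdiff g t (\sum_j (a t j - c j) * h j).
  move=> /df dft; have H := rcdiff_comp (g := fun s j => q j + rc s * h j) dft (fun j => rcdiff_line (q j) (h j) t).
  move=> e /H [d [d0 {}H]]; exists d; split => // s /H; congr (cabs _ <= _).
  have -> : \sum_j (a t j - c j) * h j = \sum_j a t j * h j - \sum_j c j * h j.
    by rewrite -sumrB; apply: eq_bigr => j _; rewrite mulrBl.
  by rewrite /g rcD; ring.
have bound (u : R -> R) (u' : R -> R) : (forall t : R, 0 <= t <= 1 -> is_derive t 1 u (u' t)) ->
    (forall t : R, 0 <= t <= 1 -> `|u' t| <= B) -> `|u 1 - u 0| <= B.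
  move=> du uB; have [||x x01 ->] := @MVT R u u' 0 1 ltr01.
  - by move=> x; rewrite in_itv /= => /andP[x0 x1]; apply: du; rewrite !ltW.
  - apply: continuous_in_subspaceT => x; rewrite inE /= in_itv /= => /du [].
    by move=> /derivable1_diffP/differentiable_continuous.
  - by rewrite subr0 mulr1; apply: uB; move: x01; rewrite in_itv /= => /andP[x0 x1]; rewrite !ltW.
have E1 : (fun j => q j + rc 1 * h j) = (fun j => q j + h j) by apply/funext => j; rewrite mul1r.
have E0 : (fun j => q j + rc 0 * h j) = q by apply/funext => j; rewrite mul0r addr0.
rewrite (_ : _ - _ = g 1 - g 0); last by rewrite /g E1 E0 mul1r mul0r; ring.
apply: le_trans (cabs_leD _) _; rewrite cReB cImB (_ : 2 * B = B + B); last by ring.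
apply: lerD.
  apply: (bound (fun s => complex.Re (g s)) (fun t => complex.Re (\sum_j (a t j - c j) * h j))).
    by move=> t /dg /rcdiff_is_derive [].
  by move=> t /aB; apply: le_trans; exact: cRe_le.
apply: (bound (fun s => complex.Im (g s)) (fun t => complex.Im (\sum_j (a t j - c j) * h j))).
  by move=> t /dg /rcdiff_is_derive [].
by move=> t /aB; apply: le_trans; exact: cIm_le.
Qed.

Lemma cball_sub N (p : pt R N) d d' : d <= d' -> cball p d `<=` cball p d'.
Proof. by move=> dd q H j; exact: lt_le_trans (H j) dd. Qed.

Lemma cball_upd N (p q : pt R N) l c d r : cball p d q -> cabs c <= r -> 0 <= r -> cball p (d + r) (upd q l c).
Proof.
move=> H cr r0 j; rewrite /upd; case: ifP => _; last by apply: lt_le_trans (H j) _; rewrite lerDl.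
by rewrite addrAC; apply: le_lt_trans (cabsD _ _) _; apply: ltr_leD.
Qed.

Lemma cball_convex N (p q h : pt R N) d t : cball p d q -> cball p d (fun j => q j + h j) ->
  0 <= t <= 1 -> cball p d (fun j => q j + rc t * h j).
Proof.
move=> H1 H2 /andP[t0 t1] j.
rewrite (_ : _ - _ = rc (1 - t) * (q j - p j) + rc t * (q j + h j - p j)); last by rewrite rcB rc1; ring.
apply: le_lt_trans (cabsD _ _) _; rewrite !cabsM !cabs_rc !ger0_norm ?subr_ge0 //.
have := H1 j; have := H2 j; rewrite /= => {H1 H2}; set u := cabs _; set v := cabs _ => uh vh.
move: t0; rewrite le_eqVlt => /orP[/eqP <-|t0]; first by rewrite subr0 mul1r mul0r addr0.
have : t * u < t * d by rewrite ltr_pM2l.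
have : (1 - t) * v <= (1 - t) * d by rewrite ler_wpM2l ?subr_ge0 // ltW.
lra.
Qed.

Section Local.
Variables (N : nat) (f : pt R N -> C) (p : pt R N) (r M : R).
Hypothesis r0 : 0 < r.
Hypothesis hf : forall q, cball p (4 * r) q -> exists a, cdiff f q a.
Hypothesis fM : forall q, cball p (4 * r) q -> cabs (f q) <= M.

Let D q : pt R N := fun j => dz f j q.
Let r34 : 3 * r <= 4 * r. Proof. by have := r0; lra. Qed.
Let r24 : 2 * r <= 4 * r. Proof. by have := r0; lra. Qed.
Let r12 : r <= 2 * r. Proof. by have := r0; lra. Qed.

Lemma cdiff_D q : cball p (4 * r) q -> cdiff f q (D q).
Proof.
by move=> /hf [a da]; rewrite (_ : D q = a) //; apply/funext => j; exact: dz_cdiff.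
Qed.

Let upd_cdiff q l z d : d + r <= 4 * r -> cball p d q -> cabs z <= r ->
  cdiff1 (fun c => f (upd q l c)) z (D (upd q l z) l).
Proof.
move=> dr qd zr.
have H : cball p (4 * r) (upd q l z) by apply: cball_sub dr _ _; apply: cball_upd => //; exact: ltW.
have := cdiff_upd l (cdiff_D H) => H1 e /H1 [d1 [d10 Hd]]; exists d1; split => // h /Hd.
have U c : upd (upd q l z) l c = upd q l (z + c).
  by apply/funext => j; rewrite /upd; case: (j == l); rewrite ?addrA.
by rewrite !U addr0 add0r.
Qed.

Let K1 := 6 * M / r.
Let M0 : 0 <= M.
Proof.
apply: le_trans (fM (q := p) _); first exact: cabs_ge0.
by move=> j; rewrite subrr cabs0 mulr_gt0.
Qed.

Let D_bound q l : cball p (3 * r) q -> cabs (D q l) <= K1.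
Proof.
move=> q3; have r3 : 3 * r + r <= 4 * r by lra.
apply: (derivative_bound (f := fun c => f (upd q l c)) (c := 0) r0 _ _ _).2.
- by move=> z; rewrite subr0 => zr; eexists; exact: (upd_cdiff l r3 q3 zr).
- move=> z; rewrite subr0 => zr; apply: fM; apply: cball_sub r3 _ _.
  by apply: cball_upd => //; [rewrite zr|exact: ltW].
- have := upd_cdiff l r3 q3 (z := 0); rewrite cabs0 upd0; apply; exact: ltW.
Qed.

Let S (h : pt R N) := \sum_j cabs (h j).
Let S0 h : 0 <= S h. Proof. by apply: sumr_ge0 => j _; exact: cabs_ge0. Qed.

Let K10 : 0 <= K1. Proof. by rewrite divr_ge0 ?mulr_ge0 // ltW. Qed.

Let f_lip q h : cball p (3 * r) q -> cball p (3 * r) (fun j => q j + h j) ->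
  cabs (f (fun j => q j + h j) - f q) <= 2 * (K1 * S h).
Proof.
move=> q3 qh3.
have seg t : 0 <= t <= 1 -> cball p (3 * r) (fun j => q j + rc t * h j) by exact: cball_convex.
have := @segment_bound N f q h (fun t => D (fun j => q j + rc t * h j)) (fun=> 0) (K1 * S h).
rewrite [\sum_j 0 * _]big1 ?subr0 => [|j _]; last by rewrite mul0r.
apply.
- by move=> t /seg H; apply: cdiff_D; exact: (cball_sub r34 H).
- move=> t /seg H; apply: le_trans (cabs_sum _ _ _) _; rewrite mulr_sumr; apply: ler_sum => j _.
  by rewrite subr0 cabsM ler_wpM2r ?cabs_ge0 //; exact: D_bound.
Qed.

Let K2 := 6 * (2 * K1) / r.

Let K20 : 0 <= K2. Proof. by apply: divr_ge0; [apply: mulr_ge0 => //; apply: mulr_ge0|exact: ltW]. Qed.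

(** Cauchy's estimate for the difference of [f] and its translate by [h], which [f_lip] bounds by a
    multiple of [S h]. *)
Let D_lip q h l : cball p (2 * r) q -> cball p (2 * r) (fun j => q j + h j) ->
  cabs (D (fun j => q j + h j) l - D q l) <= K2 * S h.
Proof.
move=> q2 qh2; have r3 : 2 * r + r <= 4 * r by have := r0; lra.
have r3' : 2 * r + r <= 3 * r by lra.
rewrite (_ : K2 * S h = 6 * (2 * (K1 * S h)) / r); last by rewrite /K2; ring.
pose F c := f (upd (fun j => q j + h j) l c) + - f (upd q l c).
have dF z : cabs z <= r -> cdiff1 F z (D (upd (fun j => q j + h j) l z) l + - D (upd q l z) l).
  by move=> zr; apply: cdiff1D; [exact: (upd_cdiff l r3 qh2 zr)|apply: cdiff1N; exact: (upd_cdiff l r3 q2 zr)].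
apply: (derivative_bound (f := F) (c := 0) r0 _ _ _).2.
- by move=> z; rewrite subr0 => zr; eexists; exact: dF.
- move=> z; rewrite subr0 => zr; rewrite /F.
  rewrite (_ : upd (fun j => q j + h j) l z = (fun j => upd q l z j + h j)); last first.
    by apply/funext => j; rewrite /upd; case: ifP => // _; rewrite addrAC.
  apply: f_lip.
    by apply: cball_sub r3' _ _; apply: cball_upd => //; [rewrite zr|exact: ltW].
  rewrite (_ : (fun j => upd q l z j + h j) = upd (fun j => q j + h j) l z); last first.
    by apply/funext => j; rewrite /upd; case: ifP => // _; rewrite addrAC.
  by apply: cball_sub r3' _ _; apply: cball_upd => //; [rewrite zr|exact: ltW].
- by have := dF 0; rewrite cabs0 !upd0; apply; exact: ltW.
Qed.

Let rem q h := f (fun j => q j + h j) - f q - \sum_j D q j * h j.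

Let taylor q h : cball p (2 * r) q -> cball p (2 * r) (fun j => q j + h j) ->
  cabs (rem q h) <= 2 * (K2 * S h * S h).
Proof.
move=> q2 qh2.
have seg t : 0 <= t <= 1 -> cball p (2 * r) (fun j => q j + rc t * h j) by exact: cball_convex.
apply: (@segment_bound N f q h (fun t => D (fun j => q j + rc t * h j)) (D q)).
- by move=> t /seg H; apply: cdiff_D; exact: (cball_sub r24 H).
- move=> t t01; apply: le_trans (cabs_sum _ _ _) _; rewrite mulr_sumr; apply: ler_sum => j _.
  rewrite cabsM ler_wpM2r ?cabs_ge0 //.
  apply: le_trans (D_lip j q2 (seg t t01)) _; rewrite ler_wpM2l //.
  apply: ler_sum => i _; rewrite cabsM cabs_rc; case/andP: t01 => t0 t1.
  by rewrite ger0_norm // ler_piMl ?cabs_ge0.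
Qed.

(** Cauchy's formula writes [dz f l] as a circle mean of [f] in the l-th coordinate. The mean can be
    differentiated because the Taylor remainder of [f] is quadratic in [h], uniformly along the
    circle. *)
Lemma cdiff_dz l : exists b, cdiff (fun q => dz f l q) p b.
Proof.
pose w t := (circ 0 r t - 0 : C)^-1.
pose pc t : pt R N := upd p l (circ 0 r t).
have cr t : cabs (circ 0 r t) = r by rewrite -[circ _ _ _]subr0 circ_dist // ltW.
have p1 : cball p r p by move=> j; rewrite subrr cabs0.
have p2 : cball p (2 * r) p by exact: (cball_sub r12 p1).
pose b j := CM (fun t => (D (pc t) j - D p j) * w t).
exists b => e e0.
(* Two Taylor remainders divided by [r] give 4 K2 / r, which [CM_bound] doubles; the summand 1 keeps
   [K] positive. *)
pose K := 2 * (4 * K2 / r) + 1.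
have K0 : 0 < K.
  by apply: ltr_wpDl => //; apply: mulr_ge0 => //; apply: divr_ge0; [exact: mulr_ge0|exact: ltW].
exists (Num.min r (e / K / (N%:R + 1))); have n0 : 0 < N%:R + 1 :> R by rewrite ltr_wpDl.
split; first by rewrite lt_min r0 !divr_gt0.
move=> h hd.
have hr j : cabs (h j) < r by have := hd j; rewrite lt_min => /andP[].
have Sh : K * S h <= e.
  have : S h <= N%:R * (e / K / (N%:R + 1)).
    apply: le_trans (ler_sum _ (G := fun=> e / K / (N%:R + 1)) _) _ => [j _|].
      by have := hd j; rewrite lt_min => /andP[_ /ltW].
    by rewrite sumr_const card_ord mulr_natl.
  move=> /(ler_wpM2l (ltW K0)) /le_trans; apply.
  rewrite (_ : K * _ = N%:R / (N%:R + 1) * e); last by field; rewrite !gt_eqF.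
  by rewrite ger_pMl // ler_pdivrMr // mul1r lerDl.
have ph : cball p r (fun j => p j + h j) by move=> j; rewrite addrAC subrr add0r.
have ph2 : cball p (2 * r) (fun j => p j + h j) by exact: (cball_sub r12 ph).
have pcb t : cball p (2 * r) (pc t).
  by rewrite (_ : 2 * r = r + r); [apply: cball_upd => //; [rewrite cr|exact: ltW]|ring].
have pch t : cball p (2 * r) (fun j => pc t j + h j).
  rewrite (_ : (fun j => pc t j + h j) = upd (fun j => p j + h j) l (circ 0 r t)); last first.
    by apply/funext => j; rewrite /pc /upd; case: ifP => // _; rewrite addrAC.
  by rewrite (_ : 2 * r = r + r); [apply: cball_upd => //; [rewrite cr|exact: ltW]|ring].
have r3 : r + r <= 4 * r by have := r0; lra.
have DE q : cball p r q -> D q l = CM (fun t => (f (upd q l (circ 0 r t)) - f q) * w t).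
  move=> qr; have := (derivative_bound (f := fun c => f (upd q l c)) (c := 0) (rho := r) (M := M) (a := D q l) r0 _ _ _).1.
  rewrite upd0; apply.
  - by move=> z; rewrite subr0 => zr; eexists; exact: (upd_cdiff l r3 qr zr).
  - move=> z; rewrite subr0 => zr; apply: fM; apply: cball_sub r3 _ _.
    by apply: cball_upd => //; [rewrite zr|exact: ltW].
  - have := upd_cdiff l r3 qr (z := 0); rewrite cabs0 upd0; apply; exact: ltW.
have cw : ccurve w.
  apply: (ccurve_circ (f := fun z => (z - 0)^-1)) => t.
  have z0 : circ 0 r t - 0 != 0 by rewrite subr0 -cabs_gt0 cr.
  eexists; apply: (cdiff1_comp (f := GRing.inv) (g := fun z => z - 0) (cdiff1V z0)).
  by apply: cdiff1D; [exact: cdiff1_id|exact: cdiff1_cst].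
have cf q : cball p r q -> ccurve (fun t => f (upd q l (circ 0 r t))).
  move=> qr; apply: (ccurve_circ (f := fun c => f (upd q l c))) => t.
  by eexists; apply: (upd_cdiff l r3 qr); rewrite cr.
have cfw q : cball p r q -> ccurve (fun t => (f (upd q l (circ 0 r t)) - f q) * w t).
  by move=> qr; apply: ccurveM => //; apply: ccurveD; [exact: cf|exact: ccurve_cst].
have cD j : ccurve (fun t => D (pc t) j).
  have H t e' : 0 < e' -> \forall s \near nbhs t, cabs (D (pc s) j - D (pc t) j) < e'.
    move=> e'0; have K20' : 0 < K2 + 1 by rewrite ltr_wpDl.
    have d2 : 0 < e' / (K2 + 1) / 2 by rewrite !divr_gt0.
    have [/cvgrPdist_lt /(_ _ d2) HR /cvgrPdist_lt /(_ _ d2) HI] := circ_cont (0 : C) r t.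
    near=> s; pose k i := pc s i - pc t i.
    have ks : pc s = (fun i => pc t i + k i) by apply/funext => i; rewrite /k addrC subrK.
    have := D_lip (h := k) j (pcb t); rewrite -ks => /(_ (pcb s)) H.
    apply: le_lt_trans H _.
    have -> : S k = cabs (circ 0 r s - circ 0 r t).
      rewrite /S (bigD1 l) //= big1 ?addr0.
        by rewrite /k /pc /upd eqxx; congr cabs; ring.
      by move=> i /negbTE il; rewrite /k /pc /upd il subrr cabs0.
    have : cabs (circ 0 r s - circ 0 r t) < e' / (K2 + 1).
      apply: le_lt_trans (cabs_leD _) _; rewrite cReB cImB [X in _ < X]splitr.
      by apply: ltrD; rewrite distrC; near: s; [exact: HR|exact: HI].
    rewrite ltr_pdivlMr // => H2; apply: le_lt_trans H2.
    by rewrite mulrC ler_wpM2l ?cabs_ge0 // lerDl.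
  split=> t _; apply/cvgrPdist_lt => e' e'0; near=> s; rewrite distrC.
    rewrite -cReB; apply: le_lt_trans (cRe_le _) _; near: s; exact: H.
  rewrite -cImB; apply: le_lt_trans (cIm_le _) _; near: s; exact: H.
have cDw j : ccurve (fun t => (D (pc t) j - D p j) * w t).
  by apply: ccurveM => //; apply: ccurveD; [exact: cD|exact: ccurve_cst].
(* By linearity of the mean, the error of the derivative is a mean of Taylor remainders of [f]. *)
have -> : dz f l (fun j => p j + h j) - dz f l p - \sum_j b j * h j =
    CM (fun t => (rem (pc t) h - rem p h) * w t).
  rewrite -[dz f l _]/(D _ l) -[dz f l p]/(D p l) !DE //.
  have -> : \sum_j b j * h j = CM (fun t => \sum_j h j * ((D (pc t) j - D p j) * w t)).
    rewrite CM_sum; last by move=> j; apply: ccurveM => //; exact: ccurve_cst.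
    by apply: eq_bigr => j _; rewrite CMZ // mulrC.
  have NG (G : R -> C) : ccurve G -> - CM G = CM (fun t => -1 * G t) by move=> cG; rewrite CMZ // mulN1r.
  have cS : ccurve (fun t => \sum_j h j * ((D (pc t) j - D p j) * w t)).
    by apply: ccurve_sum => j; apply: ccurveM => //; exact: ccurve_cst.
  rewrite (NG _ (cfw _ p1)) (NG _ cS).
  have c1 : ccurve (fun t => -1 * ((f (upd p l (circ 0 r t)) - f p) * w t)).
    by apply: ccurveM; [exact: ccurve_cst|exact: cfw].
  have c2 : ccurve (fun t => -1 * \sum_j h j * ((D (pc t) j - D p j) * w t)).
    apply: ccurveM; first exact: ccurve_cst.
    by apply: ccurve_sum => j; apply: ccurveM => //; exact: ccurve_cst.
  rewrite -CMD //; last exact: cfw.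
  rewrite -CMD //; last by apply: ccurveD => //; exact: cfw.
  congr CM; apply/funext => t; rewrite /rem.
  have -> : upd (fun j => p j + h j) l (circ 0 r t) = (fun j => pc t j + h j).
    by apply/funext => j; rewrite /pc /upd; case: ifP => // _; rewrite addrAC.
  have -> : \sum_j h j * ((D (pc t) j - D p j) * w t) =
      (\sum_j D (pc t) j * h j - \sum_j D p j * h j) * w t.
    by rewrite -sumrB mulr_suml; apply: eq_bigr => j _; ring.
  by rewrite -/(pc t); ring.
have cG : ccurve (fun t => (rem (pc t) h - rem p h) * w t).
  apply: ccurveM => //; apply: ccurveD; last exact: ccurve_cst.
  apply: ccurveD.
    apply: ccurveD; last by under eq_fun do rewrite -mulN1r; apply: ccurveM; [exact: ccurve_cst|exact: cf].
    have -> : (fun t => f (fun j => pc t j + h j)) = (fun t => f (upd (fun j => p j + h j) l (circ 0 r t))).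
      apply/funext => t; congr f; apply/funext => j; rewrite /pc /upd; case: ifP => // _; exact: addrAC.
    exact: cf.
  under eq_fun do rewrite -mulN1r; apply: ccurveM; first exact: ccurve_cst.
  by apply: ccurve_sum => j; apply: ccurveM => //; exact: ccurve_cst.
apply: le_trans (CM_bound (M := 4 * K2 / r * S h * S h) cG _) _.
  move=> t; rewrite cabsM /w cabsV subr0 cr ler_pdivrMr //.
  apply: le_trans (cabsD _ _) _; rewrite cabsN.
  rewrite (_ : 4 * K2 / r * S h * S h * r = 2 * (K2 * S h * S h) + 2 * (K2 * S h * S h)); last by field; rewrite gt_eqF.
  by apply: lerD; exact: taylor.
rewrite mulrA mulrA -/(S h) ler_wpM2r //; apply: le_trans Sh.
by rewrite ler_wpM2r // /K lerDl.
Unshelve. all: by end_near. Qed.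
End Local.

Lemma holomorphic_dz N (O : set (pt R N)) (f : pt R N -> C) l :
  copen O -> holomorphic_on O f -> holomorphic_on O (dz f l).
Proof.
move=> oO hf p Op.
have [a /cdiff_cont /(_ 1 ltr01) [d1 [d10 H1]]] := hf p Op.
have [d2 [d20 H2]] := oO p Op.
(* On the polydisc of radius 4 r, [f] is differentiable and bounded by |f p| + 1. *)
pose r := Num.min d1 d2 / 4.
have r0 : 0 < r by rewrite divr_gt0 // lt_min d10.
have r4 : 4 * r = Num.min d1 d2 by rewrite /r; field.
apply: (@cdiff_dz N f p r (cabs (f p) + 1) r0).
- move=> q; rewrite r4 => qb; apply: hf; apply: H2.
  by apply: cball_sub qb; rewrite ge_min lexx orbT.
- move=> q; rewrite r4 => qb.
  have /H1 : cball p d1 q by apply: cball_sub qb; rewrite ge_min lexx.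
  have := cabsBl (f q) (f p); lra.
Qed.

End Regularity.

(** * Bergman spaces and kernels *)

Section OpenMeasurable.
Variable R : realType.
Local Notation C := R[i].

(** An open set is the union of those countably many boxes with rational centre and half-side 1 / (n
    + 1) that it contains. The bound d / 4 on the half-side accounts for two real coordinates and
    two distances to the centre. *)
Lemma copen_measurable N (O : set (pt R N)) : copen O -> measurable (O : set (mpt R N)).
Proof.
move=> oO.
pose I := ({ffun 'I_N -> rat * rat} * nat)%type.
pose e (i : I) : R := i.2.+1%:R^-1.
pose B (i : I) : set (mpt R N) := [set p | forall j, `|complex.Re (p j) - ratr (i.1 j).1| < e i /\
  `|complex.Im (p j) - ratr (i.1 j).2| < e i].
pose D : set I := [set i | B i `<=` O].
have -> : O = \bigcup_(i in D) B i.
  apply/seteqP; split=> [p Op|p [i Di Bip]]; last exact: Di.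
  have [d [d0 Hd]] := oO p Op.
  have [n n0] : exists n : nat, n.+1%:R^-1 < d / 4 :> R.
    exists (Num.trunc (d / 4)^-1); have d4 : 0 < d / 4 by rewrite divr_gt0.
    rewrite -[ltRHS]invrK ltf_pV2 ?qualifE /= ?invr_gt0 // ?ltr0n //.
    exact: truncnS_gt.
  have n1 : 0 < n.+1%:R^-1 :> R by rewrite invr_gt0 ltr0n.
  have R1 (x : R) : exists r : rat, `|x - ratr r| < n.+1%:R^-1.
    have h0 : x - n.+1%:R^-1 < x + n.+1%:R^-1 by rewrite ltrD2l gtrN.
    have [r] := rat_in_itvoo h0.
    by rewrite in_itv /= => h; exists r; rewrite distrC ltr_distl.
  have R2 j : exists r : rat * rat, `|complex.Re (p j) - ratr r.1| < n.+1%:R^-1 /\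
      `|complex.Im (p j) - ratr r.2| < n.+1%:R^-1.
    have [r1 h1] := R1 (complex.Re (p j)); have [r2 h2] := R1 (complex.Im (p j)).
    by exists (r1, r2).
  have [r Hr] := boolp.choice R2.
  exists ([ffun j => r j], n); last by move=> j /=; rewrite ffunE; exact: Hr.
  move=> q Bq; apply: Hd => j; apply: le_lt_trans (cabs_leD _) _.
  have := Bq j; rewrite /= ffunE /e /= => -[h1 h2]; have [h3 h4] := Hr j.
  rewrite cReB cImB.
  have a1 : `|complex.Re (q j) - complex.Re (p j)| <= `|complex.Re (q j) - ratr (r j).1| + `|complex.Re (p j) - ratr (r j).1|.
    by rewrite (distrC (complex.Re (p j))); exact: ler_distD.
  have a2 : `|complex.Im (q j) - complex.Im (p j)| <= `|complex.Im (q j) - ratr (r j).2| + `|complex.Im (p j) - ratr (r j).2|.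
    by rewrite (distrC (complex.Im (p j))); exact: ler_distD.
  move: n0 h1 h2 h3 h4; set t := (_.+1)%:R^-1 => n0 h1 h2 h3 h4.
  have [b1 b2] := (le_lt_trans a1 (ltrD h1 h3), le_lt_trans a2 (ltrD h2 h4)).
  by apply: lt_le_trans (ltrD b1 b2) _; clear -n0; lra.
rewrite bigcup_mkcond; apply: countable_bigcupT_measurable => [|i]; first exact: countableP.
case: ifP => _; last exact: measurable0.
rewrite (_ : B i = \bigcap_(j in [set: 'I_N]) [set p : mpt R N | `|complex.Re (p j) - ratr (i.1 j).1| < e i /\
  `|complex.Im (p j) - ratr (i.1 j).2| < e i]); last first.
  by apply/seteqP; split => [p H j _|p H j]; apply: H.
apply: fin_bigcap_measurable => // j _.
have m1 (u : mpt R N -> R) (c : R) : measurable_fun setT u -> measurable [set p : mpt R N | `|u p - c| < e i].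
  move=> mu; have : measurable_fun setT (fun p : mpt R N => `|u p - c| < e i).
    apply: measurable_fun_ltr => //; apply: (measurableT_comp (f := @Num.norm _ R)) => //.
    exact: measurable_funB.
  move=> /(_ measurableT [set true]); rewrite setTI preimage_true; exact.
by apply: measurableI; apply: m1; [exact: measurable_coord_Re|exact: measurable_coord_Im].
Qed.

Lemma cindicE N (O : set (pt R N)) p : Defs.indic O p = \1_O p.
Proof.
rewrite /Defs.indic indicE; case: (asboolP (O p)) => Op.
  by rewrite mem_set.
by rewrite memNset.
Qed.

Lemma cindic1 N (O : set (pt R N)) p : O p -> Defs.indic O p = 1.
Proof. by move=> Op; rewrite /Defs.indic; case: asboolP. Qed.

Lemma cindic0 N (O : set (pt R N)) p : ~ O p -> Defs.indic O p = 0.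
Proof. by move=> Op; rewrite /Defs.indic; case: asboolP. Qed.

Lemma cindic_ge0 N (O : set (pt R N)) p : 0 <= Defs.indic O p.
Proof. by rewrite /Defs.indic; case: asboolP. Qed.

Lemma measurable_cindic N (O : set (pt R N)) : copen O ->
  measurable_fun [set: mpt R N] (fun p => Defs.indic O p).
Proof.
move=> /copen_measurable mO; under eq_fun do rewrite cindicE.
exact: (measurable_indic mO).
Qed.

Lemma measurable_continuous_on N (O : set (pt R N)) (u : pt R N -> R) : copen O ->
  (forall p, O p -> forall e : R, 0 < e -> exists d : R, 0 < d /\ forall q, cball p d q -> `|u q - u p| < e) ->
  measurable_fun [set: mpt R N] (fun p => Defs.indic O p * u p).
Proof.
move=> oO cu; apply: (measurability _ (RGenOInfty.measurableE R)).
move=> /= _ [_ [x ->] <-]; rewrite setTI preimage_itvoy.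
have oOx : copen (O `&` [set p | x < u p]).
  move=> p [Op /= xp]; have [d1 [d10 H1]] := oO p Op.
  have e0 : 0 < u p - x by rewrite subr_gt0.
  have [d2 [d20 H2]] := cu p Op _ e0.
  exists (Num.min d1 d2); split; first by rewrite lt_min d10.
  move=> q qp; split.
    by apply: H1 => j; have := qp j; rewrite lt_min => /andP[].
  have : cball p d2 q by move=> j; have := qp j; rewrite lt_min => /andP[].
  by move=> /H2; rewrite ltr_norml /=; lra.
(* Off [O] the function is zero, so the complement of [O] belongs to the superlevel sets of negative
   levels. *)
rewrite (_ : [set _ | _] = (O `&` [set p | x < u p]) `|` (if x < 0 then ~` (O : set (mpt R N)) else set0)); last first.
  apply/seteqP; split => p /=.
    have [Op|Op] := pselect (O p); first by rewrite cindic1 // mul1r; left.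
    by rewrite cindic0 // mul0r => x0; right; rewrite x0.
  case=> [[Op xp]|]; first by rewrite cindic1 // mul1r.
  by case: ifP => // x0 Op; rewrite cindic0 // mul0r.
apply: measurableU; first exact: copen_measurable.
by case: ifP => // _; apply: measurableC; exact: copen_measurable.
Qed.

Lemma measurable_Re_on N (O : set (pt R N)) (f : pt R N -> C) : copen O ->
  (forall p, O p -> ccont f p) -> measurable_fun [set: mpt R N] (fun p => Defs.indic O p * complex.Re (f p)).
Proof.
move=> oO cf; apply: measurable_continuous_on => // p /cf H e /H [d [d0 {}H]]; exists d; split => // q /H.
by rewrite -cReB; apply: le_lt_trans; exact: cRe_le.
Qed.

Lemma measurable_Im_on N (O : set (pt R N)) (f : pt R N -> C) : copen O ->
  (forall p, O p -> ccont f p) -> measurable_fun [set: mpt R N] (fun p => Defs.indic O p * complex.Im (f p)).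
Proof.
move=> oO cf; apply: measurable_continuous_on => // p /cf H e /H [d [d0 {}H]]; exists d; split => // q /H.
by rewrite -cImB; apply: le_lt_trans; exact: cIm_le.
Qed.

Lemma cindicX N (O : set (pt R N)) p : Defs.indic O p * Defs.indic O p = Defs.indic O p.
Proof. by rewrite /Defs.indic; case: asboolP; rewrite ?mulr1 ?mulr0. Qed.

Lemma measurable_sqr_on N (O : set (pt R N)) (f : pt R N -> C) : copen O ->
  (forall p, O p -> ccont f p) -> measurable_fun [set: mpt R N] (fun p => Defs.indic O p * cabs (f p) ^+ 2).
Proof.
move=> oO cf; rewrite (_ : (fun _ => _) = (fun p => (Defs.indic O p * complex.Re (f p)) ^+ 2 + (Defs.indic O p * complex.Im (f p)) ^+ 2)).
  by apply: measurable_funD; apply: measurable_funX; [exact: measurable_Re_on|exact: measurable_Im_on].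
by apply/funext => p; rewrite cabs_sqr -[in LHS]cindicX; ring.
Qed.

Lemma holomorphic_ccont N (O : set (pt R N)) (f : pt R N -> C) : holomorphic_on O f ->
  forall p, O p -> ccont f p.
Proof. by move=> hf p /hf [a]; exact: cdiff_cont. Qed.

Lemma ccontJ N (f : pt R N -> C) p : ccont f p -> ccont (fun q => (f q)^*) p.
Proof. by move=> H e /H [d [d0 {}H]]; exists d; split => // q /H; rewrite -rmorphB cabsJ. Qed.

Lemma ccontM N (f g : pt R N -> C) p : ccont f p -> ccont g p -> ccont (fun q => f q * g q) p.
Proof.
move=> cf cg e e0; have e1 : 0 < Num.min 1 e by rewrite lt_min ltr01.
pose M := cabs (f p) + cabs (g p) + 1; have M0 : 0 < M by rewrite ltr_wpDl // addr_ge0 ?cabs_ge0.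
pose e' := Num.min 1 (e / (M * 2)).
have e'0 : 0 < e' by rewrite lt_min ltr01 divr_gt0 // mulr_gt0.
have [d1 [d10 H1]] := cf _ e'0; have [d2 [d20 H2]] := cg _ e'0.
exists (Num.min d1 d2); split; first by rewrite lt_min d10.
move=> q qp.
have /H1 h1 : cball p d1 q by move=> j; have := qp j; rewrite lt_min => /andP[].
have /H2 h2 : cball p d2 q by move=> j; have := qp j; rewrite lt_min => /andP[].
rewrite (_ : _ - _ = (f q - f p) * (g q - g p) + (f p * (g q - g p) + (f q - f p) * g p)); last by ring.
have h : e' <= 1 by rewrite ge_min lexx.
have h' : e' <= e / (M * 2) by rewrite ge_min lexx orbT.
apply: (@le_lt_trans _ _ (M * e')).
  rewrite (_ : M * e' = e' + (cabs (f p) * e' + e' * cabs (g p))); last by rewrite /M; ring.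
  apply: le_trans (cabsD _ _) _; apply: lerD.
    by rewrite cabsM -[leRHS]mulr1; apply: ler_pM; rewrite ?cabs_ge0 // ltW // (lt_le_trans h2).
  apply: le_trans (cabsD _ _) _; rewrite !cabsM; apply: lerD.
    by rewrite ler_wpM2l ?cabs_ge0 // ltW.
  by rewrite ler_wpM2r ?cabs_ge0 // ltW.
apply: (@le_lt_trans _ _ (M * (e / (M * 2)))); first by rewrite ler_wpM2l // ltW.
by rewrite (_ : M * _ = e / 2); [lra|field; rewrite gt_eqF].
Qed.
End OpenMeasurable.

Section BergmanPairing.
Variables (R : realType) (N : nat) (O : set (pt R N)).
Hypothesis oO : copen O.
Local Notation C := R[i].

Lemma bergman_integrable f : bergman_space O f ->
  (vol R N).-integrable setT (fun p => (Defs.indic O p * cabs (f p) ^+ 2)%:E).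
Proof.
move=> [hf fin]; have m := measurable_sqr_on oO (holomorphic_ccont hf).
have g0 p : 0 <= Defs.indic O p * cabs (f p) ^+ 2 by rewrite mulr_ge0 ?cindic_ge0 ?sqr_ge0.
apply/integrableP; split; first exact/measurable_EFinP.
under eq_integral do rewrite gee0_abs ?lee_fin //.
by rewrite -lint_ge0.
Qed.

Lemma pairing_integrable f g (u : C -> R) : bergman_space O f -> bergman_space O g ->
  (forall z, `|u z| <= cabs z) ->
  measurable_fun [set: mpt R N] (fun p => Defs.indic O p * u (f p * (g p)^*)) ->
  (vol R N).-integrable setT (fun p => (Defs.indic O p * u (f p * (g p)^*))%:E).
Proof.
move=> bf bg ub mu.
apply: (@le_integrable _ _ _ (vol R N) setT measurableT _ (fun p => (Defs.indic O p * cabs (f p) ^+ 2)%:E + (Defs.indic O p * cabs (g p) ^+ 2)%:E)%E).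
- exact/measurable_EFinP.
- move=> p _; rewrite -EFinD !abse_EFin lee_fin -mulrDr !normrM ler_wpM2l //.
  apply: le_trans (ub _) _; rewrite cabsM cabsJ ger0_norm ?addr_ge0 ?sqr_ge0 //.
  have := cabs_ge0 (f p); have := cabs_ge0 (g p).
  by have := sqr_ge0 (cabs (f p) - cabs (g p)); set x := cabs _; set y := cabs _; nra.
by apply: integrableD => //; exact: bergman_integrable.
Qed.

Lemma pairing_Re f g : bergman_space O f -> bergman_space O g ->
  (vol R N).-integrable setT (fun p => (Defs.indic O p * complex.Re (f p * (g p)^*))%:E).
Proof.
move=> bf bg; apply: pairing_integrable => //; first exact: cRe_le.
apply: (measurable_Re_on oO) => p Op; apply: ccontM; [|apply: ccontJ]; apply: holomorphic_ccont Op.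
  by case: bf. by case: bg.
Qed.

Lemma pairing_Im f g : bergman_space O f -> bergman_space O g ->
  (vol R N).-integrable setT (fun p => (Defs.indic O p * complex.Im (f p * (g p)^*))%:E).
Proof.
move=> bf bg; apply: pairing_integrable => //; first exact: cIm_le.
apply: (measurable_Im_on oO) => p Op; apply: ccontM; [|apply: ccontJ]; apply: holomorphic_ccont Op.
  by case: bf. by case: bg.
Qed.

Lemma cintE f g : bergman_space O f -> bergman_space O g ->
  cint O (fun p => f p * (g p)^*) =
  complex.Complex (fine (\int[vol R N]_p (Defs.indic O p * complex.Re (f p * (g p)^*))%:E))
   (fine (\int[vol R N]_p (Defs.indic O p * complex.Im (f p * (g p)^*))%:E)).
Proof. by move=> bf bg; rewrite /cint (lint_integrable (pairing_Re bf bg)) (lint_integrable (pairing_Im bf bg)). Qed.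

Lemma cintJ f g : bergman_space O f -> bergman_space O g ->
  cint O (fun p => g p * (f p)^*) = (cint O (fun p => f p * (g p)^*))^*.
Proof.
move=> bf bg; rewrite !cintE // conjcE /=; congr complex.Complex.
  by congr fine; apply: eq_integral => p _; rewrite !cReM !cReJ !cImJ; congr (_ * _)%:E; ring.
rewrite -fineN; congr fine.
have i1 := pairing_Im bf bg.
rewrite -integralN; last exact: integrable_add_def.
apply: eq_integral => p _; rewrite -EFinN -mulrN; congr (_ * _)%:E.
by rewrite !cImM !cReJ !cImJ; ring.
Qed.

(** Each of the two kernel functions is reproduced against the other, and the two pairings are
    conjugate. *)
Lemma bergman_kernelJ K p q : bergman_kernel O K -> O p -> O q -> K p q = (K q p)^*.
Proof.
move=> bK Op Oq; have [b1 r1] := bK p Op; have [b2 r2] := bK q Oq.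
by rewrite (r1 _ b2) (r2 _ b1) -cintJ.
Qed.
End BergmanPairing.

(** * Behaviour of the Bergman kernel under a holomorphic change of variables *)

Section KernelTransformation.
Variables (R : realType) (N : nat) (O1 O2 : set (pt R N)).
Local Notation C := R[i].
Variables (psi phi : pt R N -> pt R N) (J : pt R N -> C).
Hypotheses (oO1 : copen O1) (oO2 : copen O2).
Hypothesis psiO : forall p, O1 p -> O2 (psi p).
Hypothesis psiK : forall p, O1 p -> phi (psi p) = p.
Hypothesis J0 : forall p, O1 p -> J p != 0.
Hypothesis pullback_hol : forall f, holomorphic_on O2 f -> holomorphic_on O1 (fun p => J p * f (psi p)).
Hypothesis pushforward_hol : forall f, holomorphic_on O1 f ->
  holomorphic_on O2 (fun q => (J (phi q))^-1 * f (phi q)).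
Hypothesis change_of_variables : forall F : mpt R N -> \bar R,
  measurable_fun setT F -> (forall p, 0 <= F p)%E -> (forall p, ~ O2 p -> F p = 0%E) ->
  (\int[vol R N]_p F p = \int[vol R N]_p
     (if `[< O1 p >] then F (psi p) * (cabs (J p) ^+ 2)%:E else 0))%E.

Let signed_cov (F : mpt R N -> \bar R) :
  measurable_fun setT F -> (forall p, ~ O2 p -> F p = 0%E) ->
  (\int[vol R N]_p F p = \int[vol R N]_p
     (if `[< O1 p >] then F (psi p) * (cabs (J p) ^+ 2)%:E else 0))%E.
Proof.
move=> mF F0; rewrite integralE [RHS]integralE.
have c0 p : (0 <= cabs (J p) ^+ 2)%R by exact: sqr_ge0.
have e1 := change_of_variables (measurable_funepos mF) (funepos_ge0 F).
have e2 := change_of_variables (measurable_funeneg mF) (funeneg_ge0 F).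
rewrite e1; last by move=> p /F0 Fp; rewrite funeposE Fp maxxx.
rewrite e2; last by move=> p /F0 Fp; rewrite funenegE Fp oppe0 maxxx.
congr (_ - _)%E; apply: eq_integral => p _; rewrite ?funeposE ?funenegE; case: ifP => _.
- by rewrite muleC maxe_pMr ?lee_fin // mule0 muleC.
- by rewrite maxxx.
- by rewrite muleC maxe_pMr ?lee_fin // mule0 muleN muleC.
- by rewrite oppe0 maxxx.
Qed.

Let pull f p := J p * f (psi p).
Let push f q := (J (phi q))^-1 * f (phi q).

Let pull_lint f : holomorphic_on O2 f ->
  lint (fun p => Defs.indic O1 p * cabs (pull f p) ^+ 2) = lint (fun p => Defs.indic O2 p * cabs (f p) ^+ 2).
Proof.
move=> hf; have m2 := measurable_sqr_on oO2 (holomorphic_ccont hf).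
have m1 := measurable_sqr_on oO1 (holomorphic_ccont (pullback_hol hf)).
have g0 (O : set (pt R N)) (g : pt R N -> C) p : 0 <= Defs.indic O p * cabs (g p) ^+ 2.
  by rewrite mulr_ge0 ?cindic_ge0 ?sqr_ge0.
rewrite (lint_ge0 m1 (g0 _ _)) (lint_ge0 m2 (g0 _ _)) [RHS]signed_cov; first last.
- by move=> p Op; rewrite cindic0 // mul0r.
- exact/measurable_EFinP.
apply: eq_integral => p _; case: asboolP => Op; last by rewrite cindic0 // mul0r.
by rewrite (cindic1 Op) (cindic1 (psiO Op)) !mul1r /pull cabsM exprMn mulrC.
Qed.

Let pull_bergman f : bergman_space O2 f -> bergman_space O1 (pull f).
Proof. by move=> [hf fin]; split; [exact: pullback_hol|rewrite pull_lint]. Qed.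

Let pullK f p : O1 p -> pull (push f) p = f p.
Proof. by move=> Op; rewrite /pull /push psiK // mulVKf ?J0. Qed.

Let push_bergman f : bergman_space O1 f -> bergman_space O2 (push f).
Proof.
move=> [hf fin]; have hp := pushforward_hol hf; split => //.
rewrite -pull_lint // (_ : (fun p => _) = (fun p => Defs.indic O1 p * cabs (f p) ^+ 2)) //.
apply/funext => p; have [Op|Op] := pselect (O1 p); first by rewrite pullK.
by rewrite !cindic0 // !mul0r.
Qed.

(** On [O1] one has g = pull (push g), so the integrand is |J|^2 times that on [O2] at [psi p]:
    [push] is the adjoint and the inverse of the isometry [pull]. *)
Let pull_cint f g : bergman_space O2 f -> bergman_space O1 g ->
  cint O1 (fun p => pull f p * (g p)^*) = cint O2 (fun p => f p * (push g p)^*).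
Proof.
move=> bf bg; have bpf := pull_bergman bf; have bpg := push_bergman bg.
rewrite (cintE oO1 bpf bg) (cintE oO2 bf bpg).
have E p : O1 p -> pull f p * (g p)^* = rc (cabs (J p) ^+ 2) * (f (psi p) * (push g (psi p))^*).
  by move=> Op; rewrite -(pullK g Op) /pull rmorphM /= -mulcJ; ring.
congr (complex.Complex (fine _) (fine _)).
- rewrite [RHS]signed_cov; first last.
  + by move=> p Op; rewrite cindic0 // mul0r.
  + exact: measurable_int (pairing_Re oO2 bf bpg).
  apply: eq_integral => p _; case: asboolP => Op; last by rewrite cindic0 // mul0r.
  by rewrite (cindic1 Op) (cindic1 (psiO Op)) !mul1r -EFinM E // cReM /= mul0r subr0 mulrC.
- rewrite [RHS]signed_cov; first last.
  + by move=> p Op; rewrite cindic0 // mul0r.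
  + exact: measurable_int (pairing_Im oO2 bf bpg).
  apply: eq_integral => p _; case: asboolP => Op; last by rewrite cindic0 // mul0r.
  by rewrite (cindic1 Op) (cindic1 (psiO Op)) !mul1r -EFinM E // cImM /= mul0r addr0 mulrC.
Qed.

(* The pushforward is the adjoint of the pullback, so [K1] is found by reproducing
   [K2 (., p)] against the pushforward of [K1 (., Q)]. *)
Theorem kernel_transform K1 K2 P Q : bergman_kernel O1 K1 -> bergman_kernel O2 K2 ->
  O1 P -> O1 Q -> K1 P Q = K2 (psi P) (psi Q) * J P * (J Q)^*.
Proof.
move=> b1 b2 OP OQ; have [bK1 r1] := b1 Q OQ; have bk := push_bergman bK1.
have [bK2 r2] := b2 _ (psiO OP).
have := r1 _ (pull_bergman bK2); rewrite (pull_cint bK2 bK1) (cintJ oO2 bk bK2) -(r2 _ bk).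
rewrite /pull /push psiK // => /(congr1 Num.conj); rewrite conjCK rmorphM /=.
rewrite -(bergman_kernelJ oO2 b2 (psiO OP) (psiO OQ)) => E.
by rewrite -[LHS](mulVKf (J0 OP)) -E; ring.
Qed.
End KernelTransformation.

(** * Operations on holomorphic functions; kernels under diagonal maps *)

Section Restriction.
Variables (R : realType) (N : nat).
Local Notation C := R[i].

Lemma holomorphic_ext (O : set (pt R N)) (f g : pt R N -> C) : copen O ->
  (forall p, O p -> f p = g p) -> holomorphic_on O f -> holomorphic_on O g.
Proof.
move=> oO fg hf p Op; have [a da] := hf p Op; have [d0 [d00 H0]] := oO p Op.
exists a => e e0; have [d [d1 H]] := da e e0; exists (Num.min d0 d); split; first by rewrite lt_min d00.
move=> h hd; rewrite -!fg //; first by apply: H => j; have := hd j; rewrite lt_min => /andP[].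
by apply: H0 => j; rewrite addrAC subrr add0r; have := hd j; rewrite lt_min => /andP[].
Qed.

Lemma holomorphic_comp M (O : set (pt R N)) (V : set (pt R M)) (f : pt R M -> C) (F : pt R N -> pt R M) :
  (forall p, O p -> V (F p)) -> (forall i, holomorphic_on O (fun p => F p i)) ->
  holomorphic_on V f -> holomorphic_on O (fun p => f (F p)).
Proof.
move=> FV hF hf p Op; have [b db] := hf _ (FV p Op).
have [A dA] : {A : 'I_M -> pt R N & forall i, cdiff (fun q => F q i) p (A i)}.
  by apply: (@boolp.choice _ _ (fun i a => cdiff (fun q => F q i) p a)) => i; exact: hF.
by eexists; exact: (cdiff_comp db dA).
Qed.

Lemma holomorphicM (O : set (pt R N)) (f g : pt R N -> C) :
  holomorphic_on O f -> holomorphic_on O g -> holomorphic_on O (fun p => f p * g p).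
Proof. by move=> hf hg p Op; have [a da] := hf p Op; have [b db] := hg p Op; eexists; exact: cdiffM da db. Qed.

Lemma holomorphicD (O : set (pt R N)) (f g : pt R N -> C) :
  holomorphic_on O f -> holomorphic_on O g -> holomorphic_on O (fun p => f p + g p).
Proof. by move=> hf hg p Op; have [a da] := hf p Op; have [b db] := hg p Op; eexists; exact: cdiffD da db. Qed.

Lemma holomorphic_cst (O : set (pt R N)) (c : C) : holomorphic_on O (fun=> c).
Proof. by move=> p _; eexists; exact: cdiff_cst. Qed.

Lemma holomorphic_coord (O : set (pt R N)) i : holomorphic_on O (fun p => p i).
Proof. by move=> p _; eexists; exact: cdiff_coord. Qed.

Lemma holomorphic_comp1 (O : set (pt R N)) (f : C -> C) (F : pt R N -> C) :
  holomorphic_on O F -> (forall p, O p -> exists a, cdiff1 f (F p) a) ->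
  holomorphic_on O (fun p => f (F p)).
Proof. by move=> hF hf p Op; have [a da] := hF p Op; have [b db] := hf p Op; eexists; exact: cdiff_comp1 db da. Qed.

Lemma holomorphic_sum (O : set (pt R N)) (I : Type) (r : seq I) (f : I -> pt R N -> C) :
  (forall i, holomorphic_on O (f i)) -> holomorphic_on O (fun p => \sum_(i <- r) f i p).
Proof.
move=> hf; elim: r => [|i r IH].
  by rewrite (_ : (fun p => _) = fun=> 0); [exact: holomorphic_cst|apply/funext => p; rewrite big_nil].
rewrite (_ : (fun p => _) = fun p => f i p + \sum_(j <- r) f j p); last by apply/funext => p; rewrite big_cons.
exact: holomorphicD.
Qed.

Lemma copen_preimage M (O : set (pt R N)) (V : set (pt R M)) (F : pt R N -> pt R M) :
  copen O -> copen V -> (forall p, O p -> forall i, ccont (fun q => F q i) p) ->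
  copen (O `&` [set p | V (F p)]).
Proof.
move=> oO oV cF p [Op Vp]; have [d0 [d00 H0]] := oO p Op; have [e [e0 He]] := oV _ Vp.
have [d Hd] : {d : 'I_M -> R & forall i, 0 < d i /\ forall q, cball p (d i) q -> cabs (F q i - F p i) < e}.
  by apply: (@boolp.choice _ _ (fun i (d : R) => 0 < d /\ forall q, cball p d q -> cabs (F q i - F p i) < e)) => i; exact: cF.
have [dm [dm0 Hm]] : exists dm : R, 0 < dm /\ forall i, dm <= d i.
  exists (\big[Num.min/1]_(i < M) d i); split.
    by elim/big_ind: _ => // [x y x0 y0|i _]; [rewrite lt_min x0|exact: (Hd i).1].
  by move=> i; exact: bigmin_le_cond.
exists (Num.min d0 dm); split; first by rewrite lt_min d00.
move=> q qp; split.
  by apply: H0 => j; have := qp j; rewrite lt_min => /andP[].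
apply: He => i; apply: (Hd i).2 => j; have := qp j; rewrite lt_min => /andP[_ h].
exact: lt_le_trans h (Hm i).
Qed.

(** The Jacobian is the constant product of the [c i]; its two occurrences combine into a squared
    modulus. *)
Lemma kernel_diag (O1 O2 : set (pt R N)) (c : 'I_N -> C) K1 K2 P Q :
  copen O1 -> copen O2 -> (forall i, c i != 0) ->
  (forall p, O1 p <-> O2 (fun i => c i * p i)) ->
  bergman_kernel O1 K1 -> bergman_kernel O2 K2 -> O1 P -> O1 Q ->
  K1 P Q = K2 (fun i => c i * P i) (fun i => c i * Q i) * rc (\prod_i cabs (c i) ^+ 2).
Proof.
move=> oO1 oO2 c0 E b1 b2 OP OQ; pose J : C := \prod_i c i.
have J0 : J != 0 by apply/prodf_neq0 => i _; exact: c0.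
have JJ : cabs J ^+ 2 = \prod_i cabs (c i) ^+ 2.
  by rewrite prodrXl; congr (_ ^+ 2); rewrite /J; elim/big_rec2: _ => [|i x y _ <-]; rewrite ?cabs1 ?cabsM.
have phiK (p : pt R N) : (fun i => c i * ((c i)^-1 * p i)) = p by apply/funext => i; rewrite mulVKf.
rewrite (@kernel_transform R N O1 O2 (fun p i => c i * p i) (fun p i => (c i)^-1 * p i) (fun=> J) oO1 oO2
   _ _ _ _ _ _ K1 K2) // -?mulrA ?mulcJ ?JJ //.
- by move=> p /E.
- by move=> p _; apply/funext => i; rewrite mulKf.
- move=> f hf; apply: holomorphicM; first exact: holomorphic_cst.
  apply: holomorphic_comp hf; first by move=> p /E.
  by move=> i; apply: holomorphicM; [exact: holomorphic_cst|exact: holomorphic_coord].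
- move=> f hf; apply: holomorphicM; first exact: holomorphic_cst.
  apply: holomorphic_comp hf; first by move=> q Oq; apply/E; rewrite phiK.
  by move=> i; apply: holomorphicM; [exact: holomorphic_cst|exact: holomorphic_coord].
- move=> F mF F0 Fz; rewrite (vol_diag c0 mF F0); apply: eq_integral => p _.
  rewrite -JJ; case: asboolP => Op //.
  by rewrite Fz ?mul0e // => /E.
Qed.
End Restriction.

(** * Hartogs symmetry *)

Section Dilation.
Variables (R : realType) (N : nat).
Local Notation C := R[i].

Definition act (S : pred 'I_N) (c : C) (p : pt R N) : pt R N :=
  fun i => if S i then c * p i else p i.

Lemma actM S c d p : act S c (act S d p) = act S (c * d) p.
Proof. by apply/funext => i; rewrite /act; case: (S i) => //; rewrite mulrA. Qed.

Lemma act1 S p : act S 1 p = p.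
Proof. by apply/funext => i; rewrite /act mul1r; case: ifP. Qed.

(** Schwarz reflection: conjugating both the variable and the value preserves complex
    differentiability. *)
Lemma cdiff1_conj (G : C -> C) z a : cdiff1 G z^* a -> cdiff1 (fun w => (G w^*)^*) z a^*.
Proof.
move=> dG e /dG [d [d0 H]]; exists d; split => // h hd.
have := H h^*; rewrite !cabsJ => /(_ hd); rewrite -[in X in X -> _]cabsJ; congr (cabs _ <= _).
by rewrite !rmorphB rmorphM /= conjCK rmorphD.
Qed.

Section Kernel.
Variables (O : set (pt R N)) (K : pt R N -> pt R N -> C) (S : pred 'I_N).
Hypotheses (oO : copen O) (bK : bergman_kernel O K).
Hypothesis actO : forall c p, cabs c <= 1 -> O p -> O (act S c p).

Lemma conj_mul1 (c : C) : cabs c = 1 -> c * c^* = 1.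
Proof. by move=> c1; rewrite mulcJ c1 expr1n. Qed.

Lemma kernel_rotation c p q : cabs c = 1 -> O p -> O q -> K (act S c p) q = K p (act S c^* q).
Proof.
move=> c1 Op Oq; pose d i : C := if S i then c else 1.
have dE x : act S c x = (fun i => d i * x i).
  by apply/funext => i; rewrite /act /d; case: ifP => //; rewrite mul1r.
have d1 i : cabs (d i) = 1 by rewrite /d; case: ifP; rewrite ?cabs1.
rewrite [RHS](@kernel_diag R N O O d K K) // -?dE.
- rewrite actM conj_mul1 // act1 big1 ?mulr1 // => i _.
  by rewrite d1 expr1n.
- by move=> i; rewrite -cabs_eq0 d1 oner_eq0.
- move=> x; rewrite -dE; split => [|h]; first by apply: actO; rewrite c1.
  rewrite -[x](act1 S) -(conj_mul1 c1) mulrC -actM; apply: actO => //.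
  by rewrite cabsJ c1.
- by apply: actO => //; rewrite cabsJ c1.
Qed.

Lemma cdiff1_act p q c : cabs c <= 1 -> O p -> O q -> exists a, cdiff1 (fun x => K (act S x p) q) c a.
Proof.
move=> c1 Op Oq; have [[hK _] _] := bK Oq; have [b db] := hK _ (actO c1 Op).
pose a i : C := if S i then 1 * p i + c * 0 else 0.
suff H i : cdiff1 (fun x => act S x p i) c (a i) by exists (\sum_i b i * a i); exact: (@cdiff1_curve R N (fun z => K z q) (fun x => act S x p) c b a db H).
rewrite /a /act; case: ifP => _; last exact: cdiff1_cst.
by apply: cdiff1M; [exact: cdiff1_id|exact: cdiff1_cst].
Qed.

(* Both sides are holomorphic in [c] and agree on the unit circle. *)
Lemma kernel_dilation c p q : cabs c <= 1 -> O p -> O q -> K (act S c p) q = K p (act S c^* q).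
Proof.
move=> c1 Op Oq; have [e1|n1] := eqVneq (cabs c) 1; first exact: kernel_rotation.
have {n1} clt : cabs c < 1 by rewrite lt_neqAle n1.
(* By hermitian symmetry the second term is K(p, x^* q), rewritten so that its holomorphic
   dependence on [x] is visible. *)
pose F x := K (act S x p) q - (K (act S x^* q) p)^*.
have F0 x : cabs x = 1 -> F x = 0.
  move=> x1; rewrite /F kernel_rotation // -(bergman_kernelJ oO bK) ?subrr //.
  by apply: actO => //; rewrite cabsJ x1.
have dF x : cabs x <= 1 -> exists a, cdiff1 F x a.
  move=> x1; have [a da] := cdiff1_act x1 Op Oq.
  have [|b db] := @cdiff1_act q p x^* _ Oq Op; first by rewrite cabsJ.
  exists (a - b^*); apply: cdiff1D => //; apply: cdiff1N.
  exact: (cdiff1_conj (G := fun x => K (act S x q) p) db).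
have := zero_on_circle dF F0 clt; rewrite /F => /eqP; rewrite subr_eq0 => /eqP ->.
by rewrite -(bergman_kernelJ oO bK) //; apply: actO => //; rewrite cabsJ.
Qed.
End Kernel.
End Dilation.

Section HartogsGeometry.
Variables (R : realType) (n m : nat) (Om : set (pt R (n + m))).
Local Notation C := R[i].

Definition sc (lam : 'I_n -> C) (p : pt R (n + m)) : pt R (n + m) :=
  fun i => join2 lam (fun _ : 'I_m => 1) i * p i.

Lemma lpart_join a b (x : pt R a) (y : pt R b) : lpart (join2 x y) = x.
Proof. by apply/funext => i; rewrite /lpart join2_l. Qed.
Lemma rpart_join a b (x : pt R a) (y : pt R b) : rpart (join2 x y) = y.
Proof. by apply/funext => i; rewrite /rpart join2_r. Qed.
Lemma join_parts a b (p : pt R (a + b)) : join2 (lpart p) (rpart p) = p.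
Proof. by apply/funext => i; case: (split_ordP i) => j ->; rewrite ?join2_l ?join2_r. Qed.

Lemma sc_join lam z z' : sc lam (join2 z z') = join2 (fun j => lam j * z j) z'.
Proof. by apply/funext => i; rewrite /sc; case: (split_ordP i) => j ->; rewrite ?join2_l ?join2_r ?mul1r. Qed.

Lemma scM lam mu p : sc lam (sc mu p) = sc (fun j => lam j * mu j) p.
Proof. by rewrite -[p]join_parts !sc_join; congr join2; apply/funext => j; rewrite mulrA. Qed.

Lemma sc1 p : sc (fun=> 1) p = p.
Proof. by rewrite -[p]join_parts sc_join; congr join2; apply/funext => j; rewrite mul1r. Qed.

Hypothesis star : nstar_hartogs Om.

Lemma star_sc lam p : (forall j, cabs (lam j) <= 1) -> Om p -> Om (sc lam p).
Proof. by move=> l1; rewrite -[p]join_parts sc_join; exact: star. Qed.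

Variable K : pt R (n + m) -> pt R (n + m) -> C.
Hypotheses (oOm : copen Om) (bK : bergman_kernel Om K).

Lemma kernel_sc lam p q : (forall j, cabs (lam j) <= 1) -> Om p -> Om q ->
  K (sc lam p) q = K p (sc (fun j => (lam j)^*) q).
Proof.
move=> l1 Op Oq.
(* The multipliers are switched on one coordinate at a time, each time by a one-parameter
   dilation. *)
pose mu (t : nat) (j : 'I_n) : C := if (j < t)%N then lam j else 1.
have mu1 t j : cabs (mu t j) <= 1 by rewrite /mu; case: ifP; rewrite ?cabs1.
suff H t : (t <= n)%N -> K (sc (mu t) p) q = K p (sc (fun j => (mu t j)^*) q).
  have := H n (leqnn n); rewrite (_ : mu n = lam) //.
  by apply/funext => j; rewrite /mu ltn_ord.
elim: t p q Op Oq => [|t IH] p q Op Oq tn.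
  rewrite (_ : mu 0%N = fun=> 1); last exact/funext.
  by rewrite (_ : (fun j => _) = fun=> 1) ?sc1 //; apply/funext => j; rewrite rmorph1.
pose j0 := Ordinal tn; pose S : pred 'I_(n + m) := pred1 (lshift m j0).
have aE (c : C) x : act S c x = sc (fun j => if j == j0 then c else 1) x.
  apply/funext => i; rewrite /act /sc /S; case: (split_ordP i) => j -> /=.
    by rewrite eq_lshift join2_l; case: ifP => // _; rewrite mul1r.
  by rewrite eq_rlshift join2_r mul1r.
have muE j : mu t.+1 j = mu t j * (if j == j0 then lam j0 else 1).
  rewrite /mu ltnS leq_eqVlt; case: eqP => [jt|jt] /=.
    have jj : j = j0 by exact/val_inj.
    by rewrite jj /= ltnn eqxx mul1r.
  have -> : (j == j0) = false by apply/eqP => jj; apply: jt; rewrite jj.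
  by rewrite mulr1.
rewrite (_ : sc (mu t.+1) p = sc (mu t) (act S (lam j0) p)); last first.
  by rewrite aE scM; congr sc; exact/funext.
have actO c x : cabs c <= 1 -> Om x -> Om (act S c x).
  by move=> c1 Ox; rewrite aE; apply: star_sc => // j; case: ifP; rewrite ?cabs1.
rewrite IH ?(ltnW tn) //; last exact: actO.
rewrite (kernel_dilation oOm bK actO) //; last first.
  by apply: star_sc => // j; rewrite cabsJ.
rewrite aE scM; congr (K p (sc _ q)); apply/funext => j; rewrite muE rmorphM /= mulrC.
by case: ifP => //; rewrite rmorph1.
Qed.

End HartogsGeometry.

(** * The domain U^alpha and its radial scalings *)

Section UAlpha.
Variables (R : realType) (n m k : nat) (Om : set (pt R (n + m))) (alpha : 'I_n -> R).
Local Notation C := R[i].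
Hypotheses (star : nstar_hartogs Om) (oOm : copen Om) (alpha_gt0 : forall j, 0 < alpha j).
Local Notation U := (U_alpha (k := k) Om alpha).

(** The exponent [s] makes the scalings a group: s = -1 is the scaling in [f_alpha], s = 1 undoes
    it, and s = 2 gives the full power (1 - |w|^2)^alpha. *)
Definition radf (s : R) (w : pt R k) : 'I_n -> C := fun j => rc (powR (1 - sqnorm w) (s * alpha j / 2)).

Lemma sqnorm_ge0 a (w : pt R a) : 0 <= sqnorm w.
Proof. by apply: sumr_ge0 => i _; exact: sqr_ge0. Qed.

Lemma radfD s t w j : sqnorm w < 1 -> radf s w j * radf t w j = radf (s + t) w j.
Proof.
move=> w1; rewrite /radf -rcM -powRD; last by apply/implyP => _; rewrite gt_eqF // subr_gt0.
by rewrite -mulrDl -mulrDl.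
Qed.

Lemma radf0 w j : sqnorm w < 1 -> radf 0 w j = 1.
Proof. by move=> w1; rewrite /radf !mul0r powRr0. Qed.

Lemma radf_neq0 s w j : sqnorm w < 1 -> radf s w j != 0.
Proof. by move=> w1; rewrite /radf rc_eq0 gt_eqF // powR_gt0 // subr_gt0. Qed.

Lemma radfV s w j : sqnorm w < 1 -> (radf s w j)^-1 = radf (- s) w j.
Proof.
by move=> w1; apply: (mulfI (radf_neq0 s j w1)); rewrite divff ?radf_neq0 // radfD // subrr radf0.
Qed.

Lemma cabs_rad_le1 s w j : 0 <= s -> sqnorm w < 1 -> cabs (radf s w j) <= 1.
Proof.
move=> s0 w1; rewrite cabs_rc ger0_norm ?powR_ge0 //.
rewrite -[leRHS](powRr0 (1 - sqnorm w)).
rewrite ger_powR //; last by rewrite divr_ge0 // mulr_ge0 // ltW.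
by rewrite subr_gt0 w1 lerBlDr lerDl sqnorm_ge0.
Qed.

Lemma U_alphaE p w : U (join2 p w) <-> Om (sc (radf (-1) w) p) /\ sqnorm w < 1.
Proof.
rewrite /U_alpha lpart_join rpart_join; rewrite -[in sc _ p](join_parts p) sc_join.
split=> -[h w1]; split => //; move: h; congr (Om (join2 _ _)); apply/funext => j;
by rewrite /f_alpha -radfV // /radf mul1r mulrC.
Qed.

Lemma U_eta0 : U_eta (k := k) Om alpha (fun=> 0) = Om.
Proof.
have s0 : sqnorm (fun _ : 'I_k => 0 : C) = 0 by rewrite /sqnorm big1 // => i _; rewrite cabs0 expr0n.
apply/seteqP; split => p; rewrite /U_eta.
  case/U_alphaE => + _; rewrite (_ : radf _ _ = fun=> 1) ?sc1 //.
  by apply/funext => j; rewrite /radf s0 subr0 powR1.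
move=> Op; apply/U_alphaE; rewrite s0 ltr01; split => //.
by rewrite (_ : radf _ _ = fun=> 1) ?sc1 //; apply/funext => j; rewrite /radf s0 subr0 powR1.
Qed.

Lemma herm_self a (w : pt R a) : herm w w = rc (sqnorm w).
Proof. by rewrite /herm /sqnorm rc_sum; apply: eq_bigr => i _; rewrite mulcJ. Qed.

Lemma ccont_cst N (c : C) (p : pt R N) : ccont (fun=> c) p.
Proof. by apply: cdiff_cont (cdiff_cst _ _). Qed.
Lemma ccont_coord N i (p : pt R N) : ccont (fun q => q i) p.
Proof. by apply: cdiff_cont (cdiff_coord _ _). Qed.
Lemma ccontD N (f g : pt R N -> C) p : ccont f p -> ccont g p -> ccont (fun q => f q + g q) p.
Proof.
move=> cf cg e e0; have e2 : 0 < e / 2 by rewrite divr_gt0.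
have [d1 [d10 H1]] := cf _ e2; have [d2 [d20 H2]] := cg _ e2.
exists (Num.min d1 d2); split; first by rewrite lt_min d10.
move=> q qp.
have /H1 h1 : cball p d1 q by move=> j; have := qp j; rewrite lt_min => /andP[].
have /H2 h2 : cball p d2 q by move=> j; have := qp j; rewrite lt_min => /andP[].
rewrite (_ : _ - _ = (f q - f p) + (g q - g p)); last by ring.
by apply: le_lt_trans (cabsD _ _) _; lra.
Qed.
Lemma ccont_sum N (I : Type) (r : seq I) (f : I -> pt R N -> C) p :
  (forall i, ccont (f i) p) -> ccont (fun q => \sum_(i <- r) f i q) p.
Proof.
move=> cf; elim: r => [|i r IH].
  by rewrite (_ : (fun q => _) = fun=> 0); [exact: ccont_cst|apply/funext => q; rewrite big_nil].
rewrite (_ : (fun q => _) = fun q => f i q + \sum_(j <- r) f j q); last by apply/funext => q; rewrite big_cons.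
exact: ccontD.
Qed.
Lemma ccont_comp1 N (f : C -> C) (g : pt R N -> C) p a : cdiff1 f (g p) a -> ccont g p -> ccont (fun q => f (g q)) p.
Proof.
move=> /cdiff1_cont cf cg e /cf [d [d0 H]]; have [d' [d'0 H']] := cg d d0.
by exists d'; split => // q /H'; exact: H.
Qed.

Lemma ccont_norm (q : pt R (n + m + k)) : ccont (fun q : pt R (n + m + k) => 1 - herm (rpart q) (rpart q)) q.
Proof.
apply: ccontD; first exact: ccont_cst.
rewrite (_ : (fun q => _) = (fun q : pt R (n + m + k) => -1 * herm (rpart q) (rpart q))); last by apply/funext => x; rewrite mulN1r.
apply: ccontM; first exact: ccont_cst.
by apply: ccont_sum => i; apply: ccontM; [|apply: ccontJ]; exact: ccont_coord.
Qed.

(** The radial factors are complex powers of 1 - <w, w>, whose real part is positive; their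
    continuity is thus inherited from [cpow]. *)
Lemma copenU : copen U.
Proof.
pose O := [set q : pt R (n + m + k) | 0 < complex.Re (1 - herm (rpart q) (rpart q))].
have OE q : O q = (sqnorm (rpart q) < 1) by rewrite /O /= herm_self -rc1 -rcB /= subr_gt0.
have oO : copen O.
  move=> q Oq; have [d [d0 H]] := @ccont_norm q _ Oq; exists d; split => // x /H.
  rewrite /O /= => h; have := le_lt_trans (cRe_le _) h.
  by rewrite cReB ltr_norml; move: Oq; rewrite /O /=; set a := complex.Re _; set b := complex.Re _; lra.
rewrite (_ : U = O `&` [set q | Om (sc (radf (-1) (rpart q)) (lpart q))]); last first.
  apply/seteqP; split => q; rewrite -[q]join_parts /= OE rpart_join lpart_join.
    by case/U_alphaE.
  by case=> h1 h2; apply/U_alphaE.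
apply: copen_preimage => // q Oq i.
pose f (q : pt R (n + m + k)) : C := (if fintype.split i is inl j then cpow (1 - herm (rpart q) (rpart q)) (-1 * alpha j / 2) else 1) * q (lshift k i).
have H : ccont f q.
  apply: ccontM; last exact: ccont_coord.
  case: (fintype.split i) => [j|_]; last exact: ccont_cst.
  have [a da] := cdiff1_cpow (-1 * alpha j / 2) Oq.
  exact: (ccont_comp1 (f := fun z => cpow z (-1 * alpha j / 2)) da (@ccont_norm q)).
have fE x : O x -> f x = sc (radf (-1) (rpart x)) (lpart x) i.
  move=> Ox; rewrite /f /sc /join2 /lpart; congr (_ * _); case: (fintype.split i) => // j.
  by rewrite herm_self -rc1 -rcB cpow_rc // subr_gt0 -OE.
move=> e /H [d [d0 Hd]]; have [d' [d'0 Hd']] := oO q Oq.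
exists (Num.min d d'); split; first by rewrite lt_min d0.
move=> x xq; rewrite -!fE //; last by apply: Hd' => j; have := xq j; rewrite lt_min => /andP[].
by apply: Hd => j; have := xq j; rewrite lt_min => /andP[].
Qed.

Lemma copenU_eta eta : copen (U_eta (k := k) Om alpha eta).
Proof.
move=> p Up; have [d [d0 Hd]] := copenU Up; exists d; split => // q qp; apply: Hd => i.
by case: (split_ordP i) => j ->; rewrite ?join2_l ?join2_r ?subrr ?cabs0.
Qed.

Lemma radfJ s w j : (radf s w j)^* = radf s w j.
Proof. exact: rcJ. Qed.

End UAlpha.

(** * Radial integrals over balls *)

Section IteratedIntegral.
Variable R : realType.
Local Notation leb := (@lebesgue_measure R).
Variable phi : R -> R.
Hypotheses (cphi : forall x : R, {for x, continuous phi}) (phi0 : forall u, u <= 0 -> phi u = 0).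

(* The lower bound [-1] is immaterial: all these functions vanish on [u <= 0]. *)
Fixpoint iterint (k : nat) (t : R) : R :=
  if k is k'.+1 then pi * sint (iterint k') (-1) t else phi t.

Lemma iterint0 k t : t <= 0 -> iterint k t = 0.
Proof.
elim: k t => [|k IH] t t0 /=; first exact: phi0.
rewrite /sint (@eq_Rintegral _ _ _ leb _ (cst 0)).
  by rewrite Rintegral_cst // mul0r mulr0.
move=> x; rewrite inE /= in_itv /= => /andP[_ xt]; exact/IH/(le_trans xt).
Qed.

Let step k : (forall x : R, {for x, continuous (iterint k)}) ->
  forall x : R, -1 < x -> is_derive x 1 (iterint k.+1) (pi * iterint k x).
Proof.
move=> ck x x1.
have ix : leb.-integrable [set` Interval (BLeft (-1)) (BRight (x + 1))] (EFin \o iterint k).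
  by apply: contin_integrable => y _; exact: ck.
have xx : x < x + 1 by rewrite ltrDl.
have [d1 d2] := continuous_FTC1_closed xx ix x1 (ck x).
have d3 : is_derive x 1 (fun t => sint (iterint k) (-1) t) (iterint k x).
  by apply: DeriveDef; [exact: d1|rewrite -derive1E; exact: d2].
exact: (is_deriveZ pi d3).
Qed.

Lemma iterint_cont k (x : R) : {for x, continuous (iterint k)}.
Proof.
elim: k x => [|k IH] x; first exact: cphi.
have [x1|x1] := ltP (-1) x.
  have [dx _] := step IH x1.
  by apply: differentiable_continuous; exact/derivable1_diffP.
have xx0 : x <= 0 by lra.
have E := @iterint0 k.+1 x xx0.
apply: cvg_near_cst; rewrite -/(iterint k.+1) E; have x0 : x < 0 by lra.
by apply: filterS (lt_nbhsl x0) => y y0; apply: iterint0; exact: ltW.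
Qed.

Lemma iterint_derive k (x : R) : -1 < x -> is_derive x 1 (iterint k.+1) (pi * iterint k x).
Proof. by apply: step; exact: iterint_cont. Qed.

Lemma iterint_ge0 k t : (forall u, 0 <= phi u) -> 0 <= iterint k t.
Proof.
move=> p0; elim: k t => [|k IH] t //=.
by rewrite mulr_ge0 ?pi_ge0 // /sint fine_ge0 // integral_ge0 // => x _; rewrite lee_fin.
Qed.

Lemma measurable_iterint k : measurable_fun [set: measurableTypeR R] (iterint k : measurableTypeR R -> measurableTypeR R).
Proof. by apply: continuous_measurable_fun; exact: iterint_cont. Qed.

Lemma measurable_sqnorm k : measurable_fun [set: mpt R k] (fun w : mpt R k => sqnorm w : measurableTypeR R).
Proof.
rewrite /sqnorm; apply: measurable_sum => i; under eq_fun do rewrite cabs_sqr.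
apply: measurable_funD; apply: measurable_funX; [exact: measurable_coord_Re|exact: measurable_coord_Im].
Qed.

Lemma sqnorm_ccons k (c : R[i]) (p : pt R k) : sqnorm (ccons c p) = cabs c ^+ 2 + sqnorm p.
Proof. by rewrite /sqnorm big_ord_recl ccons0; congr (_ + _); apply: eq_bigr => i _; rewrite cconsS. Qed.

Lemma measurable_radial k t :
  measurable_fun [set: mpt R k] (fun w : mpt R k => (phi (t - sqnorm w))%:E).
Proof.
apply/measurable_EFinP; apply: (measurableT_comp (f := phi)); first exact: (measurable_iterint 0).
by apply: measurable_funB => //; exact: measurable_sqnorm.
Qed.

(** Integrating out one complex coordinate yields, by [leb2_radial], pi times the integral of
    [iterint k (t - v)] over v > 0; the reflection v -> t - v turns this into the next iterated
    integral. *)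
Lemma ge0_integral_radial k t : (forall u, 0 <= phi u) ->
  (\int[vol R k]_w (phi (t - sqnorm w))%:E = (iterint k t)%:E)%E.
Proof.
move=> p0; elim: k t => [|k IH] t.
  rewrite vol0; last exact: measurable_radial.
  by rewrite /sqnorm big_ord0 subr0.
rewrite vol_cons; [|exact: measurable_radial|by move=> p; rewrite lee_fin].
transitivity (\int[leb2 R]_z (iterint k (t - cabs (pc z) ^+ 2))%:E)%E.
  apply: eq_integral => z _; rewrite -IH; apply: eq_integral => w _.
  by rewrite sqnorm_ccons opprD addrA.
have mF : measurable_fun [set: measurableTypeR R] (fun v : measurableTypeR R => (iterint k (t - v))%:E).
  apply/measurable_EFinP; apply: (measurableT_comp (f := iterint k)); first exact: measurable_iterint.
  by apply: measurable_funB.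
have mI : measurable_fun [set: measurableTypeR R] (fun u : measurableTypeR R => (iterint k u)%:E).
  by apply/measurable_EFinP; exact: measurable_iterint.
rewrite (leb2_radial mF); last by move=> x; rewrite lee_fin iterint_ge0.
rewrite [RHS]/= EFinM; congr (_ * _)%E.
pose H (u : measurableTypeR R) : \bar R := if (u < t)%R then (iterint k u)%:E else 0%E.
have mH : measurable_fun setT H by apply: measurable_fun_ifT => //; exact: measurable_fun_ltr.
transitivity (\int[leb]_u H u)%E.
  rewrite (@leb_affine R (-1) t _ H mH); first last.
  - by move=> x; rewrite /H; case: ifP => // _; rewrite lee_fin iterint_ge0.
  - by rewrite oppr_eq0 oner_eq0.
  apply: eq_integral => v _; rewrite normrN normr1 mule1 /H.
  by rewrite (_ : -1 * v + t = t - v)%R ?gtrBl //; ring.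
have iI : leb.-integrable `[-1, t] (EFin \o iterint k).
  by apply: contin_integrable => x _; exact: iterint_cont.
rewrite /sint /Rintegral fineK; last exact: integrable_fin_num.
rewrite -integral_itv_bndo_bndc; last exact: measurable_funTS.
rewrite [RHS]integral_mkcond; apply: eq_integral => u _; rewrite /H patchE.
case: (boolP (u < t)) => ut; last first.
  by rewrite memNset //= in_itv /= (negbTE ut) andbF.
have [u1|u1] := leP (-1) u; first by rewrite mem_set //= in_itv /= u1.
rewrite memNset /= ?in_itv /= ?leNgt ?u1 //.
by rewrite iterint0 //; lra.
Qed.
End IteratedIntegral.

Section SignedRadial.
Variable R : realType.
Local Notation leb := (@lebesgue_measure R).

Lemma iterintB (f g : R -> R) k t : (forall x : R, {for x, continuous f}) -> (forall u, u <= 0 -> f u = 0) ->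
  (forall x : R, {for x, continuous g}) -> (forall u, u <= 0 -> g u = 0) ->
  iterint (fun x => f x - g x) k t = iterint f k t - iterint g k t.
Proof.
move=> cf f0 cg g0; elim: k t => [|k IH] t //=; rewrite -mulrBr; congr (_ * _).
rewrite /sint -RintegralB //.
- by apply: eq_Rintegral => x _; exact: IH.
- by apply: contin_integrable => x _; exact: iterint_cont.
- by apply: contin_integrable => x _; exact: iterint_cont.
Qed.

(** The parts (|phi| + phi) / 2 and (|phi| - phi) / 2 are again continuous and vanish for u <= 0. *)
Lemma integral_radial (phi : R -> R) k t : (forall x : R, {for x, continuous phi}) ->
  (forall u, u <= 0 -> phi u = 0) ->
  (vol R k).-integrable setT (fun w => (phi (t - sqnorm w))%:E) /\
  (\int[vol R k]_w (phi (t - sqnorm w))%:E = (iterint phi k t)%:E)%E.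
Proof.
move=> cphi phi0.
pose fp x := (`|phi x| + phi x) / 2; pose fn x := (`|phi x| - phi x) / 2.
have cn x : {for x, continuous (fun x => `|phi x|)} by apply: cvg_norm; exact: cphi.
have cp x : {for x, continuous fp} by apply: cvgM; [apply: cvgD; [exact: cn|exact: cphi]|exact: cvg_cst].
have cm x : {for x, continuous fn} by apply: cvgM; [apply: cvgB; [exact: cn|exact: cphi]|exact: cvg_cst].
have p0 u : u <= 0 -> fp u = 0 by move=> /phi0 h; rewrite /fp h normr0 addr0 mul0r.
have m0 u : u <= 0 -> fn u = 0 by move=> /phi0 h; rewrite /fn h normr0 subr0 mul0r.
have pg u : 0 <= fp u by rewrite divr_ge0 // -lerBlDr sub0r -normrN ler_norm.
have mg u : 0 <= fn u by rewrite divr_ge0 // subr_ge0 ler_norm.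
have ip (f : R -> R) : (forall x : R, {for x, continuous f}) -> (forall u, u <= 0 -> f u = 0) ->
    (forall u, 0 <= f u) -> (vol R k).-integrable setT (fun w => (f (t - sqnorm w))%:E).
  move=> cf f0 fg; apply/integrableP; split; first exact: measurable_radial.
  under eq_integral do rewrite gee0_abs ?lee_fin //.
  by rewrite (ge0_integral_radial cf f0) // ltry.
have E w : (phi (t - sqnorm w))%:E = ((fp (t - sqnorm w))%:E - (fn (t - sqnorm w))%:E)%E.
  by rewrite -EFinB; congr (_%:E); rewrite /fp /fn; field.
have i1 := ip _ cp p0 pg; have i2 := ip _ cm m0 mg.
split; first by under eq_fun do rewrite E; exact: integrableB.
under eq_integral do rewrite E.
rewrite integralB // (ge0_integral_radial cp p0) // (ge0_integral_radial cm m0) // -EFinB -iterintB //.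
by congr (iterint _ k t)%:E; apply/funext => x; rewrite /fp /fn; field.
Qed.
End SignedRadial.

Section RealCurves.
Variable R : realType.
Local Notation C := R[i].

Lemma rcdiffM (f g : R -> C) t a b : rcdiff f t a -> rcdiff g t b ->
  rcdiff (fun s => f s * g s) t (a * g t + f t * b).
Proof.
move=> /rcdiff_cdiff1 df /rcdiff_cdiff1 dg.
have E (x : C) : x * complex.Complex 0 0 = 0 by rewrite -[complex.Complex 0 0]/(0 : C) mulr0.
have := cdiff1M df dg; rewrite /= !E !addr0 => H e /H [d [d0 {}H]]; exists d; split => // s sd.
have := H (rc s); rewrite cabs_rc => /(_ sd).
by rewrite /= !addr0 !E !addr0.
Qed.

Lemma rcdiff_rc (f : R -> R) (t : R) (df : R) : is_derive t 1 f df -> rcdiff (fun s => rc (f s)) t (rc df).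
Proof.
move=> /derive_eps H e /H [d [d0 {}H]]; exists d; split => // s /H.
by rewrite -!rcB -rcM -rcB cabs_rc.
Qed.

Lemma rcdiff_local (f g : R -> C) t a d : 0 < d -> (forall s, `|s - t| < d -> f s = g s) ->
  rcdiff f t a -> rcdiff g t a.
Proof.
move=> d0 fg df e /df [d' [d'0 H]]; exists (Num.min d d'); split; first by rewrite lt_min d0.
move=> s; rewrite lt_min => /andP[s1 s2]; rewrite -!fg ?subrr ?normr0 //; first exact: H.
by rewrite addrAC subrr add0r.
Qed.

Lemma rcdiff_unique (f g : R -> R) (t : R) a (df dg : R) :
  rcdiff (fun s => complex.Complex (f s) (g s)) t a ->
  is_derive t 1 f df -> is_derive t 1 g dg -> a = complex.Complex df dg.
Proof.
move=> /rcdiff_is_derive [[_ h1] [_ h2]] [_ <-] [_ <-].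
by apply: cplx_eq => /=; rewrite -?h1 -?h2.
Qed.
End RealCurves.

(** * The operator of the theorem as a derivative along curves *)

Section EulerOperator.
Variables (R : realType) (n : nat) (alpha : 'I_n -> R) (V : set (pt R n)) (z : pt R n) (T : R).
Local Notation C := R[i].
Local Notation A := (\sum_(l < n) alpha l).
Let cz (t : R) : pt R n := fun j => rc (powR t (alpha j)) * z j.
Hypotheses (oV : copen V) (czV : forall t, 0 < t < T -> V (cz t)).

Lemma holomorphic_Lop j G : holomorphic_on V G -> holomorphic_on V (Lop alpha j G).
Proof.
move=> hG; rewrite /Lop; apply: holomorphicD.
  by apply: holomorphicM => //; exact: holomorphic_cst.
apply: holomorphic_sum => l; apply: holomorphicM; first exact: holomorphic_cst.
apply: holomorphicD => //; apply: holomorphicM; first exact: holomorphic_coord.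
exact: holomorphic_dz.
Qed.

Lemma powRS1 (t a : R) : 0 < t -> t * powR t (a - 1) = powR t a.
Proof.
move=> t0; rewrite -{1}[t](powRr1 (ltW t0)) -powRD ?(addrC 1) ?subrK //.
by apply/implyP => _; rewrite gt_eqF.
Qed.

(* The Euler-type factors are derivatives along the curve [t^alpha z]. *)
Lemma Lop_curve j G t : holomorphic_on V G -> 0 < t < T ->
  rcdiff (fun s => rc (powR s (j%:R + 1 + A)) * G (cz s)) t
    (rc (powR t (j%:R + A)) * Lop alpha j.+1 G (cz t)).
Proof.
move=> hG /[dup] /andP[t0 _] tT; have [a da] := hG _ (czV tT).
have dcz i : rcdiff (fun s => cz s i) t (rc (alpha i * powR t (alpha i - 1)) * z i + rc (powR t (alpha i)) * 0).
  apply: rcdiffM; first exact/rcdiff_rc/is_derive1_powR.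
  by move=> e e0; exists 1; split => // s _; rewrite subrr mul0r subrr cabs0 mulr_ge0 // ltW.
have d1 := rcdiff_rc (is_derive1_powR (j%:R + 1 + A) t0).
have := rcdiffM d1 (rcdiff_comp da dcz); congr rcdiff.
have e1 : powR t (j%:R + 1 + A - 1) = powR t (j%:R + A) by congr powR; ring.
have e2 : powR t (j%:R + 1 + A) = powR t (j%:R + A) * t.
  by rewrite -e1 mulrC powRS1.
rewrite e1 e2 !rcM; set X := rc (powR _ _); set S : C := \sum_i (_ * _).
transitivity (X * (rc (j%:R + 1 + A) * G (cz t) + rc t * S)); first by ring.
congr (_ * _).
rewrite /Lop; under [in RHS]eq_bigr do rewrite mulrDr.
rewrite [in RHS]big_split /= -mulr_suml -rc_sum addrA -mulrDl; congr (_ + _).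
  by rewrite rcD rcD rc_nat rc1 -[in RHS]natr1.
rewrite mulr_sumr; apply: eq_bigr => i _.
rewrite (dz_cdiff i da) mulr0 addr0 /cz rcM -(powRS1 (alpha i) t0) rcM; ring.
Qed.

(** The factor of index k + 1 is the innermost in [Prodop]: it acts on [G] first and undoes the
    outermost of the k + 1 integrations, releasing one factor pi. The constant [c] is kept general
    so as to collect these. *)
Lemma Prodop_curve (fr fi : R -> R) : (forall x : R, {for x, continuous fr}) -> (forall u, u <= 0 -> fr u = 0) ->
  (forall x : R, {for x, continuous fi}) -> (forall u, u <= 0 -> fi u = 0) ->
  forall k G (c : R), holomorphic_on V G ->
  (forall t, 0 < t < T -> rc (powR t (k%:R + A)) * G (cz t) =
     rc c * complex.Complex (iterint fr k t) (iterint fi k t)) ->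
  forall t, 0 < t < T -> rc (powR t A) * Prodop alpha k G (cz t) =
    rc (c * pi ^+ k) * complex.Complex (fr t) (fi t).
Proof.
move=> cfr fr0 cfi fi0; elim=> [|k IH] G c hG H t tT.
  by rewrite /Prodop /= mulr1 -H // add0r.
rewrite /Prodop -(addn1 k) iotaD foldr_cat /= add1n -/(Prodop alpha k _) (IH _ (c * pi)) //.
- by rewrite addn1 exprS mulrA.
- exact: holomorphic_Lop.
move=> s sT; have [s0 s1] := andP sT.
have := @Lop_curve k G s hG sT.
(* A two-sided neighbourhood of [s] on which the assumed identity can be differentiated. *)
have d0 : 0 < Num.min s (T - s) by rewrite lt_min s0 subr_gt0.
have E x : `|x - s| < Num.min s (T - s) -> rc (powR x (k%:R + 1 + A)) * G (cz x) =
    complex.Complex (c * iterint fr k.+1 x) (c * iterint fi k.+1 x).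
  rewrite lt_min !ltr_norml => /andP[/andP[h1 h2] /andP[h3 h4]].
  rewrite natr1 H; last by apply/andP; split; lra.
  by apply: cplx_eq; rewrite ?(cReM, cImM) /=; ring.
move=> /(rcdiff_local d0 E).
have s10 : -1 < s by lra.
move=> /rcdiff_unique /(_ (is_deriveZ c (iterint_derive cfr fr0 k s10)) (is_deriveZ c (iterint_derive cfi fi0 k s10))) ->.
by apply: cplx_eq; rewrite ?(cReM, cImM) /= /GRing.scale /=; ring.
Qed.
End EulerOperator.

(** * Integration over the fibres of U^alpha *)

Section Pairings.
Variables (R : realType) (N : nat) (O : set (pt R N)).
Local Notation C := R[i].
Hypothesis oO : copen O.

(** With [u] the real or the imaginary part, both halves of a complex integral are handled by one
    argument; finiteness of the integral makes [fine] lossless. *)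
Lemma pairing_integral (u : C -> R) f g : u = @complex.Re R \/ u = @complex.Im R ->
  bergman_space O f -> bergman_space O g ->
  (vol R N).-integrable setT (fun p => (Defs.indic O p * u (f p * (g p)^*))%:E) /\
  (\int[vol R N]_p (Defs.indic O p * u (f p * (g p)^*))%:E = (u (cint O (fun p => f p * (g p)^*)))%:E)%E.
Proof.
move=> [->|->] bf bg; rewrite (cintE oO bf bg) /=.
  have i := pairing_Re oO bf bg; split => //; rewrite fineK //; exact: integrable_fin_num.
have i := pairing_Im oO bf bg; split => //; rewrite fineK //; exact: integrable_fin_num.
Qed.
End Pairings.

Section Fubini.
Variable R : realType.

Lemma integrable_join2 a b (F : mpt R (a + b) -> \bar R) : (vol R (a + b)).-integrable setT F ->
  (prod_sfm (vol R a) (vol R b)).-integrable setT (fun x => F (join2 x.1 x.2)).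
Proof.
move=> /integrableP[mF fF]; have mJ : measurable_fun setT (fun z : mpt R a * mpt R b => join2 z.1 z.2 : mpt R (a + b)).
  exact: measurable_join2.
apply/integrableP; split; first exact: (measurableT_comp mF mJ).
by rewrite -(vol_join2E (F := fun p => `|F p|%E)) //; exact: measurableT_comp.
Qed.

Lemma integral_join2 a b (F : mpt R (a + b) -> \bar R) : (vol R (a + b)).-integrable setT F ->
  (\int[vol R (a + b)]_p F p = \int[vol R b]_y \int[vol R a]_x F (join2 x y))%E.
Proof.
move=> iF; rewrite vol_join2E; last exact: measurable_int iF.
exact/esym/(integral21_prod_meas1 (integrable_join2 iF)).
Qed.

Lemma ae_integrable_join2 a b (F : mpt R (a + b) -> \bar R) : (vol R (a + b)).-integrable setT F ->
  \forall y \ae vol R b, (vol R a).-integrable setT (fun x => F (join2 x y)).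
Proof. by move=> /integrable_join2 /ae_integrable2. Qed.

Lemma vol_diagE N (c : 'I_N -> R[i]) (F : mpt R N -> \bar R) :
  (forall i, c i != 0) -> measurable_fun setT F ->
  (\int[vol R N]_p F p =
  \int[vol R N]_p (F (fun i => c i * p i)%R * (\prod_(i < N) cabs (c i) ^+ 2)%:E))%E.
Proof.
move=> c0; apply: (integral_weighted (psi := fun p : mpt R N => (fun i => c i * p i) : mpt R N)
  (w := fun=> \prod_(i < N) cabs (c i) ^+ 2)).
  by move=> _; apply: prodr_ge0 => i _; exact: sqr_ge0.
by move=> G mG G0; exact: vol_diag.
Qed.
End Fubini.

(** * The kernel of the base as a radial integral of the kernel of U^alpha *)

Section FiberFormula.
Variables (R : realType) (n m k : nat) (Om : set (pt R (n + m))) (alpha : 'I_n -> R).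
Local Notation C := R[i].
Local Notation U := (U_alpha (k := k) Om alpha).
Local Notation A := (\sum_(l < n) alpha l).
Variables (KU : pt R (n + m + k) -> pt R (n + m + k) -> C) (K : pt R (n + m) -> pt R (n + m) -> C).
Hypotheses (star : nstar_hartogs Om) (oOm : copen Om) (alpha_gt0 : forall j, 0 < alpha j).
Hypotheses (bKU : bergman_kernel U KU) (bK : bergman_kernel Om K).

Let UE p w : U (join2 p w) <-> Om (sc (radf alpha (-1) w) p) /\ sqnorm w < 1 := U_alphaE Om alpha p w.
Let oU : copen U := @copenU R n m k Om alpha oOm.

Definition emb (p : pt R (n + m)) : pt R (n + m + k) := join2 p (fun=> 0).
(** The function that is to be recovered from [K]. *)
Definition kernel0 p q : C := KU (emb p) (emb q).

Lemma sqnorm0 a : sqnorm (fun _ : 'I_a => 0 : C) = 0.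
Proof. by rewrite /sqnorm big1 // => i _; rewrite cabs0 expr0n. Qed.

(** Passing from [w] to a shorter [v] multiplies the scaled point by ((1 - |w|^2) / (1 -
    |v|^2))^(alpha_j / 2) <= 1, which the star-shape of [Om] permits. *)
Lemma U_alphaS p v w : sqnorm v <= sqnorm w -> U (join2 p w) -> U (join2 p v).
Proof.
move=> vw /UE [Op w1]; have v1 := le_lt_trans vw w1; apply/UE; split; last exact: v1.
rewrite (_ : sc _ p = sc (fun j => radf alpha (-1) v j * radf alpha 1 w j) (sc (radf alpha (-1) w) p)).
  apply: (star_sc star) Op => j; rewrite cabsM -radfV // cabsV !cabs_rc !ger0_norm ?powR_ge0 //.
  rewrite mulrC ler_pdivrMr ?powR_gt0 ?subr_gt0 // mul1r mul1r ge0_ler_powR //.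
  - by rewrite divr_ge0 // ltW.
  - by rewrite nnegrE subr_ge0 ltW.
  - by rewrite nnegrE subr_ge0 ltW.
  - by rewrite lerD2l lerN2.
rewrite scM; congr sc; apply/funext => j.
by rewrite -mulrA radfD // addrN radf0 // mulr1.
Qed.

Lemma U_emb p : U (emb p) <-> Om p.
Proof. by rewrite -[X in _ <-> X p](@U_eta0 _ _ _ k Om alpha). Qed.

Lemma U_base p (w : pt R k) : U (join2 p w) -> Om p.
Proof. by move=> Up; apply/U_emb/(U_alphaS _ Up); rewrite sqnorm0 sqnorm_ge0. Qed.

Lemma U_scaled (w : pt R k) x : sqnorm w < 1 -> U (join2 (sc (radf alpha 1 w) x) w) <-> Om x.
Proof.
move=> w1; rewrite UE scM (_ : (fun j => _) = fun=> 1); last first.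
  by apply/funext => j; rewrite radfD // addNr radf0.
by rewrite sc1; split => [[]|].
Qed.

(** The dilation identity for the [w] coordinates at c = 0: collapsing [w] in the first argument
    amounts to collapsing it in the second, where it is already zero. *)
Lemma kernel_fiber0 p w q : U (join2 p w) -> Om q -> KU (join2 p w) (emb q) = kernel0 p q.
Proof.
move=> Up Oq; pose S : pred 'I_(n + m + k) := fun i => if fintype.split i is inr _ then true else false.
have aE c x y : act S c (join2 x y) = join2 x (fun i => c * y i) :> pt R (n + m + k).
  apply/funext => i; rewrite /act /S /join2.
  by case: (fintype.split i).
have actU c x : cabs c <= 1 -> U x -> U (act S c x).
  move=> c1; rewrite -[x]join_parts aE; apply: U_alphaS.
  apply: ler_sum => i _; rewrite cabsM exprMn ler_piMl ?sqr_ge0 //.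
  by rewrite expr_le1 // cabs_ge0.
have Z (x : pt R k) : (fun i => 0 * x i) = fun=> 0 by apply/funext => i; rewrite mul0r.
have := kernel_dilation oU bKU actU (c := 0) _ Up ((U_emb q).2 Oq).
by rewrite cabs0 conjC0 /emb !aE !Z => /(_ ler01) E; rewrite /kernel0 /emb E.
Qed.

(** The kernel on the fibre over [w], rescaled so that every fibre becomes [Om]. *)
Definition slice q (w : pt R k) x : C := KU (join2 (sc (radf alpha 1 w) x) w) (emb q).

(** The real Jacobian of that rescaling, in which each factor (1 - |w|^2)^(alpha_j / 2) counts
    twice. *)
Definition rho (w : pt R k) : R := powR (1 - sqnorm w) A.

Lemma prod_rad w : sqnorm w < 1 ->
  \prod_i cabs (join2 (radf alpha 1 w) (fun _ : 'I_m => 1) i) ^+ 2 = rho w.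
Proof.
move=> w1; rewrite big_split_ord /= [X in _ * X]big1 ?mulr1; last first.
  by move=> i _; rewrite join2_r cabs1 expr1n.
rewrite /rho; elim/big_rec2: _ => [|j y1 y2 _ ->]; first by rewrite powRr0.
rewrite powRD; last by apply/implyP => _; rewrite gt_eqF // subr_gt0.
rewrite join2_l cabs_rc ger0_norm ?powR_ge0 // expr2 -powRD; last first.
  by apply/implyP => _; rewrite gt_eqF // subr_gt0.
by congr (powR _ _ * _); rewrite mul1r; field.
Qed.

Lemma rho_gt0 w : sqnorm w < 1 -> 0 < rho w.
Proof. by move=> w1; rewrite powR_gt0 // subr_gt0. Qed.

Lemma integral_scaled w (F : mpt R (n + m) -> \bar R) : sqnorm w < 1 -> measurable_fun setT F ->
  (\int[vol R (n + m)]_z F z = \int[vol R (n + m)]_x (F (sc (radf alpha 1 w) x) * (rho w)%:E))%E.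
Proof.
move=> w1 mF; rewrite -prod_rad //; apply: vol_diagE => // i.
by case: (split_ordP i) => j ->; rewrite ?join2_l ?join2_r ?radf_neq0 ?oner_eq0.
Qed.

(* Fubini provides the integrability hypothesis for almost every [w] only. *)
Lemma slice_bergman q w : Om q -> sqnorm w < 1 ->
  (vol R (n + m)).-integrable setT (fun z => (Defs.indic U (join2 z w) * cabs (KU (join2 z w) (emb q)) ^+ 2)%:E) ->
  bergman_space Om (slice q w).
Proof.
move=> Oq w1 iF; have [[hKU _] _] := bKU ((U_emb q).2 Oq).
have hs : holomorphic_on Om (slice q w).
  apply: (holomorphic_comp (V := U) (f := fun P => KU P (emb q)) (F := fun x => join2 (sc (radf alpha 1 w) x) w)) => //.
    by move=> x Ox; exact/U_scaled.
  move=> i; case: (split_ordP i) => j ->.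
    rewrite (_ : (fun x => _) = fun x => join2 (radf alpha 1 w) (fun _ : 'I_m => 1) j * x j).
      by apply: holomorphicM; [exact: holomorphic_cst|exact: holomorphic_coord].
    by apply/funext => x; rewrite join2_l.
  rewrite (_ : (fun x => _) = fun=> w j); first exact: holomorphic_cst.
  by apply/funext => x; rewrite join2_r.
split => //; have mF := measurable_int _ iF.
have m1 := measurable_sqr_on oOm (holomorphic_ccont hs).
have p0 x : 0 <= Defs.indic Om x * cabs (slice q w x) ^+ 2 by rewrite mulr_ge0 ?cindic_ge0 ?sqr_ge0.
rewrite (lint_ge0 m1 p0).
have E : (\int[vol R (n + m)]_z (Defs.indic U (join2 z w) * cabs (KU (join2 z w) (emb q)) ^+ 2)%:E =
    (rho w)%:E * \int[vol R (n + m)]_x (Defs.indic Om x * cabs (slice q w x) ^+ 2)%:E)%E.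
  rewrite (integral_scaled w1 mF) -ge0_integralZl //; first last.
  - by rewrite lee_fin ltW // rho_gt0.
  - by move=> x _; rewrite lee_fin.
  - exact/measurable_EFinP.
  apply: eq_integral => x _; rewrite muleC; congr (_ * (_ * _)%:E)%E.
  have [Ox|Ox] := pselect (Om x); first by rewrite !cindic1 //; exact/U_scaled.
  by rewrite !cindic0 // => /(U_scaled _ w1).
have h := integrable_fin_num measurableT iF; rewrite E in h.
rewrite ltNge leye_eq; apply/negP => /eqP X; move: h; rewrite X gt0_muley //.
by rewrite lte_fin rho_gt0.
Qed.

Section Part.
Variables (u : C -> R) (uP : u = @complex.Re R \/ u = @complex.Im R) (p q : pt R (n + m)).
Hypotheses (Op : Om p) (Oq : Om q).

Definition weighted (v : R) : C := rc (powR v A) * kernel0 (sc (fun j => rc (powR v (alpha j))) p) q.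

Lemma uZ (a : R) (z : C) : u (rc a * z) = a * u z.
Proof. by case: uP => ->; rewrite ?cReM ?cImM /= mul0r ?subr0 ?addr0. Qed.

(** After rescaling the fibre to [Om], the scaling in K(., p) is moved onto [p], and the reproducing
    property evaluates the slice at the scaled [p]. The slice contains a second copy of the scaling,
    so the exponent alpha_j / 2 becomes alpha_j. *)
Lemma fiber_integral w : sqnorm w < 1 -> bergman_space Om (slice q w) ->
  measurable_fun [set: mpt R (n + m)] (fun z => (Defs.indic U (join2 z w) * u (K z p * (KU (join2 z w) (emb q))^*))%:E) ->
  (\int[vol R (n + m)]_z (Defs.indic U (join2 z w) * u (K z p * (KU (join2 z w) (emb q))^*))%:E =
   (u (weighted (1 - sqnorm w))^*)%:E)%E.
Proof.
move=> w1 bs mF; pose r1p := sc (radf alpha 1 w) p.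
have Or1 x : Om x -> Om (sc (radf alpha 1 w) x) by move=> Ox; apply: star_sc => // j; exact: (cabs_rad_le1 alpha_gt0).
have [bK1 rK1] := bK (Or1 _ Op).
have [iP eP] := pairing_integral oOm uP bK1 bs.
rewrite (cintJ oOm bs bK1) -rK1 // in eP.
rewrite (integral_scaled w1 mF).
transitivity ((rho w)%:E * \int[vol R (n + m)]_x (Defs.indic Om x * u (K x r1p * (slice q w x)^*))%:E)%E.
  rewrite -integralZl //; apply: eq_integral => x _; rewrite muleC; congr (_ * _)%E.
  have [Ox|Ox] := pselect (Om x); last by rewrite !cindic0 ?mul0r // => /(U_scaled _ w1).
  rewrite !cindic1 //; last exact/U_scaled.
  rewrite (kernel_sc star oOm bK) //; last by move=> j; exact: (cabs_rad_le1 alpha_gt0).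
  by rewrite (_ : (fun j => _) = radf alpha 1 w) //; apply/funext => j; rewrite radfJ.
rewrite eP -EFinM -uZ /weighted rmorphM /= rcJ; congr (u (_ * _^*))%:E.
rewrite /slice /r1p kernel_fiber0 //; last exact/U_scaled/Or1.
rewrite scM; congr (kernel0 (sc _ p) q); apply/funext => j.
by rewrite radfD // /radf; congr (rc (powR _ _)); field.
Qed.

Lemma base_bergman : bergman_space U (fun P => K (lpart P) p).
Proof.
have [[hK fK] _] := bK Op; have hb : holomorphic_on U (fun P => K (lpart P) p).
  apply: (holomorphic_comp (V := Om) (f := fun x => K x p) (F := fun P => lpart P)) => //.
    by move=> P; rewrite -[P]join_parts lpart_join; exact: U_base.
  by move=> i; exact: holomorphic_coord.
have mb := measurable_sqr_on oU (holomorphic_ccont hb).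
have mK := measurable_sqr_on oOm (holomorphic_ccont hK).
have g0 N (O : set (pt R N)) (f : pt R N -> C) x : 0 <= Defs.indic O x * cabs (f x) ^+ 2.
  by rewrite mulr_ge0 ?cindic_ge0 ?sqr_ge0.
split => //; rewrite (lint_ge0 mb (g0 _ U (fun P => K (lpart P) p))) vol_join2E; last exact/measurable_EFinP.
(* At 2 - |w|^2 this is at least one on the unit ball, and it is continuous, so [integral_radial]
   gives a finite majorant for the integral over [w]. *)
pose psi (v : R) := Num.max 0 v.
have cpsi (x : R) : {for x, continuous psi}.
  exact: (@continuous_max R R (fun=> 0) id x (cvg_cst _) cvg_id).
have psi0 v : v <= 0 -> psi v = 0 by move=> v0; apply/max_idPl.
have ga z : 0 <= Defs.indic Om z * cabs (K z p) ^+ 2 by exact: (g0 _ Om (fun z => K z p)).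
have psi_ge0 v : 0 <= psi v by rewrite le_max lexx.
have [iw ew] := integral_radial k 2 cpsi psi0.
pose a z := Defs.indic Om z * cabs (K z p) ^+ 2.
have ma : measurable_fun [set: mpt R (n + m)] a := mK.
have mw : measurable_fun [set: mpt R k] (fun w => psi (2 - sqnorm w)) by have /measurable_int/measurable_EFinP := iw.
apply: (@le_lt_trans _ _ (\int[prod_sfm (vol R (n + m)) (vol R k)]_x (a x.1 * psi (2 - sqnorm x.2))%:E)%E).
  have mJ : measurable_fun setT (fun z : mpt R (n + m) * mpt R k => join2 z.1 z.2 : mpt R (n + m + k)).
    exact: measurable_join2.
  have mb' := (measurable_EFinP _ _).2 mb.
  apply: (ge0_le_integral _ measurableT _ (measurableT_comp mb' mJ)).
  - by move=> x _; rewrite /= lee_fin; exact: (g0 _ U (fun P => K (lpart P) p)).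
  - apply/measurable_EFinP; apply: measurable_funM.
      exact: (measurableT_comp ma).
    exact: (measurableT_comp mw measurable_snd).
  move=> [z w] _ /=; rewrite lee_fin lpart_join.
  have [Uz|Uz] := pselect (U (join2 z w)); last by rewrite cindic0 // mul0r mulr_ge0 // ga.
  rewrite cindic1 // /a cindic1; last exact: U_base Uz.
  rewrite !mul1r ler_peMr ?sqr_ge0 // /psi le_max; apply/orP; right.
  by have [_] := (UE _ _).1 Uz; lra.
rewrite tonelli; first last.
- by move=> x; rewrite lee_fin mulr_ge0 // ga.
- apply/measurable_EFinP; apply: measurable_funM; first exact: (measurableT_comp ma).
  exact: (measurableT_comp mw measurable_snd).
rewrite (_ : (fun x => _) = fun x : mpt R (n + m) => ((iterint psi k 2)%:E * (a x)%:E)%E); last first.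
  apply/funext => x; rewrite muleC -ew -integralZl //.
rewrite ge0_integralZl //; first last.
- by rewrite lee_fin iterint_ge0.
- by move=> x _; rewrite lee_fin ga.
- exact/measurable_EFinP.
rewrite -(lint_ge0 mK ga).
by apply: lte_mul_pinfty => //; rewrite lee_fin iterint_ge0.
Qed.

(* [K (., p)] does not depend on [w]; it is reproduced by [KU] and Fubini is applied. *)
Lemma kernel_fiber (phi : R -> R) : (forall x : R, {for x, continuous phi}) ->
  (forall v, v <= 0 -> phi v = 0) -> (forall v, 0 < v <= 1 -> phi v = u (weighted v)^*) ->
  u (K q p) = iterint phi k 1.
Proof.
move=> cphi phi0 phiE; have bb := base_bergman.
have [bKq rKq] := bKU ((U_emb q).2 Oq).
have := rKq _ bb; rewrite /emb lpart_join -/(emb q) => ->.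
have [iP eP] := pairing_integral oU uP bb bKq.
have [ir er] := integral_radial k 1 cphi phi0.
apply: EFin_inj; rewrite -eP -er (integral_join2 iP).
apply: ae_eq_integral => //.
- apply: (measurable_pint (vol R (n + m)) (F := fun y : mpt R k * mpt R (n + m) =>
    (Defs.indic U (join2 y.2 y.1) * u (K (lpart (join2 y.2 y.1)) p * (KU (join2 y.2 y.1) (emb q))^*))%:E)).
  apply: (measurableT_comp (measurable_int _ iP)).
  exact: measurable_join2.
- exact: measurable_int ir.
(* Almost every [w] has both an integrable pairing and a square-integrable slice; the fibre
   integrals are computed for these only. *)
have := ae_integrable_join2 (bergman_integrable oU bKq).
have := ae_integrable_join2 iP.
apply: (filterS2 (ae_filter_ringOfSetsType (vol R k))) => w i1 i2 _.
under eq_integral do rewrite lpart_join.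
have [w1|w1] := ltP (sqnorm w) 1; last first.
  rewrite phi0; last by rewrite subr_le0.
  rewrite integral0_eq // => z _; rewrite cindic0 ?mul0r //.
  by case/UE => _; rewrite ltNge w1.
rewrite phiE; last by rewrite subr_gt0 w1 lerBlDr lerDl sqnorm_ge0.
apply: fiber_integral => //; first exact: slice_bergman.
have := measurable_int _ i1; by under eq_fun do rewrite lpart_join.
Qed.
End Part.
End FiberFormula.

(** * Continuity along real curves and the dilation of iterated integrals *)

Section ContinuousCurves.
Variable R : realType.
Local Notation C := R[i].

Definition econt (G : R -> C) (x : R) : Prop :=
  forall e : R, 0 < e -> exists d : R, 0 < d /\ forall s, `|s - x| < d -> cabs (G s - G x) < e.

Lemma econt_ball M (F : R -> pt R M) x (e : R) : 0 < e -> (forall i, econt (fun s : R => F s i) x) ->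
  exists d : R, 0 < d /\ forall s, `|s - x| < d -> cball (F x) e (F s).
Proof.
move=> e0 cF.
have [d Hd] := boolp.choice (fun i => cF i e e0).
exists (\big[Num.min/1]_(i < M) d i); split.
  by elim/big_ind: _ => // [a b a0 b0|i _]; [rewrite lt_min a0|exact: (Hd i).1].
move=> s sx i; apply: (Hd i).2; apply: lt_le_trans sx _; exact: bigmin_le_cond.
Qed.

Lemma econt_comp M (f : pt R M -> C) (F : R -> pt R M) x : ccont f (F x) ->
  (forall i, econt (fun s : R => F s i) x) -> econt (fun s : R => f (F s)) x.
Proof.
move=> cf cF e /cf [d [d0 Hd]]; have [d' [d'0 H]] := econt_ball d0 cF.
by exists d'; split => // s /H /Hd.
Qed.

Lemma econt_cst c x : econt (fun=> c) x.
Proof. by move=> e e0; exists 1; split => // s _; rewrite subrr cabs0. Qed.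

Lemma econtM F G x : econt F x -> econt G x -> econt (fun s : R => F s * G s) x.
Proof.
move=> cF cG; have := @econt_comp 2 (fun q => q ord0 * q (lift ord0 ord0))
  (fun (s : R) i => if i == ord0 then F s else G s) x; apply.
  by apply: ccontM; exact: ccont_coord.
by move=> i; case: (boolP (i == ord0)) => _.
Qed.

Lemma econt_rc (f : R -> R) (x : R) : {for x, continuous f} -> econt (fun s : R => rc (f s)) x.
Proof.
move=> /cvgrPdist_lt cf e /cf /nbhs_ballP [d d0 Hd]; exists d; split => // s sx.
by rewrite -rcB cabs_rc distrC; apply: Hd; rewrite /ball /= distrC.
Qed.

Lemma econt_part (u : C -> R) G (x : R) : (forall z w, `|u z - u w| <= cabs (z - w)) ->
  econt G x -> {for x, continuous (fun s : R => u (G s))}.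
Proof.
move=> hu cG; apply/cvgrPdist_lt => e /cG [d [d0 H]]; apply/nbhs_ballP; exists d => // s.
rewrite /ball /= distrC => /H h; rewrite distrC; exact: le_lt_trans (hu _ _) h.
Qed.

(* [powR] extended by [0] to the negative axis and frozen after [T]. *)
Definition pw (T a v : R) : R := powR (Num.max 0 (Num.min T v)) a.

Lemma pwE T a v : 0 < v <= T -> pw T a v = powR v a.
Proof. by move=> /andP[v0 vT]; rewrite /pw (min_idPr vT) (max_idPr (ltW v0)). Qed.

Lemma pw0 T a v : 0 < a -> v <= 0 -> pw T a v = 0.
Proof.
move=> a0 v0; rewrite /pw (_ : Num.max 0 _ = 0) ?powR0 ?gt_eqF //.
by apply/max_idPl; rewrite ge_min v0 orbT.
Qed.

Lemma powR_cont (a x : R) : 0 < x -> {for x, continuous (fun v : R => powR v a)}.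
Proof.
move=> x0; have [dx _] := is_derive1_powR a x0.
by apply: differentiable_continuous; exact/derivable1_diffP.
Qed.

Lemma pos_powR_cont (a x : R) : 0 < a -> {for x, continuous (fun v : R => powR (Num.max 0 v) a)}.
Proof.
move=> a0; have [x0|x0|->] := ltgtP x 0.
- have E : powR (Num.max 0 x) a = 0 by rewrite (max_idPl (ltW x0)) powR0 ?gt_eqF.
  apply: cvg_near_cst; rewrite E; apply: filterS (lt_nbhsl x0) => v v0.
  by rewrite (max_idPl (ltW v0)) powR0 ?gt_eqF.
- have H : (fun v : R => powR v a) @ x --> powR (Num.max 0 x) a.
    by rewrite (max_idPr (ltW x0)); exact: powR_cont.
  apply: cvg_trans H; apply: near_eq_cvg.
  by apply: filterS (lt_nbhsr x0) => v v0; rewrite (max_idPr (ltW v0)).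
have Z : powR (Num.max 0 0) a = 0 by rewrite maxxx powR0 ?gt_eqF.
apply/cvgrPdist_lt => e e0; rewrite Z.
have d0 : 0 < powR e a^-1 by rewrite powR_gt0.
have S (v : R) : `|v| < powR e a^-1 -> powR (Num.max 0 v) a < e.
  move=> vd; have [v0|v0] := leP v 0; first by rewrite ?(max_idPl v0) powR0 ?gt_eqF.
  rewrite ?(max_idPr (ltW v0)); rewrite ger0_norm ?(ltW v0) // in vd.
  have -> : e = powR (powR e a^-1) a by rewrite -powRrM mulVf ?gt_eqF // powRr1 // ltW.
  by rewrite gt0_ltr_powR // nnegrE ltW.
apply/nbhs_ballP; exists (powR e a^-1) => // v; rewrite /ball /= !sub0r !normrN => vd.
by rewrite ger0_norm ?powR_ge0 //; exact: S.
Qed.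

Lemma pw_cont (T a x : R) : 0 < a -> {for x, continuous (pw T a)}.
Proof.
move=> a0; apply: (@continuous_comp R R R (fun v : R => Num.min T v) (fun v : R => powR (Num.max 0 v) a)).
  exact: (@continuous_min R R (fun=> T) id x (cvg_cst _) cvg_id).
exact: pos_powR_cont.
Qed.

Lemma iterintZ (c : R) (phi : R -> R) k t : (forall x : R, {for x, continuous phi}) ->
  (forall u, u <= 0 -> phi u = 0) -> iterint (fun v : R => c * phi v) k t = c * iterint phi k t.
Proof.
move=> cphi phi0; elim: k t => [|k IH] t //=.
have ck : contin (iterint phi k) (-1) t by move=> x _; exact: (iterint_cont cphi phi0).
rewrite mulrCA -(sintZ c ck).
by congr (_ * sint _ _ _); apply/funext => x; exact: IH.
Qed.

(** Both sides are integrals over C^k, related by the dilation w -> sqrt(t) w, of real Jacobian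
    t^k. *)
Lemma iterint_scale (phi : R -> R) k t : (forall x : R, {for x, continuous phi}) ->
  (forall u, u <= 0 -> phi u = 0) -> 0 < t ->
  iterint phi k t = t ^+ k * iterint (fun v : R => phi (t * v)) k 1.
Proof.
move=> cphi phi0 t0.
have cp x : {for x, continuous (fun v : R => phi (t * v))}.
  apply: (@continuous_comp R R R (fun v : R => t * v) phi); last exact: cphi.
  by apply: cvgM; [exact: cvg_cst|exact: cvg_id].
have p0 u : u <= 0 -> phi (t * u) = 0 by move=> u0; rewrite phi0 // pmulr_rle0.
have [i1 e1] := integral_radial k t cphi phi0.
have [i2 e2] := integral_radial k 1 cp p0.
apply: EFin_inj; rewrite EFinM -e1 -e2.
have s0 : rc (Num.sqrt t) != 0 by rewrite rc_eq0 sqrtr_eq0 -ltNge.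
rewrite (vol_diagE (c := fun=> rc (Num.sqrt t)) (fun=> s0) (measurable_int _ i1)).
rewrite -integralZl //; apply: eq_integral => w _.
rewrite muleC prodr_const card_ord cabs_rc ger0_norm ?sqrtr_ge0 // sqr_sqrtr ?(ltW t0) //.
congr (_ * (phi _)%:E)%E; rewrite mulrBr mulr1; congr (_ - _).
rewrite /sqnorm mulr_sumr; apply: eq_bigr => i _.
by rewrite cabsM exprMn cabs_rc ger0_norm ?sqrtr_ge0 // sqr_sqrtr ?(ltW t0).
Qed.
End ContinuousCurves.

(** * Recovering the kernel at w = eta = 0 from the kernel of the base *)

Section Reconstruction.
Variables (R : realType) (n m k : nat) (Om : set (pt R (n + m))) (alpha : 'I_n -> R).
Local Notation C := R[i].
Local Notation U := (U_alpha (k := k) Om alpha).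
Local Notation A := (\sum_(l < n) alpha l).
Variables (KU : pt R (n + m + k) -> pt R (n + m + k) -> C) (K : pt R (n + m) -> pt R (n + m) -> C).
Hypotheses (star : nstar_hartogs Om) (oOm : copen Om) (alpha_gt0 : forall j, 0 < alpha j).
Hypotheses (bKU : bergman_kernel U KU) (bK : bergman_kernel Om K) (A_gt0 : 0 < A).

Definition curve (p : pt R (n + m)) (t : R) : pt R (n + m) := sc (fun j => rc (powR t (alpha j))) p.
Local Notation g := (kernel0 (k := k) KU).

Lemma holomorphic_kernel0 q : Om q -> holomorphic_on Om (fun p => g p q).
Proof.
move=> Oq; have [[hKU _] _] := bKU ((U_emb k Om alpha q).2 Oq).
apply: (holomorphic_comp (V := U) (f := fun P => KU P (emb (k := k) q)) (F := fun x => emb (k := k) x)) => //.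
  by move=> x Ox; exact/U_emb.
move=> i; rewrite /emb; case: (split_ordP i) => j ->.
  rewrite (_ : (fun x => _) = fun x : pt R (n + m) => x j); first exact: holomorphic_coord.
  by apply/funext => x; rewrite join2_l.
rewrite (_ : (fun x => _) = fun=> 0); first exact: holomorphic_cst.
by apply/funext => x; rewrite join2_r.
Qed.

Section Clamped.
Variables (p q : pt R (n + m)) (T : R).
Hypotheses (T0 : 0 < T) (OT : Om (curve p T)) (Oq : Om q).

(** The iterated integrals ask for a function continuous on the whole line: freezing past [T] keeps
    the point in [Om], and the positive exponent [A] makes the prefactor vanish continuously for v
    <= 0. *)
Definition clamped (v : R) : C := rc (pw T A v) * g (sc (fun j => rc (pw T (alpha j) v)) p) q.

Lemma pw_Om v : Om (sc (fun j => rc (pw T (alpha j) v)) p).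
Proof.
rewrite (_ : sc _ p = sc (fun j => rc (pw T (alpha j) v / powR T (alpha j))) (curve p T)).
  apply: (star_sc star) OT => j; rewrite cabs_rc ger0_norm ?divr_ge0 ?powR_ge0 //.
  rewrite ler_pdivrMr ?powR_gt0 // mul1r /pw ge0_ler_powR ?nnegrE ?(ltW T0) ?(ltW (alpha_gt0 j)) //.
    by rewrite le_max lexx.
  by rewrite ge_max (ltW T0) ge_min lexx.
rewrite /curve scM; congr sc; apply/funext => j.
by rewrite -rcM divfK // gt_eqF // powR_gt0.
Qed.

Lemma curve_Om t : 0 < t <= T -> Om (curve p t).
Proof. by move=> tT; have := pw_Om t; congr (Om (sc _ p)); apply/funext => j; rewrite pwE. Qed.

Lemma clampedE v : 0 < v <= T -> clamped v = weighted alpha KU p q v.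
Proof.
move=> vT; rewrite /clamped /weighted pwE //; congr (_ * g (sc _ p) q).
by apply/funext => j; rewrite pwE.
Qed.

Lemma clamped_cont x : econt clamped x.
Proof.
apply: econtM; first exact/econt_rc/pw_cont.
apply: (econt_comp (f := fun p => g p q)).
  exact: (holomorphic_ccont (holomorphic_kernel0 Oq)) (pw_Om x).
move=> i; case: (split_ordP i) => j ->.
  rewrite (_ : (fun s : R => _) = fun s : R => rc (pw T (alpha j) s) * p (lshift m j)).
    by apply: econtM; [exact/econt_rc/pw_cont|exact: econt_cst].
  by apply/funext => s; rewrite /sc join2_l.
rewrite (_ : (fun s : R => _) = fun=> p (rshift n j)); first exact: econt_cst.
by apply/funext => s; rewrite /sc join2_r mul1r.
Qed.

Lemma clamped_Re_cont (x : R) : {for x, continuous (fun v : R => complex.Re (clamped v))}.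
Proof. by apply: econt_part (clamped_cont x) => z w; rewrite -cReB; exact: cRe_le. Qed.

Lemma clamped_Im_cont (x : R) : {for x, continuous (fun v : R => complex.Im (clamped v))}.
Proof. by apply: econt_part (clamped_cont x) => z w; rewrite -cImB; exact: cIm_le. Qed.

Lemma clamped0 v : v <= 0 -> clamped v = 0.
Proof. by move=> v0; rewrite /clamped pw0 // rc0 mul0r. Qed.

Lemma weighted_curve t v : 0 < t <= T -> 0 < v <= 1 ->
  weighted alpha KU (curve p t) q v = rc (powR t (- A)) * clamped (t * v).
Proof.
move=> /andP[t0 tT] /andP[v0 v1].
rewrite clampedE; last by rewrite mulr_gt0 //= (le_trans _ tT) // ler_piMr // ltW.
rewrite /weighted /curve scM (powRM A (ltW t0) (ltW v0)) rcM !mulrA -rcM -powRD; last first.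
  by apply/implyP => _; rewrite gt_eqF.
rewrite addNr powRr0 rc1 mul1r; congr (_ * g (sc _ p) q); apply/funext => j.
by rewrite -rcM (powRM _ (ltW t0) (ltW v0)) mulrC.
Qed.

Lemma kernel_curve t : 0 < t <= T -> rc (powR t (k%:R + A)) * K (curve p t) q =
  complex.Complex (iterint (fun v : R => complex.Re (clamped v)) k t) (iterint (fun v : R => complex.Im (clamped v)) k t).
Proof.
move=> tT; have /andP[t0 _] := tT; have Op := curve_Om tT.
(* The sign [s] records how [u] reacts to conjugation. It occurs twice, through hermitian symmetry
   of [K] and through the conjugate in [kernel_fiber], and cancels. *)
have H (u : C -> R) (s : R) : u = @complex.Re R \/ u = @complex.Im R -> (forall z, u z^* = s * u z) -> s * s = 1 ->
    powR t (k%:R + A) * u (K (curve p t) q) = iterint (fun v : R => u (clamped v)) k t.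
  move=> uP us ss.
  have cu (x : R) : {for x, continuous (fun v : R => u (clamped v))}.
    by case: uP => ->; [exact: clamped_Re_cont|exact: clamped_Im_cont].
  have u0 v : v <= 0 -> u (clamped v) = 0 by move=> /clamped0 ->; case: uP => ->.
  have cut (x : R) : {for x, continuous (fun v : R => u (clamped (t * v)))}.
    apply: (@continuous_comp R R R (fun v : R => t * v) (fun v : R => u (clamped v))); last exact: cu.
    by apply: cvgM; [exact: cvg_cst|exact: cvg_id].
  have ut0 v : v <= 0 -> u (clamped (t * v)) = 0 by move=> v0; rewrite u0 // pmulr_rle0.
  have := @kernel_fiber R n m k Om alpha KU K star oOm alpha_gt0 bKU bK u uP (curve p t) q Op Oq
     (fun v : R => (s * powR t (- A)) * u (clamped (t * v))).
  move=> /(_ _ _ _) E; rewrite (bergman_kernelJ oOm bK Op Oq) us E.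
  - rewrite iterintZ // (iterint_scale k cu u0 t0) powRD; last by apply/implyP => _; rewrite gt_eqF.
    rewrite powR_mulrn ?(ltW t0) //; set I := iterint _ _ _.
    have e : powR t A * powR t (- A) = 1.
      by rewrite -powRD ?subrr ?powRr0 //; apply/implyP => _; rewrite gt_eqF.
    transitivity (t ^+ k * ((s * s) * (powR t A * powR t (- A)) * I)); first by ring.
    by rewrite ss e !mul1r.
  - by move=> x; apply: cvgM; [exact: cvg_cst|exact: cut].
  - by move=> v v0; rewrite ut0 // mulr0.
  - by move=> v v1; rewrite weighted_curve // us uZ // mulrA.
apply: cplx_eq; rewrite ?(cReM, cImM) /= mul0r ?subr0 ?addr0.
  by apply: (H _ 1); [left|move=> z; rewrite cReJ mul1r|rewrite mulr1].
by apply: (H _ (-1)); [right|move=> z; rewrite cImJ mulN1r|rewrite mulrNN mulr1].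
Qed.
End Clamped.

Lemma curve1 p : curve p 1 = p.
Proof. by rewrite /curve -[RHS]sc1; congr sc; apply/funext => j; rewrite powR1. Qed.

(** Room beyond t = 1 makes the evaluation point interior to the curve, so that two-sided
    derivatives exist there. *)
Lemma curve_extends p : Om p -> exists T : R, 1 < T /\ Om (curve p T).
Proof.
move=> Op; have [d [d0 Hd]] := oOm Op.
have [|e [e0 H]] := @econt_ball R _ (curve p) 1 d d0.
  move=> i; case: (split_ordP i) => j ->.
    rewrite (_ : (fun s : R => _) = fun s : R => rc (powR s (alpha j)) * p (lshift m j)).
      by apply: econtM; [exact/econt_rc/powR_cont|exact: econt_cst].
    by apply/funext => s; rewrite /curve /sc join2_l.
  rewrite (_ : (fun s : R => _) = fun=> p (rshift n j)); first exact: econt_cst.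
  by apply/funext => s; rewrite /curve /sc join2_r mul1r.
exists (1 + e / 2); split; first by rewrite ltrDl divr_gt0.
apply: Hd; have := H (1 + e / 2); rewrite curve1; apply.
by rewrite addrAC subrr add0r gtr0_norm ?divr_gt0 //; lra.
Qed.

(** Diagonal factors commute with the curve t^alpha z, so the operator may act on [K] composed with
    a diagonal map; this is the form in which the kernel of U_eta composed with h appears. *)
Lemma Prodop_kernel (c : 'I_n -> C) (z : pt R n) (z' : pt R m) q (a : R) :
  Om (join2 (fun j => c j * z j) z') -> Om q ->
  Prodop alpha k (fun x => rc a * K (join2 (fun j => c j * x j) z') q) z =
  rc (a * pi ^+ k) * g (join2 (fun j => c j * z j) z') q.
Proof.
move=> Op Oq; set P := join2 _ _ in Op *; have [T [T1 OT]] := curve_extends Op.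
have T0 : 0 < T by lra.
pose F (x : pt R n) := join2 (fun j => c j * x j) z' : pt R (n + m).
pose V := [set x : pt R n | Om (F x)].
have hF (O : set (pt R n)) i : holomorphic_on O (fun x => F x i).
  rewrite /F; case: (split_ordP i) => j ->.
    rewrite (_ : (fun x => _) = fun x : pt R n => c j * x j).
      by apply: holomorphicM; [exact: holomorphic_cst|exact: holomorphic_coord].
    by apply/funext => x; rewrite join2_l.
  rewrite (_ : (fun x => _) = fun=> z' j); first exact: holomorphic_cst.
  by apply/funext => x; rewrite join2_r.
have oT : copen (setT : set (pt R n)) by move=> x _; exists 1.
have oV : copen V.
  rewrite (_ : V = setT `&` [set x | Om (F x)]); last by rewrite setTI.
  by apply: copen_preimage => // x _ i; exact: (holomorphic_ccont (hF setT i)).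
have FE t : F (fun j => rc (powR t (alpha j)) * z j) = curve P t.
  by rewrite /F /curve sc_join; congr join2; apply/funext => j; rewrite mulrCA.
have tle t : 0 < t < T -> 0 < t <= T by case/andP => -> /ltW ->.
have czV t : 0 < t < T -> V (fun j => rc (powR t (alpha j)) * z j).
  by move=> /tle tT; rewrite /V /= FE; exact: curve_Om tT.
have hG : holomorphic_on V (fun x => rc a * K (F x) q).
  apply: holomorphicM; first exact: holomorphic_cst.
  have [[hK _] _] := bK Oq.
  exact: (holomorphic_comp (V := Om) (f := fun x => K x q) _ (hF V) hK).
have H t : 0 < t < T -> rc (powR t (k%:R + A)) * (rc a * K (F (fun j => rc (powR t (alpha j)) * z j)) q) =
    rc a * complex.Complex (iterint (fun v : R => complex.Re (clamped P q T v)) k t)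
      (iterint (fun v : R => complex.Im (clamped P q T v)) k t).
  by move=> /tle tT; rewrite FE mulrCA (kernel_curve T0 OT Oq tT).
have z1 : (fun j => rc (powR 1 (alpha j)) * z j) = z.
  by apply/funext => j; rewrite powR1 mul1r.
have tT1 : 0 < (1 : R) < T by apply/andP; split; lra.
have c0 v : v <= 0 -> clamped P q T v = 0 by exact: clamped0.
have := Prodop_curve oV czV (clamped_Re_cont T0 OT Oq) _ (clamped_Im_cont T0 OT Oq) _ hG H tT1.
cbv beta; rewrite z1 powR1 rc1 mul1r => /(_ _ _) ->; first last.
- by move=> v /c0 ->.
- by move=> v /c0 ->.
have cE (x : C) : complex.Complex (complex.Re x) (complex.Im x) = x by case: x.
rewrite cE clampedE ?tle // /weighted powR1 mul1r; congr (_ * g _ q).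
exact: sc1.
Qed.
End Reconstruction.

(** * Moebius invariance *)

Section MobiusKernel.
Variables (R : realType) (N : nat) (j : 'I_N) (a : R[i]) (ex : 'I_N -> R).
Local Notation C := R[i].
Hypotheses (a0 : a != 0) (a1 : cabs a < 1) (exj : ex j = 0).

Definition mobs : R := Num.sqrt (1 - cabs a ^+ 2).

Lemma mobs_gt0 : 0 < mobs.
Proof. by rewrite sqrtr_gt0 subr_gt0 expr_lt1 // cabs_ge0. Qed.

Lemma mobs_sqr : mobs ^+ 2 = 1 - cabs a ^+ 2.
Proof. by rewrite sqr_sqrtr // subr_ge0 expr_le1 ?cabs_ge0 // ltW. Qed.

(* Truncated outside the unit disc, so as to have a nonzero value everywhere. *)
Definition mobD (w : C) : C := if cabs w < 1 then rc mobs / (1 - a^* * w) else 1.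

Lemma mob_re w : cabs w < 1 -> 0 < complex.Re (1 - a^* * w).
Proof. by move=> w1; apply: re_1Bmul_gt0; rewrite ?cabsJ. Qed.

Lemma re_rc_div (c : R) (z : C) : 0 < c -> 0 < complex.Re z -> 0 < complex.Re (rc c / z).
Proof.
move=> c0 z0; rewrite cReM /= mul0r subr0 mulr_gt0 // cReV divr_gt0 // exprn_gt0 //.
by rewrite cabs_gt0 re_gt0_neq0.
Qed.

Lemma mobD_re w : 0 < complex.Re (mobD w).
Proof. by rewrite /mobD; case: ifP => w1; [exact: re_rc_div mobs_gt0 (mob_re w1)|rewrite /= ltr01]. Qed.

Lemma cabs_mobD w : cabs w < 1 -> cabs (mobD w) = mobs / cabs (1 - a^* * w).
Proof. by move=> w1; rewrite /mobD w1 cabsM cabsV cabs_rc gtr0_norm ?mobs_gt0. Qed.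

Lemma mob_lt1 w : cabs w < 1 -> cabs (mob a w) < 1.
Proof.
move=> w1; have d0 : 0 < cabs (1 - a^* * w) by rewrite cabs_gt0 re_gt0_neq0 // mob_re.
rewrite cabsM cabsV ltr_pdivrMr // mul1r -(@ltr_pXn2r _ 2) ?nnegrE ?cabs_ge0 // -subr_gt0 mob_modulus.
by apply: mulr_gt0; rewrite subr_gt0 expr_lt1 ?cabs_ge0.
Qed.

Lemma one_sub_mob w : cabs w < 1 -> 1 - a^* * mob a w = rc (mobs ^+ 2) / (1 - a^* * w).
Proof.
move=> w1; have d0 : 1 - a^* * w != 0 by rewrite re_gt0_neq0 // mob_re.
by rewrite mobs_sqr rcB rc1 -mulJc /mob; field.
Qed.

(** This cocycle relation makes [mobius] an involution, hence its own inverse in the kernel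
    transformation. *)
Lemma mobD_mob w : cabs w < 1 -> mobD (mob a w) = (mobD w)^-1.
Proof.
move=> w1; have d0 : 1 - a^* * w != 0 by rewrite re_gt0_neq0 // mob_re.
have s0 : rc mobs != 0 by rewrite rc_eq0 gt_eqF // mobs_gt0.
by rewrite /mobD mob_lt1 // w1 one_sub_mob // rcX; field; rewrite d0 s0.
Qed.

Lemma mobK w : cabs w < 1 -> mob a (mob a w) = w.
Proof.
move=> w1; have d0 : 1 - a^* * w != 0 by rewrite re_gt0_neq0 // mob_re.
have s0 : rc (mobs ^+ 2) != 0 by rewrite rc_eq0 gt_eqF // exprn_gt0 // mobs_gt0.
rewrite {1}/mob one_sub_mob // invf_div.
rewrite (_ : a - mob a w = rc (mobs ^+ 2) * w / (1 - a^* * w)); first by field; rewrite d0 s0.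
by rewrite mobs_sqr rcB rc1 -mulJc /mob; field.
Qed.

Definition mobius (p : pt R N) : pt R N :=
  fun i => if i == j then mob a (p j) else cpow (mobD (p j)) (ex i) * p i.

(** The complex Jacobian determinant up to sign: [mob a] has derivative minus the square of [mobD],
    and the coordinate [i] contributes the power [ex i]. The sign cancels between the two arguments
    of the kernel. *)
Definition mobius_jac (p : pt R N) : C := cpow (mobD (p j)) (2 + \sum_i ex i).

Lemma mobius_j p : mobius p j = mob a (p j).
Proof. by rewrite /mobius eqxx. Qed.

Lemma cpow_mobD_mob w e : cabs w < 1 -> cpow (mobD (mob a w)) e = (cpow (mobD w) e)^-1.
Proof. by move=> w1; rewrite mobD_mob // cpowV // mobD_re. Qed.

Lemma cpow_mobD_neq0 w e : cpow (mobD w) e != 0.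
Proof. by rewrite cpow_neq0 // re_gt0_neq0 // mobD_re. Qed.

Lemma mobiusK p : cabs (p j) < 1 -> mobius (mobius p) = p.
Proof.
move=> p1; apply/funext => i; rewrite {1}/mobius mobius_j; case: eqP => [->|/eqP ij]; first exact: mobK.
by rewrite cpow_mobD_mob // /mobius (negbTE ij) mulKf // cpow_mobD_neq0.
Qed.

Section Domain.
Variables (O : set (pt R N)).
Hypotheses (oO : copen O) (O1 : forall p, O p -> cabs (p j) < 1).

Lemma holomorphic_cpow_mobD e : holomorphic_on O (fun p => cpow (mobD (p j)) e).
Proof.
apply: (holomorphic_ext (f := fun p => cpow (rc mobs * (1 - a^* * p j)^-1) e) oO).
  by move=> p Op; rewrite /mobD O1.
apply: (holomorphic_comp1 (f := fun w => cpow (rc mobs * (1 - a^* * w)^-1) e) (F := fun p => p j)).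
  exact: holomorphic_coord.
move=> p /O1 p1; have re0 := re_rc_div mobs_gt0 (mob_re p1).
have d0 : 1 - a^* * p j != 0 by rewrite re_gt0_neq0 // mob_re.
have [b db] := cdiff1_cpow e re0.
have d1 : cdiff1 (fun w => 1 - a^* * w) (p j) (0 - (0 * p j + a^* * 1)).
  apply: cdiff1D; first exact: cdiff1_cst.
  by apply: cdiff1N; apply: cdiff1M; [exact: cdiff1_cst|exact: cdiff1_id].
have d2 := cdiff1_comp (f := GRing.inv) (g := fun w => 1 - a^* * w) (cdiff1V d0) d1.
have d3 := cdiff1M (cdiff1_cst (rc mobs) (p j)) d2.
eexists; exact: (cdiff1_comp (f := fun z => cpow z e) (g := fun w => rc mobs * (1 - a^* * w)^-1) db d3).
Qed.

Lemma holomorphic_mobius i : holomorphic_on O (fun p => mobius p i).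
Proof.
rewrite /mobius; case: (boolP (i == j)) => ij; last first.
  by apply: holomorphicM; [exact: holomorphic_cpow_mobD|exact: holomorphic_coord].
apply: (holomorphic_comp1 (f := mob a) (F := fun p => p j)); first exact: holomorphic_coord.
move=> p /O1 p1; have d0 : 1 - a^* * p j != 0 by rewrite re_gt0_neq0 // mob_re.
have d1 : cdiff1 (fun w => 1 - a^* * w) (p j) (0 - (0 * p j + a^* * 1)).
  apply: cdiff1D; first exact: cdiff1_cst.
  by apply: cdiff1N; apply: cdiff1M; [exact: cdiff1_cst|exact: cdiff1_id].
have d2 := cdiff1_comp (f := GRing.inv) (g := fun w => 1 - a^* * w) (cdiff1V d0) d1.
eexists; apply: cdiff1M; last exact: d2.
by apply: cdiff1D; [exact: cdiff1_cst|apply: cdiff1N; exact: cdiff1_id].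
Qed.
End Domain.

Let B : set (pt R N) := [set p | cabs (p j) < 1].

Let oB : copen B.
Proof.
move=> p Bp; exists (1 - cabs (p j)); split; first by rewrite subr_gt0.
by move=> q /(_ j) h; have := cabsBl (q j) (p j); rewrite /B /=; lra.
Qed.

Lemma measurable_cpow_mobD e :
  measurable_fun [set: mpt R N] (fun p : mpt R N => complex.Re (cpow (mobD (p j)) e) : measurableTypeR R) /\
  measurable_fun [set: mpt R N] (fun p : mpt R N => complex.Im (cpow (mobD (p j)) e) : measurableTypeR R).
Proof.
have hf := holomorphic_ccont (@holomorphic_cpow_mobD B oB (fun p h => h) e).
have E (u : C -> R) : (fun p : mpt R N => u (cpow (mobD (p j)) e)) =
    (fun p => Defs.indic B p * u (cpow (mobD (p j)) e) + (1 - Defs.indic B p) * u (cpow 1 e)).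
  apply/funext => p; have [Bp|Bp] := pselect (B p).
    by rewrite cindic1 // mul1r subrr mul0r addr0.
  by rewrite cindic0 // mul0r add0r subr0 mul1r /mobD; case: ifP Bp => // h []; exact: h.
have mi : measurable_fun [set: mpt R N] (fun p : mpt R N => 1 - Defs.indic B p : measurableTypeR R).
  by apply: measurable_funB => //; exact: measurable_cindic.
by split; rewrite E; apply: measurable_funD; [exact: measurable_Re_on|exact: measurable_funM|
  exact: measurable_Im_on|exact: measurable_funM].
Qed.

Lemma measurable_mobius : measurable_fun [set: mpt R N] (mobius : mpt R N -> mpt R N).
Proof.
have H i : measurable_fun [set: mpt R N] (fun p : mpt R N => complex.Re (mobius p i) : measurableTypeR R) /\
    measurable_fun [set: mpt R N] (fun p : mpt R N => complex.Im (mobius p i) : measurableTypeR R).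
  rewrite /mobius; case: (boolP (i == j)) => ij; last first.
    have [h1 h2] := measurable_cpow_mobD (ex i).
    by apply: measurable_cM => //; [exact: measurable_coord_Re|exact: measurable_coord_Im].
  have [h1 h2] : measurable_fun [set: mpt R N] (fun p : mpt R N => complex.Re (1 - a^* * p j) : measurableTypeR R) /\
      measurable_fun [set: mpt R N] (fun p : mpt R N => complex.Im (1 - a^* * p j) : measurableTypeR R).
    have [h1 h2] := measurable_cM (f := fun=> a^*) (g := fun p : mpt R N => p j) (@measurable_cst _ _ _ _ _ _)
      (@measurable_cst _ _ _ _ _ _) (measurable_coord_Re j) (measurable_coord_Im j).
    split; [under eq_fun do rewrite cReB|under eq_fun do rewrite cImB]; exact: measurable_funB.
  have [h3 h4] := measurable_cV h1 h2.
  apply: (measurable_cM (f := fun p : mpt R N => a - p j) (g := fun p : mpt R N => (1 - a^* * p j)^-1)) => //.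
    under eq_fun do rewrite cReB; apply: measurable_funB => //; exact: measurable_coord_Re.
  under eq_fun do rewrite cImB; apply: measurable_funB => //; exact: measurable_coord_Im.
by apply: measurable_to_mpt => i; [exact: (H i).1|exact: (H i).2].
Qed.

Lemma mobius_jac_sqr p : cabs (p j) < 1 -> cabs (mobius_jac p) ^+ 2 =
  (1 - cabs a ^+ 2) ^+ 2 / cabs (1 - a^* * p j) ^+ 4 * \prod_(i < N) cabs (cpow (mobD (p j)) (ex i)) ^+ 2.
Proof.
move=> p1; have d0 : 0 < cabs (mobD (p j)) by rewrite cabs_gt0 re_gt0_neq0 // mobD_re.
have nz : cabs (mobD (p j)) != 0 by rewrite gt_eqF.
rewrite -mobs_sqr (_ : _ / _ = cabs (mobD (p j)) ^+ 4); last by rewrite cabs_mobD // expr_div_n -exprM.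
rewrite /mobius_jac cabs_cpow powRD ?nz ?implybT // exprMn; congr (_ * _).
  by rewrite powR_mulrn ?cabs_ge0 // -exprM.
rewrite prodrXl; congr (_ ^+ 2); elim/big_rec2: _ => [|i x y _ IH]; first by rewrite powRr0.
by rewrite powRD ?nz ?implybT // IH cabs_cpow.
Qed.

Theorem kernel_mobius (O : set (pt R N)) K P Q : copen O -> (forall p, O p -> cabs (p j) < 1) ->
  (forall p, O p -> O (mobius p)) -> bergman_kernel O K -> O P -> O Q ->
  K P Q = K (mobius P) (mobius Q) * mobius_jac P * (mobius_jac Q)^*.
Proof.
move=> oO O1 Oinv bK OP OQ.
have pull f : holomorphic_on O f -> holomorphic_on O (fun p => mobius_jac p * f (mobius p)).
  move=> hf; apply: holomorphicM; first exact: holomorphic_cpow_mobD.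
  exact: holomorphic_comp Oinv (holomorphic_mobius oO O1) hf.
apply: (@kernel_transform R N O O mobius mobius mobius_jac oO oO Oinv _ _ pull _ _ K K P Q bK bK OP OQ).
- by move=> p /O1 /mobiusK.
- by move=> p _; exact: cpow_mobD_neq0.
- move=> f /pull; apply: (holomorphic_ext oO) => p Op.
  by rewrite {2}/mobius_jac mobius_j cpow_mobD_mob ?O1 // invrK.
move=> F mF F0 Fz.
have mJ : measurable_fun [set: mpt R N] (fun p : mpt R N => cabs (mobius_jac p) ^+ 2 : measurableTypeR R).
  have [h1 h2] := measurable_cpow_mobD (2 + \sum_i ex i).
  under eq_fun do rewrite cabs_sqr; apply: measurable_funD; exact: measurable_funX.
(* The substitution holds on the whole cylinder |p_j| < 1; points outside [O] contribute nothing
   because the involution preserves [O]. *)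
rewrite (@vol_mobius R N j a (fun i w => cpow (mobD w) (ex i)) mobius (fun p => cabs (mobius_jac p) ^+ 2) F
  a0 a1 (fun i w _ => cpow_mobD_neq0 w (ex i)) _ measurable_mobius mJ mobius_j _ _ mobius_jac_sqr mF F0).
- apply: eq_integral => p _; case: asboolP => Op; first by rewrite O1.
  case: (boolP (cabs (p j) < 1)) => // p1; rewrite Fz ?mul0e // => h; apply: Op.
  by rewrite -(mobiusK p1); exact: Oinv.
- by move=> w; rewrite exj cpow0 // re_gt0_neq0 // mobD_re.
- by move=> p i ij; rewrite /mobius (negbTE ij).
- by move=> p; exact: sqr_ge0.
- by move=> p /negP p1; apply: Fz => /O1.
Qed.
End MobiusKernel.

(** * The kernel formula *)

Section FullKernel.
Variables (R : realType) (n m k : nat) (Om : set (pt R (n + m))) (alpha : 'I_n -> R).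
Local Notation C := R[i].
Local Notation U := (U_alpha (k := k) Om alpha).
Local Notation A := (\sum_(l < n) alpha l).
Variables (KU : pt R (n + m + k) -> pt R (n + m + k) -> C).
Hypotheses (star : nstar_hartogs Om) (oOm : copen Om) (alpha_gt0 : forall j, 0 < alpha j).
Hypotheses (bKU : bergman_kernel U KU).
Local Notation g := (kernel0 (k := k) KU).

Let UE p w : U (join2 p w) <-> Om (sc (radf alpha (-1) w) p) /\ sqnorm w < 1 := U_alphaE Om alpha p w.
Let oU : copen U := @copenU R n m k Om alpha oOm.

Lemma cpow1 (z : C) : 0 < complex.Re z -> cpow z 1 = z.
Proof. by move=> z0; rewrite /cpow mul1r powRr1 ?cabs_ge0 // -cpolar. Qed.

Lemma cpow_one (e : R) : cpow (1 : C) e = 1.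
Proof. by rewrite -rc1 cpow_rc // powR1. Qed.

Lemma sqnorm_coord (w : pt R k) i : cabs (w i) ^+ 2 <= sqnorm w.
Proof. by rewrite /sqnorm (bigD1 i) //= lerDl sumr_ge0 // => j _; exact: sqr_ge0. Qed.

Lemma cabs_coord_lt1 (w : pt R k) i : sqnorm w < 1 -> cabs (w i) < 1.
Proof.
move=> w1; rewrite -(@ltr_pXn2r _ 2) ?nnegrE ?cabs_ge0 // expr1n.
exact: le_lt_trans (sqnorm_coord w i) w1.
Qed.

Lemma herm_re (w eta : pt R k) : sqnorm w < 1 -> sqnorm eta < 1 -> 0 < complex.Re (1 - herm w eta).
Proof.
move=> w1 e1; rewrite cReB /= subr_gt0; apply: le_lt_trans (ler_norm _) _.
apply: le_lt_trans (cRe_le _) _; apply: le_lt_trans (cabs_sum _ _ _) _.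
apply: (@le_lt_trans _ _ ((sqnorm w + sqnorm eta) / 2)); last by lra.
rewrite /sqnorm -big_split mulr_suml; apply: ler_sum => i _ /=.
rewrite cabsM cabsJ; have := sqr_ge0 (cabs (w i) - cabs (eta i)).
by set x := cabs _; set y := cabs _; nra.
Qed.

Section Step.
Variables (i : 'I_k) (a : C).
Hypotheses (a0 : a != 0) (a1 : cabs a < 1).

Let j : 'I_(n + m + k) := rshift (n + m) i.
(** Exponent 1 on the other [w] coordinates completes the disc map to a ball automorphism; alpha on
    z compensates its effect on 1 - |w|^2, and z' is left alone. The coordinate [i] itself is moved
    by [mob]. *)
Let ex (l : 'I_(n + m + k)) : R :=
  match fintype.split l with
  | inl l1 => match fintype.split l1 with inl l0 => alpha l0 | inr _ => 0 end
  | inr i' => if i' == i then 0 else 1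
  end.

Let splitl b c (x : 'I_b) : fintype.split (lshift c x) = inl x := unsplitK (inl x).
Let splitr b c (x : 'I_c) : fintype.split (rshift b x) = inr x := unsplitK (inr x).

Let exj : ex j = 0.
Proof. by rewrite /ex splitr eqxx. Qed.

Let sum_ex : 2 + \sum_l ex l = k.+1%:R + A.
Proof.
rewrite big_split_ord /= big_split_ord /=.
rewrite (eq_bigr alpha); last by move=> l _; rewrite /ex !splitl.
rewrite [X in _ + X + _]big1 ?addr0; last by move=> l _; rewrite /ex splitl splitr.
rewrite (eq_bigr (fun l => if l == i then 0 else 1)); last by move=> l _; rewrite /ex splitr.
rewrite (bigD1 i) //= eqxx add0r (eq_bigr (P := fun l : 'I_k => l != i) (fun=> 1)); last by move=> l li; rewrite (negbTE li).
rewrite sumr_const cardC1 card_ord.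
by case: (k) i => [[]//|k' _]; rewrite /= -!natr1; ring.
Qed.

(** The involution of the unit ball that exchanges 0 and the point with i-th coordinate [a] and all
    others zero. *)
Definition mobw (w : pt R k) : pt R k := fun l => if l == i then mob a (w i) else mobD a (w i) * w l.

Lemma mobius_join p w : mobius j a ex (join2 p w) =
  join2 (sc (fun l => cpow (mobD a (w i)) (alpha l)) p) (mobw w).
Proof.
have z0 : mobD a (w i) != 0 by rewrite re_gt0_neq0 // mobD_re.
apply/funext => l; rewrite /mobius join2_r; case: (split_ordP l) => l1 ->; last first.
  rewrite eq_rshift !join2_r /mobw /ex splitr; case: (l1 == i) => //.
  by rewrite cpow1 // mobD_re.
rewrite eq_lrshift !join2_l /ex splitl /sc; case: (split_ordP l1) => l2 ->.
  by rewrite ?splitl join2_l.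
by rewrite ?splitr join2_r cpow0.
Qed.

Lemma sqnorm_mobw w : sqnorm w < 1 -> 1 - sqnorm (mobw w) = cabs (mobD a (w i)) ^+ 2 * (1 - sqnorm w).
Proof.
move=> w1; have wi := cabs_coord_lt1 i w1; have d0 : cabs (1 - a^* * w i) != 0.
  by rewrite gt_eqF // cabs_gt0 re_gt0_neq0 // mob_re.
rewrite /sqnorm (bigD1 i) //= [in RHS](bigD1 i) //= {1}/mobw eqxx.
rewrite (eq_bigr (fun l => cabs (mobD a (w i)) ^+ 2 * cabs (w l) ^+ 2)); last first.
  by move=> l /negbTE li; rewrite /mobw li cabsM exprMn.
rewrite -mulr_sumr; set S := \sum_(l | _) _.
have E : 1 - cabs (mob a (w i)) ^+ 2 = cabs (mobD a (w i)) ^+ 2 * (1 - cabs (w i) ^+ 2).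
  rewrite cabs_mobD // expr_div_n mobs_sqr // mulrAC -mob_modulus /mob cabsM cabsV exprMn exprVn.
  by field; rewrite d0.
by rewrite opprD addrA E; ring.
Qed.

Lemma mobw_lt1 w : sqnorm w < 1 -> sqnorm (mobw w) < 1.
Proof.
move=> w1; rewrite -subr_gt0 sqnorm_mobw // mulr_gt0 ?subr_gt0 // exprn_gt0 //.
by rewrite cabs_gt0 re_gt0_neq0 // mobD_re.
Qed.

Lemma radf_mobw s w l : sqnorm w < 1 ->
  radf alpha s (mobw w) l = rc (powR (cabs (mobD a (w i))) (s * alpha l)) * radf alpha s w l.
Proof.
move=> w1; rewrite /radf sqnorm_mobw // powRM ?sqr_ge0 ?subr_ge0 ?(ltW w1) // rcM; congr (rc _ * _).
rewrite -powR_mulrn ?cabs_ge0 // -powRrM; by congr powR; field.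
Qed.

(** The factor [cpow (mobD a (w i)) (alpha l)] has exactly the modulus by which the radial factor
    changes; the scaled point in [Om] is multiplied by unimodular numbers. *)
Lemma U_mobius P : U P -> U (mobius j a ex P).
Proof.
rewrite -[P]join_parts mobius_join; set p := lpart P; set w := rpart P => /UE [Op w1].
apply/UE; split; last exact: mobw_lt1.
have d0 : mobD a (w i) != 0 by rewrite re_gt0_neq0 // mobD_re.
have c0 : 0 < cabs (mobD a (w i)) by rewrite cabs_gt0.
rewrite scM (_ : sc _ p = sc (fun l => rc (powR (cabs (mobD a (w i))) (-1 * alpha l)) * cpow (mobD a (w i)) (alpha l))
  (sc (radf alpha (-1) w) p)).
  apply: (star_sc star) Op => l; rewrite cabsM cabs_rc ger0_norm ?powR_ge0 // cabs_cpow.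
  rewrite -powRD; last by rewrite (gt_eqF c0) implybT.
  by rewrite mulN1r addNr powRr0.
by rewrite scM; congr sc; apply/funext => l; rewrite radf_mobw // mulrAC.
Qed.

Lemma U_disc P : U P -> cabs (P j) < 1.
Proof. by rewrite -[P]join_parts => /UE [_ w1]; rewrite join2_r; exact: cabs_coord_lt1. Qed.

Lemma kernel_mobius_U p w q eta : U (join2 p w) -> U (join2 q eta) ->
  KU (join2 p w) (join2 q eta) =
  KU (join2 (sc (fun l => cpow (mobD a (w i)) (alpha l)) p) (mobw w))
     (join2 (sc (fun l => cpow (mobD a (eta i)) (alpha l)) q) (mobw eta))
  * cpow (mobD a (w i)) (k.+1%:R + A) * (cpow (mobD a (eta i)) (k.+1%:R + A))^*.
Proof.
move=> UP UQ; rewrite (kernel_mobius a0 a1 exj oU U_disc U_mobius bKU UP UQ).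
by rewrite !mobius_join /mobius_jac sum_ex !join2_r.
Qed.

Lemma herm_mobw w eta : eta i = a -> sqnorm w < 1 ->
  1 - herm (mobw w) (mobw eta) = (1 - herm w eta) / (1 - a^* * w i).
Proof.
move=> ea w1; have wi := cabs_coord_lt1 i w1.
have d0 : 1 - a^* * w i != 0 by rewrite re_gt0_neq0 // mob_re.
have s0 : rc (mobs a) != 0 by rewrite rc_eq0 gt_eqF // mobs_gt0.
have Da : mobD a a = (rc (mobs a))^-1.
  rewrite /mobD a1 mulJc -rc1 -rcB -mobs_sqr // rcX; field; exact: s0.
rewrite /herm (bigD1 i) //= [in RHS](bigD1 i) //= {1 2}/mobw eqxx ea {2}/mob subrr mul0r conjC0 mulr0 add0r.
rewrite (eq_bigr (fun l => (1 - a^* * w i)^-1 * (w l * (eta l)^*))); last first.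
  move=> l /negbTE li; rewrite /mobw li ea Da rmorphM fmorphV /= rcJ /mobD wi.
  by field; rewrite d0 s0.
rewrite -mulr_sumr; set S := \sum_(l | _) _; field; exact: d0.
Qed.
End Step.

(** The multiplier of [h_map] followed by the scaling [radf alpha (-1) eta] that carries U_eta to
    [Om]. *)
Definition shear (w eta : pt R k) : 'I_n -> C := fun l => radf alpha 1 eta l * cpow (1 - herm w eta) (- alpha l).

(* The Moebius map centred at a nonzero coordinate of [eta] kills that coordinate. *)
Lemma kernel_full p w q eta : U (join2 p w) -> U (join2 q eta) ->
  Om (sc (shear w eta) p) /\
  KU (join2 p w) (join2 q eta) = cpow (1 - herm w eta) (- (k.+1%:R + A)) *
    g (sc (shear w eta) p) (sc (radf alpha (-1) eta) q).
Proof.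
have [N] := ubnP #|[pred l | eta l != 0]|; elim: N p w q eta => // N IH p w q eta cN UP UQ.
have [Op w1] := (UE _ _).1 UP; have [Oq e1] := (UE _ _).1 UQ.
have [i /= ei|e0] := pickP [pred l | eta l != 0]; last first.
  have {}e0 : eta = fun=> 0 by apply/funext => l; have /eqP := negbFE (e0 l).
  have h0 : herm w eta = 0 by rewrite /herm big1 // => l _; rewrite e0 conjC0 mulr0.
  have r1 s : radf alpha s eta = fun=> 1 :> C.
    by apply/funext => l; rewrite /radf e0 sqnorm0 subr0 powR1.
  have sh : shear w eta = fun=> 1 by apply/funext => l; rewrite /shear h0 r1 subr0 cpow_one mulr1.
  rewrite h0 sh r1 !sc1 subr0 cpow_one mul1r; split; first exact: (U_base star alpha_gt0 UP).
  move: UQ; rewrite e0 => UQ; apply: (kernel_fiber0 star oOm alpha_gt0 bKU UP).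
  exact: (U_base star alpha_gt0 UQ).
set a := eta i in ei; have a1 : cabs a < 1 by exact: cabs_coord_lt1.
have UP' := U_mobius i a1 UP; have UQ' := U_mobius i a1 UQ.
rewrite !mobius_join // in UP' UQ'.
(* Zero coordinates of [eta] are only multiplied and stay zero, while coordinate [i] becomes zero,
   so the count drops. *)
have card' : (#|[pred l | mobw i a eta l != 0%R]| < N)%N.
  apply: leq_trans (_ : #|[pred l | eta l != 0%R]| <= N)%N; last by rewrite -ltnS.
  apply: proper_card; apply/properP; split.
    apply/fintype.subsetP => l; rewrite !inE /mobw; case: (boolP (l == i)) => [/eqP -> _ //|_].
    by rewrite mulf_eq0 negb_or => /andP[].
  by exists i; rewrite !inE // /mobw eqxx /mob subrr mul0r eqxx.
have [IO IE] := IH _ _ _ _ card' UP' UQ'.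
have wi := cabs_coord_lt1 i w1.
set Y := 1 - a^* * w i; have Y0 : 0 < complex.Re Y by exact: mob_re.
set X := 1 - herm w eta; have X0 : 0 < complex.Re X by exact: herm_re.
have HXY : 1 - herm (mobw i a w) (mobw i a eta) = X / Y by exact: herm_mobw.
have XY0 : 0 < complex.Re (X / Y) by rewrite -HXY; apply: herm_re; exact: mobw_lt1.
have s0 := mobs_gt0 a1.
have Dw : mobD a (w i) = rc (mobs a) * Y^-1 by rewrite /mobD wi.
have De : mobD a a = rc (mobs a)^-1.
  rewrite /mobD a1 mulJc -rc1 -rcB -mobs_sqr // -rcV -rcM; congr rc; field; exact/lt0r_neq0.
have si0 : 0 < (mobs a)^-1 by rewrite invr_gt0.
have cD e : cpow (mobD a (w i)) e = rc (powR (mobs a) e) * cpow Y (- e).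
  have Yn : 0 < complex.Re Y^-1.
    by rewrite cReV divr_gt0 // exprn_gt0 // cabs_gt0 re_gt0_neq0.
  have h1 : 0 < complex.Re (rc 1 : C) by rewrite /= ltr01.
  have := @cpow_mul2 R Y^-1 (rc 1) (mobD a (w i)) (mobs a)^-1 e Yn h1 (mobD_re a1 (w i)) si0.
  rewrite rc1 cpow_one !mulr1 Dw mulrA -rcM mulVf ?gt_eqF // rc1 mul1r => /(_ erefl).
  rewrite cpowV // => E; rewrite [cpow Y (- e)](_ : _ = (cpow Y e)^-1); last first.
    by apply: (mulfI (cpow_neq0 e (re_gt0_neq0 Y0))); rewrite -cpowD ?re_gt0_neq0 // subrr cpow0 ?re_gt0_neq0 // divff // cpow_neq0 ?re_gt0_neq0.
  rewrite E mulrA -rcM -powRM ?(ltW s0) ?(ltW si0) // divff ?gt_eqF //.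
  by rewrite powR1 rc1 mul1r.
(* All three of X / Y, Y and X lie in the right half plane, so their principal powers multiply. *)
have cX e : cpow (X / Y) e * cpow Y e = cpow X e.
  have E1 : X / Y * Y = rc 1 * X by rewrite rc1 mul1r divfK // re_gt0_neq0.
  by rewrite (cpow_mul2 e XY0 Y0 X0 ltr01 E1) powR1 rc1 mul1r.
have cDe e : cpow (mobD a (eta i)) e = rc (powR (mobs a) (- e)).
  by rewrite -/a De cpow_rc // -(powR_inv1 (ltW s0)) -powRrM mulN1r.
(* The powers of [mobs a] cancel and those of [Y] merge with X / Y into [X]: the total multiplier
   does not change along the induction. *)
have sh : (fun l => shear (mobw i a w) (mobw i a eta) l * cpow (mobD a (w i)) (alpha l)) = shear w eta.
  apply/funext => l; rewrite /shear radf_mobw // HXY cD -/X -cX -/a De cabs_rc gtr0_norm // mul1r.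
  transitivity (rc (powR (mobs a)^-1 (alpha l) * powR (mobs a) (alpha l)) * radf alpha 1 eta l *
    (cpow (X / Y) (- alpha l) * cpow Y (- alpha l))); first by rewrite rcM; ring.
  by rewrite -powRM ?(ltW s0) ?(ltW si0) // mulVf ?gt_eqF // powR1 rc1 mul1r.
have rh : (fun l => radf alpha (-1) (mobw i a eta) l * cpow (mobD a (eta i)) (alpha l)) = radf alpha (-1) eta.
  apply/funext => l; rewrite radf_mobw // -/a De cabs_rc gtr0_norm // cpow_rc // mulrAC -rcM.
  rewrite -powRD; last by apply/implyP => _; rewrite gt_eqF.
  by rewrite mulN1r addNr powRr0 rc1 mul1r.
split; first by move: IO; rewrite scM sh.
rewrite (kernel_mobius_U i ei a1 UP UQ) IE !scM sh rh HXY cD cDe rcJ -/X -cX.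
transitivity (rc (powR (mobs a) (k.+1%:R + A) * powR (mobs a) (- (k.+1%:R + A))) *
  (cpow (X / Y) (- (k.+1%:R + A)) * cpow Y (- (k.+1%:R + A))) *
  g (sc (shear w eta) p) (sc (radf alpha (-1) eta) q)); first by rewrite rcM; ring.
rewrite -powRD; last by apply/implyP => _; rewrite gt_eqF.
by rewrite subrr powRr0 rc1 mul1r.
Qed.
End FullKernel.

(** * The operator depends only on values near the point *)

Section OperatorLocality.
Variables (R : realType) (n : nat) (alpha : 'I_n -> R) (V : set (pt R n)).
Local Notation C := R[i].
Hypothesis oV : copen V.

Lemma Lop_ext j (F G : pt R n -> C) : holomorphic_on V G -> (forall x, V x -> F x = G x) ->
  forall x, V x -> Lop alpha j F x = Lop alpha j G x.
Proof.
move=> hG FG x Vx; rewrite /Lop (FG x Vx); congr (_ + _); apply: eq_bigr => l _; congr (_ * (_ + _ * _)).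
have [a da] := hG x Vx.
suff dF : cdiff F x a by rewrite (dz_cdiff l dF) (dz_cdiff l da).
have [d0 [d00 H0]] := oV Vx => e e0; have [d [d1 H]] := da e e0.
exists (Num.min d0 d); split; first by rewrite lt_min d00.
move=> h hd; rewrite !FG //; first by apply: H => i; have := hd i; rewrite lt_min => /andP[].
by apply: H0 => i; rewrite addrAC subrr add0r; have := hd i; rewrite lt_min => /andP[].
Qed.

(** The scaling relation between the kernels of U_eta and [Om] holds only where the points lie in
    the domains; an open set of agreement with a holomorphic function is enough for the operator. *)
Lemma Prodop_ext k (F G : pt R n -> C) : holomorphic_on V G -> (forall x, V x -> F x = G x) ->
  forall x, V x -> Prodop alpha k F x = Prodop alpha k G x.
Proof.
move=> hG FG; rewrite /Prodop; elim: (iota 1 k) => [|j s IH]; first exact: FG.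
apply: (@Lop_ext j _ (foldr (fun j acc => Lop alpha j acc) G s)) IH.
elim: s => [|i s IH]; first exact: hG.
exact: (@holomorphic_Lop R n alpha V oV i (foldr (fun j acc => Lop alpha j acc) G s) IH).
Qed.
End OperatorLocality.

Theorem theorem6 (R : realType) (n m k : nat) (Om : set (pt R (n + m)))
  (alpha : 'I_n -> R)
  (KU : pt R (n + m + k) -> pt R (n + m + k) -> R[i])
  (Keta : pt R k -> pt R (n + m) -> pt R (n + m) -> R[i]) :
  (1 <= n)%N -> (1 <= k)%N ->
  cdomain Om -> nstar_hartogs Om ->
  (forall j, 0 < alpha j) ->
  bergman_kernel (U_alpha (k:=k) Om alpha) KU ->
  (forall eta : pt R k, sqnorm eta < 1 -> bergman_kernel (U_eta Om alpha eta) (Keta eta)) ->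
  forall (z : pt R n) (z' : pt R m) (w : pt R k) (zeta : pt R n) (zeta' : pt R m) (eta : pt R k),
    U_alpha (k:=k) Om alpha (join2 (join2 z z') w) ->
    U_alpha (k:=k) Om alpha (join2 (join2 zeta zeta') eta) ->
    KU (join2 (join2 z z') w) (join2 (join2 zeta zeta') eta)
    = D_op alpha w eta
        (fun x : pt R n => Keta eta (join2 (h_map alpha x w eta) z') (join2 zeta zeta')) z.
Proof.
move=> n1 _ [oOm _] star al0 bKU bKeta z z' w zeta zeta' eta UP UQ.
set q := join2 zeta zeta' in UQ *.
have bK : bergman_kernel Om (Keta (fun=> 0)).
  have := bKeta (fun=> 0); rewrite U_eta0; apply; rewrite sqnorm0; exact: ltr01.
have [Op w1] := (U_alphaE _ _ _ _).1 UP; have [Oq e1] := (U_alphaE _ _ _ _).1 UQ.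
set A := \sum_(l < n) alpha l.
(* Here n >= 1 enters: an empty sum of exponents would be zero. *)
have A0 : 0 < A.
  rewrite /A (bigD1 (Ordinal n1)) //= ltr_wpDr // sumr_ge0 // => l _; exact: ltW.
have [Osh ->] := kernel_full star oOm al0 bKU UP UQ.
set X := 1 - herm w eta; have X0 : 0 < complex.Re X by exact: herm_re.
set q' := sc (radf alpha (-1) eta) q in Oq *.
pose c := shear alpha w eta.
have pos : 0 < 1 - sqnorm eta by rewrite subr_gt0.
(* The real Jacobian of the scaling from U_eta to [Om]; the power of 1 - |eta|^2 in [D_op] cancels
   it, as pi^k cancels the factor released by the k differentiations. *)
pose a : R := powR (1 - sqnorm eta) (- A).
have prod_a : \prod_i cabs (join2 (radf alpha (-1) eta) (fun _ : 'I_m => 1) i) ^+ 2 = a.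
  rewrite /a powRN -/(rho alpha eta) -(prod_rad m alpha e1) -prodfV; apply: eq_bigr => i _.
  case: (split_ordP i) => l ->; last by rewrite !join2_r cabs1 expr1n invr1.
  by rewrite !join2_l -radfV // cabsV exprVn.
have shE x : sc (radf alpha (-1) eta) (join2 (h_map alpha x w eta) z') = join2 (fun l => c l * x l) z'.
  rewrite sc_join; congr join2; apply/funext => l; rewrite /h_map mulrCA mulrC; congr (_ * _).
  have XV : 0 < complex.Re X^-1 by rewrite cReV divr_gt0 // exprn_gt0 // cabs_gt0 re_gt0_neq0.
  have re1 : 0 < complex.Re (rc (1 - sqnorm eta) / X) by exact: re_rc_div.
  have posV : 0 < complex.Re (rc (1 - sqnorm eta)) by [].
  have E := @cpow_mul2 R (rc (1 - sqnorm eta)) X^-1 (rc (1 - sqnorm eta) / X) 1 (alpha l) posV XV re1 ltr01.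
  rewrite rc1 mul1r powR1 rc1 mul1r in E; rewrite -E // cpow_rc // /c /shear -/X.
  rewrite mulrA (_ : radf alpha (-1) eta l * _ = radf alpha 1 eta l); last first.
    rewrite /radf -rcM -powRD; last by apply/implyP => _; rewrite gt_eqF.
    by congr (rc (powR _ _)); field.
  congr (_ * _); rewrite cpowV //; apply: (mulfI (cpow_neq0 (alpha l) (re_gt0_neq0 X0))).
  by rewrite -cpowD ?re_gt0_neq0 // subrr cpow0 ?re_gt0_neq0 // divff // cpow_neq0 // re_gt0_neq0.
have UetaE p : U_eta Om alpha eta p <-> Om (fun i => join2 (radf alpha (-1) eta) (fun _ : 'I_m => 1) i * p i).
  rewrite /U_eta U_alphaE; split => [[]|] //.
(* This turns the argument of the operator into the kernel of [Om] composed with a diagonal map in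
   [x]. *)
have KE x : Om (join2 (fun l => c l * x l) z') ->
    Keta eta (join2 (h_map alpha x w eta) z') q = rc a * Keta (fun=> 0) (join2 (fun l => c l * x l) z') q'.
  move=> Ox; rewrite mulrC -prod_a -shE.
  have oE : copen (U_eta Om alpha eta) by exact: copenU_eta.
  apply: (@kernel_diag R (n + m) (U_eta Om alpha eta) Om (join2 (radf alpha (-1) eta) (fun _ : 'I_m => 1))
    (Keta eta) (Keta (fun=> 0)) _ _ oE oOm _ UetaE (bKeta eta e1) bK).
  - by move=> i; case: (split_ordP i) => l ->; rewrite ?join2_l ?join2_r ?oner_eq0 // radf_neq0.
  - by apply/UetaE; rewrite -/(sc _ _) shE.
  - exact/UetaE.
have shP : sc c (join2 z z') = join2 (fun l => c l * z l) z' by rewrite sc_join.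
rewrite -/c shP in Osh *.
pose V := [set x : pt R n | Om (join2 (fun l => c l * x l) z')].
pose G x := rc a * Keta (fun=> 0) (join2 (fun l => c l * x l) z') q'.
have hF (O : set (pt R n)) i : holomorphic_on O (fun x => (join2 (fun l => c l * x l) z' : pt R (n + m)) i).
  case: (split_ordP i) => j ->.
    rewrite (_ : (fun x => _) = fun x : pt R n => c j * x j).
      by apply: holomorphicM; [exact: holomorphic_cst|exact: holomorphic_coord].
    by apply/funext => x; rewrite join2_l.
  rewrite (_ : (fun x => _) = fun=> z' j); first exact: holomorphic_cst.
  by apply/funext => x; rewrite join2_r.
have oV : copen V.
  have oT : copen (setT : set (pt R n)) by move=> x _; exists 1.
  rewrite (_ : V = setT `&` [set x | Om (join2 (fun l => c l * x l) z')]); last by rewrite setTI.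
  by apply: copen_preimage => // x _ i; exact: (holomorphic_ccont (hF setT i)).
have hG : holomorphic_on V G.
  apply: holomorphicM; first exact: holomorphic_cst.
  have [[hK _] _] := bK _ Oq.
  exact: (holomorphic_comp (V := Om) (f := fun x => Keta (fun=> 0) x q') _ (hF V) hK).
rewrite /D_op (Prodop_ext alpha oV k hG KE Osh).
rewrite (Prodop_kernel star oOm al0 bKU bK A0 a Osh Oq) -/A -/X.
have Xe e : cpow X (- e) = (cpow X e)^-1.
  have Xn := re_gt0_neq0 X0; apply: (mulfI (cpow_neq0 e Xn)).
  by rewrite -cpowD // subrr cpow0 // divff // cpow_neq0.
have ra : rc (powR (1 - sqnorm eta) A) * rc a = 1.
  rewrite /a -rcM -powRD ?subrr ?powRr0 //; by apply/implyP => _; rewrite gt_eqF.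
have pn0 : rc (pi ^+ k : R) != 0 by rewrite rc_eq0 expf_neq0 // gt_eqF // pi_gt0.
have cn0 := cpow_neq0 (k.+1%:R + A) (re_gt0_neq0 X0).
rewrite Xe rcM; set g := kernel0 _ _ _.
transitivity (rc (powR (1 - sqnorm eta) A) * rc a * ((cpow X (k.+1%:R + A))^-1 * g)); first by rewrite ra mul1r.
by field; rewrite pn0 cn0.
Qed.
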